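(* Suppose $P$ is a convex planar $n$-gon in $\mathbb{R}^3$ with unit-length sides and turning angles in $[0,2\pi/3]$. Let $L_0$ be the outer parallel curve at distance $1$ from $P$ (in the plane of $P$), and let $L_1,\dots,L_n$ be unit circles, perpendicular to the plane of $P$, passing through the vertices of $P$ (one for each vertex), and centered at points on $L_0$. Then the link $L=L_0\cup L_1\cup\dots\cup L_n$ is a configuration of $H(T_n)$ with link-thickness $1$ that is critical for link-ropelength.
   Context: The $n$-gon may have vertices with turning angle $0$. $T_n$ is the $n$-star, the tree with a central vertex incident to all $n$ edges. For a tree $T$ with $n$ edges, $H(T)$ is the link that is a connected sum of $n$ Hopf links and whose associated graph (vertices are components, edges record nontrivially linked pairs) is $T$; thus $H(T_n)$ has a central component forming a Hopf link with each of $n$ others. For a rectifiable link $L$ (closed curve with disjoint components, parametrized by arclength $s$, with unit tangent $T$), the link-thickness $\mathrm{LThi}(L)$ is the minimum distance between points on different components. For an $\mathbb{R}^3$-valued vector field $\xi$ along $L$ that is a smooth function of arclength, $\delta_\xi\mathrm{Len}(L)=\int_L\langle T,d\xi/ds\rangle\,ds$ and $\delta^+_\xi\mathrm{LThi}(L)=\frac{d}{dt^+}\big|_{t=0}\mathrm{LThi}(L+t\xi)$. $L$ is critical for link-ropelength if every such $\xi$ with $\delta_\xi\mathrm{Len}(L)<0$ has $\delta^+_\xi\mathrm{LThi}(L)<0$. *)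

(* Defs.v *)
From HB Require Import structures.
From mathcomp Require Import all_boot all_order all_algebra.
From mathcomp Require Import all_classical all_reals all_analysis.

Set Implicit Arguments.
Unset Strict Implicit.
Unset Printing Implicit Defensive.

Import Order.TTheory GRing.Theory Num.Theory.
Import numFieldNormedType.Exports.

Local Open Scope classical_set_scope.
Local Open Scope ring_scope.

(* The library norm `|x| on 'rV[R]_3 is the sup norm, so the Euclidean
   structure is spelled out; the topology of 'rV[R]_3 is the usual one. *)

Definition dot (R : realType) (x y : 'rV[R]_3) : R :=
  \sum_(i < 3) x 0 i * y 0 i.

Definition enorm (R : realType) (x : 'rV[R]_3) : R := Num.sqrt (dot x x).

Definition unit_vec (R : realType) (k : 'I_3) : 'rV[R]_3 := delta_mx 0 k.

Definition dist_to_set (R : realType) (x : 'rV[R]_3) (S : set 'rV[R]_3) : R :=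
  inf [set enorm (x - y) | y in S].

Definition segment (R : realType) (p q : 'rV[R]_3) : set 'rV[R]_3 :=
  [set (1 - t) *: p + t *: q | t in [set t : R | 0 <= t <= 1]].

(* Unit circle centered at c in the plane through c orthogonal to w != 0. *)
Definition unit_circle (R : realType) (c w : 'rV[R]_3) : set 'rV[R]_3 :=
  [set x | enorm (x - c) = 1 /\ dot w (x - c) = 0].

(* ---- Polygons: vertices are indexed cyclically, side i goes from v i to
   v (ordS i). ---- *)

Definition side (R : realType) (n : nat) (v : 'I_n -> 'rV[R]_3) (i : 'I_n)
  : 'rV[R]_3 := v (ordS i) - v i.

(* The closed polygonal path is traversed injectively; adjacent sides may be
   collinear (turning angle 0). *)
Definition simple_polygon (R : realType) (n : nat) (v : 'I_n -> 'rV[R]_3) :=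
  forall (i j : 'I_n) (s t : R), 0 <= s < 1 -> 0 <= t < 1 ->
    v i + s *: side v i = v j + t *: side v j -> i = j /\ s = t.

(* Simple polygon in a plane with unit normal u, lying on one side of the line
   spanned by each of its sides (k is an outer normal of side i). *)
Definition convex_planar_polygon (R : realType) (n : nat) (u : 'rV[R]_3)
    (v : 'I_n -> 'rV[R]_3) :=
  [/\ simple_polygon v,
      enorm u = 1,
      forall i j, dot u (v j - v i) = 0 &
      forall i, exists k : 'rV[R]_3,
        [/\ k != 0, dot u k = 0, dot (side v i) k = 0 &
            forall j, dot k (v j - v i) <= 0]].

Definition turning_angle (R : realType) (n : nat) (v : 'I_n -> 'rV[R]_3)
    (i : 'I_n) : R :=
  acos (dot (side v (ord_pred i)) (side v i)
        / (enorm (side v (ord_pred i)) * enorm (side v i))).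

(* The convex region bounded by a convex polygon. *)
Definition polygon_region (R : realType) (n : nat) (v : 'I_n -> 'rV[R]_3)
    : set 'rV[R]_3 :=
  [set x | exists a : 'I_n -> R,
     [/\ forall i, 0 <= a i, \sum_i a i = 1 & x = \sum_i a i *: v i]].

(* Points at distance d from the region are the points outside the polygon at
   distance d from it. *)
Definition outer_parallel_curve (R : realType) (n : nat) (u : 'rV[R]_3)
    (v : 'I_n -> 'rV[R]_3) (d : R) : set 'rV[R]_3 :=
  [set x | (forall i, dot u (x - v i) = 0) /\ dist_to_set x (polygon_region v) = d].

(* ---- Rectifiable closed curves parametrized by arclength ---- *)

Definition curve_length (R : realType) (g : R -> 'rV[R]_3) (a b : R) : \bar R :=
  ereal_sup [set (let p := nth b (a :: s) in
                  \sum_(0 <= k < size s) enorm (g (p k.+1) - g (p k)))%:E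
            | s in itv_partition a b].

Definition arclength_closed_curve (R : realType) (l : R)
    (g : R -> 'rV[R]_3) :=
  [/\ 0 < l, periodic g l &
      forall a b, a < b -> curve_length g a b = (b - a)%:E].

Definition simple_arclength_param (R : realType) (S : set 'rV[R]_3) (l : R)
    (g : R -> 'rV[R]_3) :=
  [/\ arclength_closed_curve l g,
      forall s t, 0 <= s < l -> 0 <= t < l -> g s = g t -> s = t &
      range g = S].

(* ---- Link types. A link is the family of its components, as sets. ---- *)

Definition homeo (R : realType) (h : 'rV[R]_3 -> 'rV[R]_3) :=
  continuous h /\
  exists h' : 'rV[R]_3 -> 'rV[R]_3,
    [/\ continuous h', cancel h h' & cancel h' h].

Definition ambient_isotopic (R : realType) (I : Type)
    (L L' : I -> set 'rV[R]_3) :=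
  exists H : R -> 'rV[R]_3 -> 'rV[R]_3,
    [/\ {within [set z : R * 'rV[R]_3 | 0 <= z.1 <= 1],
           continuous (fun z : R * 'rV[R]_3 => H z.1 z.2)},
        forall t, 0 <= t <= 1 -> homeo (H t),
        forall x, H 0 x = x &
        forall i, H 1 @` L i = L' i].

(* Standard Hopf link: the unit circle of the xy-plane about the origin and
   the unit circle of the xz-plane about (1,0,0). *)
Definition std_hopf (R : realType) (b : bool) : set 'rV[R]_3 :=
  if b then unit_circle 0 (unit_vec R (inord 2))
  else unit_circle (unit_vec R (inord 0)) (unit_vec R (inord 1)).

Definition xcoord (R : realType) (x : 'rV[R]_3) : R := dot (unit_vec R (inord 0)) x.

(* C is the connected sum of A and B along their components a and b, in
   decomposed position: the plane {x = 0} meets C only at two points p and q of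
   the common component, which crosses it there along straight orthogonal
   segments. Cutting C along the plane and closing each half of the common
   component by the segment [p, q] gives A on the left and B on the right.
   The injections f and g label the components of A and B inside C. *)
Definition decomposed_sum (R : realType) (I J K : Type)
    (A : I -> set 'rV[R]_3) (B : J -> set 'rV[R]_3) (C : K -> set 'rV[R]_3) :=
  exists (f : I -> K) (g : J -> K) (a : I) (b : J) (p q : 'rV[R]_3) (eps : R),
    [/\ [/\ injective f, injective g, f a = g b,
            forall i j, f i = g j -> i = a /\ j = b &
            forall k, (exists i, f i = k) \/ (exists j, g j = k)],
        [/\ xcoord p = 0, xcoord q = 0, p != q, 0 < eps &
            C (f a) `&` [set x | `|xcoord x| <= eps] =
            [set z + t *: unit_vec R (inord 0)
              | z in [set p; q] & t in [set t : R | `|t| <= eps]]],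
        A a = (C (f a) `&` [set x | xcoord x <= 0]) `|` segment p q /\
        B b = (C (g b) `&` [set x | 0 <= xcoord x]) `|` segment p q,
        forall i, i <> a -> A i = C (f i) /\ A i `<=` [set x | xcoord x < 0] &
        forall j, j <> b -> B j = C (g j) /\ B j `<=` [set x | 0 < xcoord x]].

(* hopf_sum n L: the link L is, up to ambient isotopy, a connected sum of n
   Hopf links. *)
Inductive hopf_sum (R : realType) :
    forall (n : nat) (I : finType), (I -> set 'rV[R]_3) -> Prop :=
| hopf_sum1 (I : finType) (L : I -> set 'rV[R]_3) (f : bool -> I) :
    bijective f -> ambient_isotopic (@std_hopf R) (L \o f) ->
    @hopf_sum R 1 I L
| hopf_sumD (m n : nat) (I J K : finType) (A : I -> set 'rV[R]_3)
    (B : J -> set 'rV[R]_3) (C : K -> set 'rV[R]_3) :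
    @hopf_sum R m I A -> @hopf_sum R n J B -> decomposed_sum A B C ->
    @hopf_sum R (m + n) K C
| hopf_sum_isotopic (n : nat) (I : finType) (L L' : I -> set 'rV[R]_3) :
    @hopf_sum R n I L -> ambient_isotopic L L' -> @hopf_sum R n I L'.

(* A two-component link is split if some ambient isotopy moves its components
   to opposite sides of a plane. *)
Definition split_pair (R : realType) (X Y : set 'rV[R]_3) :=
  exists (X' Y' : set 'rV[R]_3) (w : 'rV[R]_3) (d : R),
    [/\ ambient_isotopic (fun b : bool => if b then X else Y)
                         (fun b : bool => if b then X' else Y'),
        forall x, X' x -> dot w x < d &
        forall y, Y' y -> d < dot w y].

Definition linked_components (R : realType) (I : Type) (L : I -> set 'rV[R]_3)
    (i j : I) := i <> j /\ ~ split_pair (L i) (L j).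

(* L is a configuration of H(T), for a tree T with n edges whose vertices
   0, ..., n label the components of L and whose adjacency relation is e. *)
Definition is_H (R : realType) (n : nat) (e : rel 'I_n.+1)
    (L : 'I_n.+1 -> set 'rV[R]_3) :=
  hopf_sum n L /\ forall i j, e i j <-> linked_components L i j.

(* The star T_n, with central vertex 0. *)
Definition star (n : nat) : rel 'I_n.+1 :=
  fun i j => (i == ord0) (+) (j == ord0).

(* ---- Link-thickness and link-ropelength criticality ---- *)

Definition LThi (R : realType) (m : nat) (L : 'I_m -> set 'rV[R]_3) : R :=
  inf [set r | exists i j x y,
         [/\ i != j, L i x, L j y & r = enorm (x - y)]].

Definition smooth (R : realType) (f : R -> 'rV[R]_3) :=
  forall (k : nat) (s : R), derivable (derive1n k f) s 1.

(* A vector field along the link gamma with component lengths l is given on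
   each component as a periodic function of arclength. *)
Definition smooth_field (R : realType) (m : nat) (l : 'I_m -> R)
    (xi : 'I_m -> R -> 'rV[R]_3) :=
  forall i, smooth (xi i) /\ periodic (xi i) (l i).

(* The unit tangent derive1 (gamma i) exists almost everywhere. *)
Definition delta_Len (R : realType) (m : nat) (l : 'I_m -> R)
    (gamma xi : 'I_m -> R -> 'rV[R]_3) : R :=
  \sum_(i < m) \int[@lebesgue_measure R]_(s in `[0, l i])
     dot (derive1 (gamma i) s) (derive1 (xi i) s).

Definition perturb (R : realType) (m : nat) (gamma xi : 'I_m -> R -> 'rV[R]_3)
    (t : R) (i : 'I_m) : set 'rV[R]_3 :=
  range (fun s => gamma i s + t *: xi i s).

Definition is_delta_LThi (R : realType) (m : nat)
    (gamma xi : 'I_m -> R -> 'rV[R]_3) (d : R) :=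
  t^-1 * (LThi (perturb gamma xi t) - LThi (fun i => range (gamma i)))
    @[t --> 0^'+] --> d.

Definition link_critical (R : realType) (m : nat) (l : 'I_m -> R)
    (gamma : 'I_m -> R -> 'rV[R]_3) :=
  forall xi : 'I_m -> R -> 'rV[R]_3, smooth_field l xi ->
    delta_Len l gamma xi < 0 ->
    exists2 d, is_delta_LThi gamma xi d & d < 0.

(* Main.v *)
Require Import Defs.
From HB Require Import structures.
From mathcomp Require Import all_boot all_order all_algebra.
From mathcomp Require Import all_classical all_reals all_analysis.
From mathcomp Require Import ring lra.
Set Implicit Arguments.
Unset Strict Implicit.
Unset Printing Implicit Defensive.
Import Order.TTheory GRing.Theory Num.Theory.
Import numFieldNormedType.Exports.
Local Open Scope classical_set_scope.
Local Open Scope ring_scope.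

(** The angle hypothesis and convexity force distinct vertices to be at distance
    at least 1. The outer parallel curve carries the unit normal x - pr x, with pr
    the nearest-point projection on the polygon, and a meridian circle lies in a
    normal plane of the polygon at a vertex; comparing supporting planes gives
    thickness 1, and the struts are the unit segments from a vertex to its
    arc of the parallel curve, and between consecutive circles.

    For criticality, the one-sided derivative of the thickness is an infimum over
    near-struts (Danskin). If it is not negative, then every strut is
    not shortened to first order; transporting the field of one component to
    the other one along the struts gives a field B with <x - pr x, xi - B> of
    one sign on the arcs, and with B stretching along the straight parts. Hence
    <gamma', xi - B> grows at most as fast as the integral of <gamma', xi'>, and
    by periodicity the first variation of length is nonnegative.

    For the link type, x + t pr x spreads the vertices apart and leaves the circles
    rigid. In a generic direction the marked points are then far apart, and the
    plane curve can be cut between them, after a radial deformation that makes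
    the crossing straight, until only Hopf links remain. Linking of the central
    curve with a circle is a winding number argument. *)

(** * Euclidean geometry of three-space *)

(** The bound 2 pi / 3 is used as cos >= -1/2 for the turn between consecutive unit sides: two such
    sides then add up to a vector of length at least 1, and they are never opposite. Both facts are
    what the distance bound between vertices rests on. The curves are parametrized by arclength only
    in the sense of polygonal length, and the curvature of L_0 jumps where an arc meets a straight
    part. Tangents are therefore produced from a 1-Lipschitz unit normal instead of being assumed,
    and the first variation is run through difference estimates: neither a second derivative of the
    curve nor a derivative of the transported field is ever taken. A decomposing plane has to meet
    the link in two straight orthogonal strands of one component. Circles of diameter 2 hung on
    vertices that may be only 1 apart leave no room for such a plane, which is why the vertices are
    spread. The spreading is invertible because a nearest-point projection does not change along its
    normal rays. *)

Lemma ord3_ind (P : 'I_3 -> Prop) : P 0 -> P 1 -> P 2%:R -> forall i, P i.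
Proof.
move=> h0 h1 h2 [[|[|[|//]]] i].
- by rewrite (_ : Ordinal i = 0) //; exact: val_inj.
- by rewrite (_ : Ordinal i = 1) //; exact: val_inj.
- by rewrite (_ : Ordinal i = 2%:R) //; exact: val_inj.
Qed.

Lemma rV3P (R : realType) (x y : 'rV[R]_3) :
  x 0 0 = y 0 0 -> x 0 1 = y 0 1 -> x 0 2%:R = y 0 2%:R -> x = y.
Proof. by move=> h0 h1 h2; apply/rowP; elim/ord3_ind. Qed.

Lemma dotE (R : realType) (x y : 'rV[R]_3) :
  dot x y = x 0 0 * y 0 0 + x 0 1 * y 0 1 + x 0 2%:R * y 0 2%:R.
Proof.
rewrite /dot !big_ord_recl big_ord0 addr0 addrA.
by congr (_ * _ + _ * _ + _ * _); congr (_ _ _); exact: val_inj.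
Qed.

Lemma dotC (R : realType) (x y : 'rV[R]_3) : dot x y = dot y x.
Proof. by apply: eq_bigr => i _; rewrite mulrC. Qed.

Lemma dotDl (R : realType) (x y z : 'rV[R]_3) : dot (x + y) z = dot x z + dot y z.
Proof. by rewrite !dotE !mxE; ring. Qed.

Lemma dotDr (R : realType) (x y z : 'rV[R]_3) : dot x (y + z) = dot x y + dot x z.
Proof. by rewrite !dotE !mxE; ring. Qed.

Lemma dotNl (R : realType) (x y : 'rV[R]_3) : dot (- x) y = - dot x y.
Proof. by rewrite !dotE !mxE; ring. Qed.

Lemma dotNr (R : realType) (x y : 'rV[R]_3) : dot x (- y) = - dot x y.
Proof. by rewrite !dotE !mxE; ring. Qed.

Lemma dotZl (R : realType) a (x y : 'rV[R]_3) : dot (a *: x) y = a * dot x y.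
Proof. by rewrite !dotE !mxE; ring. Qed.

Lemma dotZr (R : realType) a (x y : 'rV[R]_3) : dot x (a *: y) = a * dot x y.
Proof. by rewrite !dotE !mxE; ring. Qed.

Lemma dot0l (R : realType) (x : 'rV[R]_3) : dot 0 x = 0.
Proof. by rewrite !dotE !mxE; ring. Qed.

Lemma dot0r (R : realType) (x : 'rV[R]_3) : dot x 0 = 0.
Proof. by rewrite !dotE !mxE; ring. Qed.

Definition dotL := (dotDl, dotDr, dotNl, dotNr, dotZl, dotZr, dot0l, dot0r).

Lemma dot_suml (R : realType) (I : Type) (r : seq I) (P : pred I)
    (F : I -> 'rV[R]_3) y :
  dot (\sum_(i <- r | P i) F i) y = \sum_(i <- r | P i) dot (F i) y.
Proof.
by apply: (big_morph (fun x => dot x y)) => [a b|]; rewrite ?dotDl ?dot0l.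
Qed.

Lemma dot_sumr (R : realType) (I : Type) (r : seq I) (P : pred I)
    (F : I -> 'rV[R]_3) y :
  dot y (\sum_(i <- r | P i) F i) = \sum_(i <- r | P i) dot y (F i).
Proof. by rewrite dotC dot_suml; apply: eq_bigr => i _; rewrite dotC. Qed.

Lemma dotxx_ge0 (R : realType) (x : 'rV[R]_3) : 0 <= dot x x.
Proof. by rewrite dotE -!expr2 !addr_ge0 ?sqr_ge0. Qed.

Lemma dotxx_eq0 (R : realType) (x : 'rV[R]_3) : dot x x = 0 -> x = 0.
Proof.
rewrite dotE -!expr2 => h.
have h0 := sqr_ge0 (x 0 0); have h1 := sqr_ge0 (x 0 1).
have h2 := sqr_ge0 (x 0 2%:R).
by apply: rV3P; rewrite mxE; apply/eqP; rewrite -sqrf_eq0; apply/eqP; lra.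
Qed.

Lemma enorm_ge0 (R : realType) (x : 'rV[R]_3) : 0 <= enorm x.
Proof. exact: sqrtr_ge0. Qed.

Lemma enorm2 (R : realType) (x : 'rV[R]_3) : enorm x ^+ 2 = dot x x.
Proof. by rewrite sqr_sqrtr // dotxx_ge0. Qed.

Lemma enorm0 (R : realType) : enorm (0 : 'rV[R]_3) = 0.
Proof. by rewrite /enorm dot0l sqrtr0. Qed.

Lemma enorm_eq0 (R : realType) (x : 'rV[R]_3) : enorm x = 0 -> x = 0.
Proof. by move=> h; apply: dotxx_eq0; rewrite -enorm2 h expr0n. Qed.

Lemma enorm_gt0 (R : realType) (x : 'rV[R]_3) : x != 0 -> 0 < enorm x.
Proof.
move=> h; rewrite lt_neqAle enorm_ge0 andbT eq_sym.
by apply: contra h => /eqP /enorm_eq0 ->.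
Qed.

Lemma enorm1 (R : realType) (x : 'rV[R]_3) : enorm x = 1 <-> dot x x = 1.
Proof.
split=> [h|h]; first by rewrite -enorm2 h expr1n.
by rewrite /enorm h sqrtr1.
Qed.

Lemma enormN (R : realType) (x : 'rV[R]_3) : enorm (- x) = enorm x.
Proof. by rewrite /enorm !dotL opprK. Qed.

Lemma enormB (R : realType) (x y : 'rV[R]_3) : enorm (x - y) = enorm (y - x).
Proof. by rewrite -enormN opprB. Qed.

Lemma enormZ (R : realType) a (x : 'rV[R]_3) : enorm (a *: x) = `|a| * enorm x.
Proof. by rewrite /enorm !dotL mulrA -expr2 sqrtrM ?sqr_ge0 // sqrtr_sqr. Qed.

Lemma enorm_le (R : realType) (x : 'rV[R]_3) a :
  0 <= a -> (enorm x <= a) = (dot x x <= a ^+ 2).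
Proof. by move=> a0; rewrite -enorm2 ler_pXn2r ?nnegrE ?enorm_ge0. Qed.

Lemma enorm_ge (R : realType) (x : 'rV[R]_3) a :
  0 <= a -> (a <= enorm x) = (a ^+ 2 <= dot x x).
Proof. by move=> a0; rewrite -enorm2 ler_pXn2r ?nnegrE ?enorm_ge0. Qed.

Lemma enorm_lt (R : realType) (x : 'rV[R]_3) a :
  0 <= a -> (enorm x < a) = (dot x x < a ^+ 2).
Proof. by move=> a0; rewrite ltNge enorm_ge // -ltNge. Qed.

Lemma dot_sqr_le (R : realType) (x y : 'rV[R]_3) :
  dot x y ^+ 2 <= dot x x * dot y y.
Proof.
rewrite -subr_ge0 !dotE.
set a := x 0 0; set b := x 0 1; set c := x 0 2%:R.
set d := y 0 0; set e := y 0 1; set f := y 0 2%:R.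
rewrite [leRHS](_ : _ = (a * e - b * d) ^+ 2 + (a * f - c * d) ^+ 2 +
  (b * f - c * e) ^+ 2); last ring.
by rewrite !addr_ge0 ?sqr_ge0.
Qed.

Lemma dot_le (R : realType) (x y : 'rV[R]_3) : `|dot x y| <= enorm x * enorm y.
Proof.
rewrite -(@ler_pXn2r _ 2) ?nnegrE ?mulr_ge0 ?enorm_ge0 //.
by rewrite real_normK ?num_real // exprMn !enorm2 dot_sqr_le.
Qed.

Lemma dot_ub (R : realType) (x y : 'rV[R]_3) : dot x y <= enorm x * enorm y.
Proof. exact: le_trans (ler_norm _) (dot_le _ _). Qed.

Lemma dot_lb (R : realType) (x y : 'rV[R]_3) : - (enorm x * enorm y) <= dot x y.
Proof. by have := dot_le x y; rewrite ler_norml => /andP[]. Qed.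

Lemma enormD (R : realType) (x y : 'rV[R]_3) : enorm (x + y) <= enorm x + enorm y.
Proof.
rewrite enorm_le ?addr_ge0 ?enorm_ge0 //.
have := dot_ub x y; have := enorm2 x; have := enorm2 y.
rewrite !dotL (dotC y x); nra.
Qed.

Lemma enorm_tri (R : realType) (x y z : 'rV[R]_3) :
  enorm (x - z) <= enorm (x - y) + enorm (y - z).
Proof. by apply: le_trans (enormD _ _); rewrite subrKA. Qed.

Lemma enorm_dist (R : realType) (x y : 'rV[R]_3) :
  `|enorm x - enorm y| <= enorm (x - y).
Proof.
rewrite ler_norml; have := enorm_tri x y 0; have := enorm_tri y x 0.
rewrite !subr0 (enormB y x); lra.
Qed.

Lemma coord_le_enorm (R : realType) (x : 'rV[R]_3) i : `|x 0 i| <= enorm x.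
Proof.
rewrite -(@ler_pXn2r _ 2) ?nnegrE ?enorm_ge0 // real_normK ?num_real //.
rewrite enorm2 /dot (bigD1 i) //= -expr2 lerDl.
by apply: sumr_ge0 => j _; rewrite -expr2 sqr_ge0.
Qed.

Lemma norm_le_enorm (R : realType) (x : 'rV[R]_3) : `|x| <= enorm x.
Proof.
rewrite [leLHS]mx_normrE; apply: bigmax_le; first exact: enorm_ge0.
by move=> [i j] _ /=; rewrite ord1 coord_le_enorm.
Qed.

Lemma enorm_le_norm (R : realType) (x : 'rV[R]_3) : enorm x <= 2 * `|x|.
Proof.
have hc i : x 0 i * x 0 i <= `|x| ^+ 2.
  rewrite -expr2 -real_normK ?num_real // ler_pXn2r ?nnegrE //.
  rewrite [leRHS]mx_normrE.
  exact: (le_bigmax _ (fun ij : 'I_1 * 'I_3 => `|x ij.1 ij.2|) (0, i)).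
rewrite enorm_le ?mulr_ge0 // dotE.
have := hc 0; have := hc 1; have := hc 2%:R; have := sqr_ge0 `|x|; nra.
Qed.

Definition vec3 (R : realType) (a b c : R) : 'rV[R]_3 :=
  \row_i (if i == 0 then a else if i == 1 then b else c).

Lemma vec3E0 (R : realType) (a b c : R) : vec3 a b c 0 0 = a.
Proof. by rewrite mxE. Qed.
Lemma vec3E1 (R : realType) (a b c : R) : vec3 a b c 0 1 = b.
Proof. by rewrite mxE. Qed.
Lemma vec3E2 (R : realType) (a b c : R) : vec3 a b c 0 2%:R = c.
Proof. by rewrite mxE. Qed.
Definition vec3E := (vec3E0, vec3E1, vec3E2).

Definition cross (R : realType) (x y : 'rV[R]_3) : 'rV[R]_3 :=
  vec3 (x 0 1 * y 0 2%:R - x 0 2%:R * y 0 1)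
       (x 0 2%:R * y 0 0 - x 0 0 * y 0 2%:R)
       (x 0 0 * y 0 1 - x 0 1 * y 0 0).

Lemma crossDr (R : realType) (x y z : 'rV[R]_3) : cross x (y + z) = cross x y + cross x z.
Proof. by apply: rV3P; rewrite !mxE /=; ring. Qed.
Lemma crossNr (R : realType) (x y : 'rV[R]_3) : cross x (- y) = - cross x y.
Proof. by apply: rV3P; rewrite !mxE /=; ring. Qed.
Lemma crossZr (R : realType) a (x y : 'rV[R]_3) : cross x (a *: y) = a *: cross x y.
Proof. by apply: rV3P; rewrite !mxE /=; ring. Qed.
Lemma dot_crossl (R : realType) (x y : 'rV[R]_3) : dot x (cross x y) = 0.
Proof. by rewrite dotE !mxE /=; ring. Qed.
Lemma dot_crossr (R : realType) (x y : 'rV[R]_3) : dot y (cross x y) = 0.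
Proof. by rewrite dotE !mxE /=; ring. Qed.
Lemma dot_cross2 (R : realType) (u x y : 'rV[R]_3) :
  dot (cross u x) (cross u y) = dot u u * dot x y - dot u x * dot u y.
Proof. by rewrite !dotE !mxE /=; ring. Qed.
Lemma cross_cross (R : realType) (u x : 'rV[R]_3) :
  cross u (cross u x) = dot u x *: u - dot u u *: x.
Proof. by apply: rV3P; rewrite !dotE !mxE /=; ring. Qed.
Lemma dot_crossC (R : realType) (u x y : 'rV[R]_3) :
  dot (cross u x) y = - dot (cross u y) x.
Proof. by rewrite !dotE !mxE /=; ring. Qed.

Lemma plane_decomp (R : realType) (u nu x : 'rV[R]_3) :
  dot u u = 1 -> dot nu nu = 1 -> dot u nu = 0 -> dot u x = 0 ->
  x = dot x nu *: nu + dot x (cross u nu) *: cross u nu.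
Proof.
move=> huu hnn hun hux; apply/eqP; rewrite -subr_eq0; apply/eqP.
set y := (X in X = 0); have e1 : dot y nu = 0.
  by rewrite /y !dotL hnn [dot (cross _ _) nu]dotC dot_crossr; ring.
have e2 : dot y (cross u nu) = 0.
  by rewrite /y !dotL dot_cross2 huu hnn hun dot_crossr; ring.
have e3 : dot u y = 0 by rewrite /y !dotL hux hun dot_crossl; ring.
(* Gram determinant of [u], [nu], [y], the square of their triple product; as all mixed products
   vanish it reduces to the squared length of [y]. *)
have gram : dot y (cross u nu) ^+ 2 =
    dot u u * dot nu nu * dot y y + 2 * dot u nu * dot y nu * dot u y
    - dot u u * dot y nu ^+ 2 - dot nu nu * dot u y ^+ 2 - dot y y * dot u nu ^+ 2.
  by rewrite !dotE !mxE /=; ring.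
by apply: dotxx_eq0; move: gram; rewrite huu hnn hun e1 e2 e3; lra.
Qed.

(** * Continuity expressed in the Euclidean norm *)

Lemma near_dist (R : realType) (V : normedModType R) (x : V) e :
  0 < e -> \forall y \near x, `|x - y| < e.
Proof. by move=> e0; have /cvgrPdist_lt := @cvg_id _ (nbhs x); apply. Qed.

Lemma cont_dist (R : realType) (V W : normedModType R) (f : V -> W) (x : V) :
  (forall e, 0 < e -> exists2 d, 0 < d & forall y, `|x - y| < d -> `|f x - f y| < e) ->
  {for x, continuous f}.
Proof.
move=> h; apply/cvgrPdist_lt => e e0; have [d d0 hd] := h e e0.
by near=> y; apply: hd; near: y; apply: near_dist.
Unshelve. all: by end_near. Qed.

Lemma econt (R : realType) (f : 'rV[R]_3 -> 'rV[R]_3) :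
  (forall x e, 0 < e -> exists2 d, 0 < d &
     forall y, enorm (x - y) < d -> enorm (f x - f y) < e) -> continuous f.
Proof.
move=> h x; apply: cont_dist => e e0; have [d d0 hd] := h x e e0.
exists (d / 2); first by rewrite divr_gt0.
move=> y hy; apply: le_lt_trans (norm_le_enorm _) _; apply: hd.
by apply: le_lt_trans (enorm_le_norm _) _; rewrite mulrC -ltr_pdivlMr.
Qed.

Lemma econtr (R : realType) (f : 'rV[R]_3 -> R) :
  (forall x e, 0 < e -> exists2 d, 0 < d &
     forall y, enorm (x - y) < d -> `|f x - f y| < e) -> continuous f.
Proof.
move=> h x; apply: cont_dist => e e0; have [d d0 hd] := h x e e0.
exists (d / 2); first by rewrite divr_gt0.
move=> y hy; apply: hd.
by apply: le_lt_trans (enorm_le_norm _) _; rewrite mulrC -ltr_pdivlMr.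
Qed.

Lemma coord_cont (R : realType) (i : 'I_3) : continuous (fun x : 'rV[R]_3 => x 0 i).
Proof. exact: coord_continuous. Qed.

Lemma elip (R : realType) (f : 'rV[R]_3 -> 'rV[R]_3) (k : R) : 0 < k ->
  (forall x y, enorm (f x - f y) <= k * enorm (x - y)) -> continuous f.
Proof.
move=> k0 h; apply: econt => x e e0; exists (e / k); first by rewrite divr_gt0.
by move=> y; rewrite ltr_pdivlMr // mulrC; apply: le_lt_trans.
Qed.

Lemma elipr (R : realType) (f : 'rV[R]_3 -> R) (k : R) : 0 < k ->
  (forall x y, `|f x - f y| <= k * enorm (x - y)) -> continuous f.
Proof.
move=> k0 h; apply: econtr => x e e0; exists (e / k); first by rewrite divr_gt0.
by move=> y; rewrite ltr_pdivlMr // mulrC; apply: le_lt_trans.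
Qed.

Lemma enorm_cont (R : realType) : continuous (@enorm R).
Proof. by apply: (@elipr _ _ 1) => // x y; rewrite mul1r enorm_dist. Qed.

Lemma dot_cont (T : topologicalType) (R : realType) (f g : T -> 'rV[R]_3) (x : T) :
  {for x, continuous f} -> {for x, continuous g} ->
  {for x, continuous (fun z => dot (f z) (g z))}.
Proof.
move=> hf hg; rewrite (_ : (fun z => _) = (fun z => f z 0 0 * g z 0 0 +
  f z 0 1 * g z 0 1 + f z 0 2%:R * g z 0 2%:R)); last first.
  by apply/funext => z; rewrite dotE.
have hc (k : T -> 'rV[R]_3) i : {for x, continuous k} ->
    {for x, continuous (fun z => k z 0 i)}.
  by move=> hk; apply: (@continuous_comp _ _ _ k (fun y => y 0 i)) => //; exact: coord_cont.
by apply: cvgD; [apply: cvgD|]; apply: cvgM; apply: hc.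
Qed.

Lemma econt_at (R : realType) (T : topologicalType) (f : T -> 'rV[R]_3) (x : T) e :
  {for x, continuous f} -> 0 < e -> \forall y \near x, enorm (f x - f y) < e.
Proof.
move=> hf e0; near=> y.
apply: le_lt_trans (enorm_le_norm _) _; rewrite mulrC -ltr_pdivlMr //.
by near: y; move/cvgrPdist_lt : hf; apply; rewrite divr_gt0.
Unshelve. all: by end_near. Qed.

Lemma econt_near (R : realType) (T : topologicalType) (f : T -> 'rV[R]_3) (x : T) :
  (forall e, 0 < e -> \forall y \near x, enorm (f x - f y) < e) ->
  {for x, continuous f}.
Proof.
move=> h; apply/cvgrPdist_lt => e e0; near=> y.
by apply: le_lt_trans (norm_le_enorm _) _; near: y; apply: h.
Unshelve. all: by end_near. Qed.

Lemma dotBB (R : realType) (x y : 'rV[R]_3) :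
  dot (x - y) (x - y) = dot x x - 2 * dot x y + dot y y.
Proof. by rewrite !dotE !mxE; ring. Qed.

Lemma dotDD (R : realType) (x y : 'rV[R]_3) :
  dot (x + y) (x + y) = dot x x + 2 * dot x y + dot y y.
Proof. by rewrite !dotE !mxE; ring. Qed.

Lemma contD (T : topologicalType) (R : realType) (V : normedModType R) (f g : T -> V) x :
  {for x, continuous f} -> {for x, continuous g} -> {for x, continuous (fun z => f z + g z)}.
Proof. exact: cvgD. Qed.

Lemma contB (T : topologicalType) (R : realType) (V : normedModType R) (f g : T -> V) x :
  {for x, continuous f} -> {for x, continuous g} -> {for x, continuous (fun z => f z - g z)}.
Proof. exact: cvgB. Qed.

Lemma contZ (T : topologicalType) (R : realType) (V : normedModType R)
    (k : T -> R) (f : T -> V) x :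
  {for x, continuous k} -> {for x, continuous f} -> {for x, continuous (fun z => k z *: f z)}.
Proof. exact: cvgZ. Qed.

Lemma contM (T : topologicalType) (R : realType) (f g : T -> R) x :
  {for x, continuous f} -> {for x, continuous g} -> {for x, continuous (fun z => f z * g z)}.
Proof. exact: cvgM. Qed.

Lemma contV (T : topologicalType) (R : realType) (f : T -> R) x : f x != 0 ->
  {for x, continuous f} -> {for x, continuous (fun z => (f z)^-1)}.
Proof. exact: cvgV. Qed.

Lemma contC (T : topologicalType) (U : topologicalType) (c : U) (x : T) :
  {for x, continuous (fun=> c)}.
Proof. exact: cvg_cst. Qed.

Lemma contI (T : topologicalType) (x : T) : {for x, continuous (fun z => z)}.
Proof. exact: cvg_id. Qed.

Lemma contcomp (T U V : topologicalType) (f : T -> U) (g : U -> V) x :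
  {for x, continuous f} -> {for f x, continuous g} -> {for x, continuous (fun z => g (f z))}.
Proof. by move=> hf hg; exact: continuous_comp. Qed.

Lemma contPair (T U V : topologicalType) (f : T -> U) (g : T -> V) x :
  {for x, continuous f} -> {for x, continuous g} -> {for x, continuous (fun z => (f z, g z))}.
Proof. by move=> hf hg; apply: cvg_pair. Qed.

Lemma contFst (U V : topologicalType) (x : U * V) : {for x, continuous fst}.
Proof. exact: cvg_fst. Qed.

Lemma contSnd (U V : topologicalType) (x : U * V) : {for x, continuous snd}.
Proof. exact: cvg_snd. Qed.

Lemma near_R (R : realType) (s : R) (P : R -> Prop) : (\forall x \near s, P x) ->
  exists2 d : R, 0 < d & forall x, `|x - s| < d -> P x.
Proof.
move=> /nbhs_normP [d /= d0 hd]; exists d => // x hx; apply: hd.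
by rewrite /ball_ /= distrC.
Qed.

(** * Nearest-point projections *)

Definition normal_to (R : realType) (C : set 'rV[R]_3) (p k : 'rV[R]_3) :=
  forall q, C q -> dot k (q - p) <= 0.

(** Stated by the variational inequality instead of minimality: [x - pr x] lies in the normal cone
    at [pr x]. Uniqueness and the 1-Lipschitz bounds for [pr x] and [x - pr x] then follow by adding
    two such inequalities. *)
Definition projection (R : realType) (C : set 'rV[R]_3)
    (pr : 'rV[R]_3 -> 'rV[R]_3) :=
  forall x, C (pr x) /\ normal_to C (pr x) (x - pr x).

Definition convex_rV (R : realType) (C : set 'rV[R]_3) :=
  forall p q (t : R), C p -> C q -> 0 <= t <= 1 -> C (p + t *: (q - p)).

Lemma dist_to_set_le (R : realType) (C : set 'rV[R]_3) x y :
  C y -> dist_to_set x C <= enorm (x - y).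
Proof.
move=> Cy; apply: ge_inf; last by exists y.
by exists 0 => _ [z _ <-]; exact: enorm_ge0.
Qed.

Lemma dist_to_set_ge (R : realType) (C : set 'rV[R]_3) x a : C !=set0 ->
  (forall y, C y -> a <= enorm (x - y)) -> a <= dist_to_set x C.
Proof.
move=> [z Cz] h; apply: lb_le_inf; first by exists (enorm (x - z)), z.
by move=> _ [y Cy <-]; exact: h.
Qed.

Lemma normal_dist (R : realType) (C : set 'rV[R]_3) x p :
  C p -> normal_to C p (x - p) -> dist_to_set x C = enorm (x - p).
Proof.
move=> Cp h; apply/eqP; rewrite eq_le dist_to_set_le //=.
apply: dist_to_set_ge; first by exists p.
move=> y Cy; rewrite enorm_ge ?enorm_ge0 // enorm2.
have -> : x - y = (x - p) - (y - p) by rewrite opprB addrA subrK.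
rewrite [leRHS]dotBB; have := h _ Cy; have := dotxx_ge0 (y - p); lra.
Qed.

Lemma nearest_normal (R : realType) (C : set 'rV[R]_3) x p : convex_rV C ->
  C p -> (forall y, C y -> enorm (x - p) <= enorm (x - y)) ->
  normal_to C p (x - p).
Proof.
move=> cC Cp h q Cq; rewrite leNgt; apply/negP => D0.
set D := dot _ _ in D0; set N := dot (q - p) (q - p).
have N0 : 0 <= N by exact: dotxx_ge0.
have DN : 0 < D + N by lra.
(* Moving by t towards [q] changes the squared distance by -2 t D + t^2 N; this t is at most 1 and
   keeps t N below 2 D. *)
pose t := D / (D + N).
have t0 : 0 < t by rewrite divr_gt0.
have t1 : t <= 1 by rewrite ler_pdivrMr // mul1r; lra.
have := h _ (cC _ _ t Cp Cq _); rewrite (ltW t0) t1 => /(_ isT).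
rewrite enorm_ge ?enorm_ge0 // enorm2 opprD addrA.
rewrite [leRHS]dotBB !dotZl !dotZr -/D -/N => hh.
have : 2 * D <= t * N.
  by rewrite -(ler_pM2l t0); lra.
rewrite /t mulrAC ler_pdivlMr //; nra.
Qed.

Lemma proj_dist (R : realType) (C : set 'rV[R]_3) pr x :
  projection C pr -> dist_to_set x C = enorm (x - pr x).
Proof. by move=> /(_ x) [Cp h]; exact: normal_dist. Qed.

Lemma proj_firm (R : realType) (C : set 'rV[R]_3) pr x y : projection C pr ->
  0 <= dot ((x - pr x) - (y - pr y)) (pr x - pr y).
Proof.
move=> hp; have [Cx hx] := hp x; have [Cy hy] := hp y.
have := hx _ Cy; have := hy _ Cx; rewrite !dotL; lra.
Qed.

Lemma proj_sqr (R : realType) (C : set 'rV[R]_3) pr x y : projection C pr ->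
  dot (pr x - pr y) (pr x - pr y) +
  dot ((x - pr x) - (y - pr y)) ((x - pr x) - (y - pr y)) <= dot (x - y) (x - y).
Proof.
move=> /(proj_firm x y); set a := _ - (y - _); set b := pr x - pr y => h.
have -> : x - y = a + b by rewrite /a /b; apply: rV3P; rewrite !mxE; ring.
by rewrite [leRHS]dotDD; lra.
Qed.

Lemma proj_lip (R : realType) (C : set 'rV[R]_3) pr x y : projection C pr ->
  enorm (pr x - pr y) <= enorm (x - y).
Proof.
move=> /(proj_sqr x y) h; rewrite enorm_le ?enorm_ge0 // enorm2.
apply: le_trans h; rewrite lerDl; exact: dotxx_ge0.
Qed.

Lemma proj_nu_lip (R : realType) (C : set 'rV[R]_3) pr x y : projection C pr ->
  enorm ((x - pr x) - (y - pr y)) <= enorm (x - y).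
Proof.
move=> /(proj_sqr x y) h; rewrite enorm_le ?enorm_ge0 // enorm2.
apply: le_trans h; rewrite lerDr; exact: dotxx_ge0.
Qed.

Lemma proj_eq (R : realType) (C : set 'rV[R]_3) pr x p : projection C pr ->
  C p -> normal_to C p (x - p) -> pr x = p.
Proof.
move=> /(_ x) [Cq hq] Cp hp; apply/eqP; rewrite -subr_eq0; apply/eqP.
apply: dotxx_eq0; apply: le_anti; rewrite dotxx_ge0 andbT.
have := hq _ Cp; have := hp _ Cq.
rewrite !dotL (dotC (pr x) p); lra.
Qed.

Lemma proj_cont (R : realType) (C : set 'rV[R]_3) pr :
  projection C pr -> continuous pr.
Proof. by move=> hp; apply: (@elip _ _ 1) => // x y; rewrite mul1r (proj_lip _ _ hp). Qed.

Lemma region_convex (R : realType) n (v : 'I_n -> 'rV[R]_3) :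
  convex_rV (polygon_region v).
Proof.
move=> p q t [a [a0 a1 ->]] [b [b0 b1 ->]] /andP[t0 t1].
exists (fun i => (1 - t) * a i + t * b i); split.
- by move=> i; apply: addr_ge0; apply: mulr_ge0; rewrite ?subr_ge0.
- by rewrite big_split -!mulr_sumr /= a1 b1; ring.
- rewrite [RHS](eq_bigr (fun i => (1 - t) *: (a i *: v i) + t *: (b i *: v i))); last first.
    by move=> i _; rewrite !scalerA -scalerDl.
  rewrite big_split -!scaler_sumr /=.
  by apply: rV3P; rewrite !mxE; ring.
Qed.

Lemma region_vertex (R : realType) n (v : 'I_n -> 'rV[R]_3) i : polygon_region v (v i).
Proof.
exists (fun j => (j == i)%:R); split.
- by move=> j; exact: ler0n.
- by rewrite (bigD1 i) //= eqxx big1 ?addr0 // => j /negbTE ->.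
- rewrite (bigD1 i) //= eqxx scale1r big1 ?addr0 // => j /negbTE ->.
  by rewrite scale0r.
Qed.

Lemma region_le (R : realType) n (v : 'I_n -> 'rV[R]_3) k m :
  (forall i, dot k (v i) <= m) -> forall q, polygon_region v q -> dot k q <= m.
Proof.
move=> h q [a [a0 a1 ->]]; rewrite dot_sumr -[m]mul1r -a1 mulr_suml.
by apply: ler_sum => i _; rewrite dotZr; apply: ler_wpM2l.
Qed.

Lemma region_eq (R : realType) n (v : 'I_n -> 'rV[R]_3) k m :
  (forall i, dot k (v i) = m) -> forall q, polygon_region v q -> dot k q = m.
Proof.
move=> h q hq; apply: le_anti; rewrite (region_le _ hq) ?h //=; last by move=> i; rewrite h.
have := @region_le _ _ v (- k) (- m) _ q hq; rewrite !dotL lerN2; apply=> i.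
by rewrite dotL h.
Qed.

Lemma region_projection (R : realType) n (v : 'I_n -> 'rV[R]_3) : (0 < n)%N ->
  exists pr, projection (polygon_region v) pr.
Proof.
move=> n0.
(* Compactness is taken in the simplex of weights, and the distance is minimised as a function of
   the weights. *)
pose A := [set a : 'rV[R]_n | (forall i, a ord0 i \in `[0 : R, 1]) /\ \sum_i a ord0 i = 1].
have csum (T : topologicalType) (V : normedModType R) (F : 'I_n -> T -> V) :
    (forall i, continuous (F i)) -> continuous (fun x => \sum_i F i x).
  move=> hF; apply: continuous_big => // z; exact: add_continuous.
have cA : compact A.
  have -> : A = [set a : 'rV[R]_n | forall i, a ord0 i \in `[0 : R, 1]] `&`
      (fun a : 'rV[R]_n => \sum_i a ord0 i) @^-1` [set x | x = 1].
    by apply/seteqP; split=> a /=.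
  apply: compact_closedI.
    by apply: (@rV_compact _ _ (fun=> `[0 : R, 1]%classic)) => _; exact: segment_compact.
  apply: preimage_closed; last exact: closed_eq.
  move=> a _; apply: csum => i; exact: coord_continuous.
have A0 : A !=set0.
  exists (delta_mx 0 (Ordinal n0)); split=> [i|].
    by rewrite mxE eqxx /= in_itv /=; case: eqP; rewrite ?ler01 ?lexx.
  rewrite (bigD1 (Ordinal n0)) //= mxE !eqxx /= big1 ?addr0 // => i /negbTE h.
  by rewrite mxE h andbF.
suff h x : exists p, polygon_region v p /\ normal_to (polygon_region v) p (x - p).
  by exists (fun x => projT1 (cid (h x))) => x; exact: (projT2 (cid (h x))).
pose g (a : 'rV[R]_n) := \sum_i a ord0 i *: v i.
have cf : continuous (fun a => enorm (x - g a)).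
  move=> a; apply: (@continuous_comp _ _ _ (fun a => x - g a) (@enorm R)); last exact: enorm_cont.
  apply: continuousB; first exact: cst_continuous.
  have := @csum _ 'rV[R]_3 (fun i (b : 'rV[R]_n) => b ord0 i *: v i); apply=> i b.
  apply: contZ; [exact: coord_continuous|exact: contC].
have [a aA amin] := EVT_min_rV A0 cA (continuous_subspaceT cf).
have Aa : A a by rewrite inE in aA.
have Rg b : A b -> polygon_region v (g b).
  case=> b0 b1; exists (fun i => b ord0 i); split=> // i.
  by have := b0 i; rewrite in_itv /= => /andP[].
exists (g a); split; first exact: Rg.
apply: nearest_normal; [exact: region_convex|exact: Rg|].
move=> _ [b [b0 b1 ->]].
pose bb : 'rV[R]_n := \row_i b i.
have -> : \sum_i b i *: v i = g bb by apply: eq_bigr => i _; rewrite mxE.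
apply: amin; rewrite inE; split=> [i|].
  rewrite mxE in_itv /= b0 /= -b1 (bigD1 i) //= lerDl.
  by apply: sumr_ge0.
by rewrite -b1; apply: eq_bigr => i _; rewrite mxE.
Qed.

(** * Convex polygons with bounded turning angles *)

Lemma cos_2pi3 (R : realType) : cos (2 * pi / 3 : R) = - 1 / 2.
Proof.
set a := pi / 3 : R.
have ha : cos a = 1 / 2.
  have ha3 : cos (a + (a + a)) = -1.
    by rewrite (_ : a + (a + a) = pi) ?cospi // /a; field.
  have s2 : sin a ^+ 2 = 1 - cos a ^+ 2 by rewrite -(cos2Dsin2 a); ring.
  (* The triple angle formula turns cos 3a = -1 into 4 c^3 - 3 c + 1 = 0, which factors in this
     way. *)
  have h : (cos a + 1) * (2 * cos a - 1) ^+ 2 = 0.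
    move: ha3; rewrite !(cosD, sinD).
    rewrite (_ : _ - _ = cos a ^+ 3 - 3 * cos a * sin a ^+ 2); last by ring.
    by rewrite s2 => ha3; lra.
  move/eqP: h; rewrite mulf_eq0 => /orP[/eqP h|]; last first.
    by rewrite sqrf_eq0 => /eqP h; lra.
  have : 0 < cos a by apply: cos_gt0_pihalf; rewrite /a; have := pi_gt0 R; lra.
  lra.
rewrite (_ : 2 * pi / 3 = a + a); last by rewrite /a; field.
rewrite cosD ha; have := cos2Dsin2 a; rewrite ha; lra.
Qed.

Lemma ler_cos (R : realType) (x y : R) : 0 <= x -> x <= y -> y <= pi -> cos y <= cos x.
Proof.
move=> x0; rewrite le_eqVlt => /orP[/eqP <- //|xy] yp.
have y0 := le_trans x0 (ltW xy).
by apply/ltW; rewrite ltr_cos // in_itv /= ?x0 ?y0 ?yp ?(le_trans (ltW xy)).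
Qed.

Lemma turning_dot (R : realType) n (v : 'I_n -> 'rV[R]_3) i :
  (forall i, enorm (side v i) = 1) -> turning_angle v i <= 2 * pi / 3 ->
  - (1 / 2) <= dot (side v (ord_pred i)) (side v i).
Proof.
move=> hs; rewrite /turning_angle !hs mulr1 divr1; set d := dot _ _ => h.
have dle : `|d| <= 1 by apply: le_trans (dot_le _ _) _; rewrite !hs mulr1.
have d1 : -1 <= d <= 1 by rewrite -ler_norml.
rewrite -(acosK (x := d)); last by rewrite in_itv.
rewrite (_ : - (1 / 2) = cos (2 * pi / 3)); last by rewrite cos_2pi3; field.
apply: ler_cos => //; first exact: acos_ge0.
have := pi_gt0 R; lra.
Qed.

Lemma ordS_iter n (i j : 'I_n) : exists k, iter k (@ordS n) i = j.
Proof.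
have h k : iter k (@ordS n) i = ((i + k) %% n)%N :> nat.
  elim: k => [|k IH] /=; first by rewrite addn0 modn_small.
  by rewrite IH -addn1 modnDml addn1 addnS.
exists (j + (n - i))%N; apply: val_inj; rewrite /= h addnCA subnKC ?(ltnW (ltn_ord i)) //.
by rewrite modnDr modn_small.
Qed.

Lemma ordS_ind n (P : 'I_n -> Prop) i : P i -> (forall j, P j -> P (ordS j)) ->
  forall j, P j.
Proof.
by move=> Pi hP j; have [k <-] := ordS_iter i j; elim: k => //= k; exact: hP.
Qed.

(** The determinant of [u], [x], [y]: for a unit [u], the signed area of the parallelogram of [x]
    and [y] in the plane orthogonal to [u]. *)
Definition area (R : realType) (u x y : 'rV[R]_3) := dot (cross u x) y.

Lemma areaC (R : realType) (u x y : 'rV[R]_3) : area u x y = - area u y x.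
Proof. exact: dot_crossC. Qed.
Lemma areaxx (R : realType) (u x : 'rV[R]_3) : area u x x = 0.
Proof. by rewrite /area dotC dot_crossr. Qed.
Lemma areaDr (R : realType) (u x y z : 'rV[R]_3) : area u x (y + z) = area u x y + area u x z.
Proof. exact: dotDr. Qed.
Lemma areaNr (R : realType) (u x y : 'rV[R]_3) : area u x (- y) = - area u x y.
Proof. exact: dotNr. Qed.
Lemma areaZr (R : realType) a (u x y : 'rV[R]_3) : area u x (a *: y) = a * area u x y.
Proof. exact: dotZr. Qed.
Lemma areaNl (R : realType) (u x y : 'rV[R]_3) : area u (- y) x = - area u y x.
Proof. by rewrite areaC areaNr !(areaC _ x); ring. Qed.
Lemma areaN (R : realType) (u x y : 'rV[R]_3) : area (- u) x y = - area u x y.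
Proof. by rewrite /area !dotE !mxE /=; ring. Qed.
Lemma area_cramer (R : realType) (u a b x : 'rV[R]_3) : dot u u = 1 ->
  dot u a = 0 -> dot u b = 0 -> dot u x = 0 ->
  area u a b *: x = area u x b *: a + area u a x *: b.
Proof.
move=> hu ha hb hx.
have id : area u a b *: x = dot (cross x a) b *: u + area u x b *: a + area u a x *: b.
  by apply: rV3P; rewrite /area !dotE !mxE /=; ring.
have h0 : dot (cross x a) b = 0.
  have : dot u (area u a b *: x) = dot (cross x a) b.
    by rewrite id !dotL hu ha hb; ring.
  by rewrite dotL hx mulr0.
by rewrite id h0 scale0r add0r.
Qed.

Lemma area_sqr (R : realType) (u x y : 'rV[R]_3) : dot u u = 1 ->
  dot u x = 0 -> dot u y = 0 ->
  area u x y ^+ 2 = dot x x * dot y y - dot x y ^+ 2.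
Proof.
move=> hu hx hy.
have gram : area u x y ^+ 2 =
    dot u u * dot x x * dot y y + 2 * dot u x * dot x y * dot u y
    - dot u u * dot x y ^+ 2 - dot x x * dot u y ^+ 2 - dot y y * dot u x ^+ 2.
  by rewrite /area !dotE !mxE /=; ring.
by rewrite gram hu hx hy; ring.
Qed.

Lemma area_mul (R : realType) (u e x y : 'rV[R]_3) : dot u u = 1 ->
  dot u e = 0 -> dot u x = 0 -> dot u y = 0 ->
  area u x y * dot e e = dot x e * area u e y - area u e x * dot y e.
Proof.
move=> hu he hx hy.
have := congr1 (fun z => dot z e) (area_cramer hu hx hy he).
by rewrite /= !dotL => ->; rewrite (areaC u x e); ring.
Qed.

Lemma dot_mul (R : realType) (u e x y : 'rV[R]_3) : dot u u = 1 ->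
  dot u e = 0 -> dot u x = 0 -> dot u y = 0 ->
  dot x y * dot e e = dot x e * dot y e + area u e x * area u e y.
Proof.
move=> hu he hx hy.
have := congr1 (fun z => dot (cross u z) (cross u e)) (area_cramer hu he hy hx).
have := congr1 (fun z => dot z y) (area_cramer hu he (dot_crossl u e) hx).
rewrite /= !dotL -![dot (cross _ _) y]/(area _ _ y).
rewrite {1}/area dot_cross2 hu he mul0r subr0 mul1r.
have -> : area u x (cross u e) = dot x e.
  by rewrite /area dot_cross2 hu hx; ring.
by move=> h _; rewrite mulrC h (dotC e y); ring.
Qed.

Lemma unit_eq (R : realType) (x y : 'rV[R]_3) :
  dot x x = 1 -> dot y y = 1 -> dot x y = 1 -> x = y.
Proof.
move=> hx hy hxy; apply/eqP; rewrite -subr_eq0; apply/eqP; apply: dotxx_eq0.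
by rewrite dotBB hx hy hxy; ring.
Qed.

Lemma unit_area0 (R : realType) (u x y : 'rV[R]_3) : dot u u = 1 ->
  dot u x = 0 -> dot u y = 0 -> dot x x = 1 -> dot y y = 1 -> area u x y = 0 ->
  y = x \/ y = - x.
Proof.
move=> hu hx hy hxx hyy h.
have /eqP : (dot x y - 1) * (dot x y + 1) = 0.
  by have := area_sqr hu hx hy; rewrite h hxx hyy; lra.
rewrite mulf_eq0 => /orP[] /eqP h1; [left|right].
  by apply/esym/unit_eq => //; lra.
by apply/esym/unit_eq; rewrite ?dotL ?hxx ?opprK //; lra.
Qed.

Lemma sideE (R : realType) n (v : 'I_n -> 'rV[R]_3) i : v (ordS i) = v i + side v i.
Proof. by rewrite /side addrC subrK. Qed.

Lemma sideE_pred (R : realType) n (v : 'I_n -> 'rV[R]_3) i :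
  v (ord_pred i) = v i - side v (ord_pred i).
Proof. by rewrite /side ord_predK; apply: rV3P; rewrite !mxE; ring. Qed.

Lemma simple_polygon_inj (R : realType) n (v : 'I_n -> 'rV[R]_3) :
  simple_polygon v -> injective v.
Proof.
move=> hs i j h; have [] // := hs i j 0 0; rewrite ?lexx ?ltr01 //.
by rewrite !scale0r !addr0.
Qed.

(** Each side has the polygon on one of its sides; the point is that the sign is the same for all.
    If it changed from one side to the next, testing at the two outer vertices would give area 0, so
    the sides would be equal or opposite. The angle bound excludes opposite sides, and equal sides
    share their line and hence the sign. *)
Lemma orientation (R : realType) n (u : 'rV[R]_3) (v : 'I_n -> 'rV[R]_3) : (0 < n)%N ->
  convex_planar_polygon u v -> (forall i, enorm (side v i) = 1) ->
  (forall i, - (1 / 2) <= dot (side v (ord_pred i)) (side v i)) ->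
  exists u', [/\ u' = u \/ u' = - u, dot u' u' = 1 &
    forall i j, 0 <= area u' (side v i) (v j - v i)].
Proof.
move=> n0 [_ /enorm1 hu hpl hk] hs hd.
have su i : dot u (side v i) = 0 by rewrite /side hpl.
have ss i : dot (side v i) (side v i) = 1 by exact/enorm1.
pose P i w := forall j, 0 <= area w (side v i) (v j - v i).
have hP i : P i u \/ P i (- u).
  have [k [k0 uk sk hkj]] := hk i.
  have := plane_decomp hu (ss i) (su i) uk.
  rewrite dotC sk scale0r add0r; set c := dot k _ => kE.
  have c0 : c != 0 by apply: contra k0 => /eqP c0; rewrite kE c0 scale0r.
  have h j : c * area u (side v i) (v j - v i) <= 0.
    by have := hkj j; rewrite kE dotZl.
  have [cn|cp] : c < 0 \/ 0 < c by case: ltgtP c0; auto.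
    by left=> j; have := h j; rewrite nmulr_rle0.
  by right=> j; have := h j; rewrite pmulr_rle0 // areaN oppr_ge0.
have step w : w = u \/ w = - u -> forall i, P i w -> P (ordS i) w.
  move=> hw i Pi; have [//|nP] := pselect (P (ordS i) w).
  have hww : dot w w = 1 by case: hw => ->; rewrite ?dotNl ?dotNr ?opprK.
  have sw j : dot w (side v j) = 0 by case: hw => ->; rewrite ?dotNl su ?oppr0.
  have Pn : P (ordS i) (- w) by case: hw nP => ->; case: (hP (ordS i)); rewrite ?opprK.
  have h1 := Pi (ordS (ordS i)); have h2 := Pn i.
  move: h1 h2; rewrite !(sideE v) !areaN.
  have -> : v i + side v i + side v (ordS i) - v i = side v i + side v (ordS i).
    by apply: rV3P; rewrite !mxE; ring.
  have -> : v i - (v i + side v i) = - side v i by apply: rV3P; rewrite !mxE; ring.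
  rewrite [area _ _ (_ + _)]areaDr areaxx [area _ _ (- _)]areaNr (areaC w (side v (ordS i))) => h1 h2.
  have h0 : area w (side v i) (side v (ordS i)) = 0 by lra.
  have [e|e] := unit_area0 hww (sw i) (sw (ordS i)) (ss i) (ss (ordS i)) h0.
    move=> j; rewrite e (sideE v); have := Pi j.
    have -> : v j - (v i + side v i) = (v j - v i) - side v i.
      by apply: rV3P; rewrite !mxE; ring.
    by rewrite [in X in _ -> X]areaDr areaNr areaxx subr0.
  by have := hd (ordS i); rewrite ordSK e dotNr ss; lra.
have [h|h] := hP (Ordinal n0).
  exists u; split; [by left|by []|] => i; move: i.
  by apply: (ordS_ind (P := P^~ u) h) => j; apply: step; left.
exists (- u); split; [by right|by rewrite !dotL opprK|] => i; move: i.
by apply: (ordS_ind (P := P^~ (- u)) h) => j; apply: step; right.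
Qed.

Definition oriented_polygon (R : realType) n (u : 'rV[R]_3) (v : 'I_n -> 'rV[R]_3) :=
  [/\ dot u u = 1,
      forall i j, dot u (v j - v i) = 0,
      forall i, dot (side v i) (side v i) = 1,
      forall i, - (1 / 2) <= dot (side v (ord_pred i)) (side v i) &
      forall i j, 0 <= area u (side v i) (v j - v i)].

Lemma sum_side (R : realType) n (v : 'I_n -> 'rV[R]_3) : \sum_i side v i = 0.
Proof.
rewrite /side sumrB; apply/eqP; rewrite subr_eq0; apply/eqP.
by rewrite [RHS](reindex_inj (can_inj (@ordSK n))).
Qed.

Lemma side_dotS (R : realType) n (u : 'rV[R]_3) (v : 'I_n -> 'rV[R]_3) i :
  oriented_polygon u v -> - (1 / 2) <= dot (side v i) (side v (ordS i)).
Proof. by case=> _ _ _ /(_ (ordS i)); rewrite ordSK. Qed.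

(** On a line all sides are equal, since consecutive ones are never opposite; but the sides of a
    closed polygon add up to 0. *)
Lemma not_collinear (R : realType) n (u k : 'rV[R]_3) (v : 'I_n -> 'rV[R]_3) : (0 < n)%N ->
  oriented_polygon u v -> dot k k = 1 -> dot u k = 0 ->
  ~ forall i, dot k (side v i) = 0.
Proof.
move=> n0 ho kk uk h; have [hu hpl ss _ _] := ho.
have su i : dot u (side v i) = 0 by exact: hpl.
have a0 i j : area u (side v i) (side v j) = 0.
  have := area_mul hu uk (su i) (su j).
  by rewrite kk !(dotC _ k) !h; lra.
have e j : side v j = side v (Ordinal n0).
  move: j; apply: (ordS_ind (i := Ordinal n0)) => // j <-.
  have [//|e] := unit_area0 hu (su j) (su (ordS j)) (ss j) (ss (ordS j)) (a0 _ _).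
  by exfalso; have := side_dotS j ho; rewrite e dotNr ss; lra.
have := congr1 (dot (side v (Ordinal n0))) (sum_side v).
rewrite (eq_bigr (fun=> side v (Ordinal n0))) // sumr_const dot0r card_ord.
rewrite -scaler_nat dotZr ss mulr1 => /eqP; rewrite pnatr_eq0 => /eqP e0.
by move: (n0); rewrite e0.
Qed.

(* Walking along the supporting line orthogonal to k from the last vertex before
   p, the next vertex of the polygon is already past p. *)
Lemma face (R : realType) n (u k p : 'rV[R]_3) (v : 'I_n -> 'rV[R]_3) : (0 < n)%N ->
  oriented_polygon u v -> dot k k = 1 -> dot u k = 0 ->
  polygon_region v p -> normal_to (polygon_region v) p k ->
  exists i (t : R), [/\ 0 <= t < 1, p = v i + t *: side v i & 0 < t -> dot k (side v i) = 0].
Proof.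
move=> n0 ho kk uk [a [a0 a1 pE]] kp; have [hu hpl ss sd hor] := ho.
have hp i : dot u (v i - p) = 0.
  have -> : dot u (v i - p) = dot u (v i) - dot u p by rewrite dotDr dotNr.
  apply/eqP; rewrite subr_eq0 eq_sym; apply/eqP.
  apply: (region_eq (v := v)); last by exists a.
  by move=> j; have := hpl i j; rewrite dotDr dotNr => /eqP; rewrite subr_eq0 => /eqP.
have kv i : dot k (v i - p) <= 0 by apply: kp; exact: region_vertex.
pose tau := cross u k; pose x i := dot (v i - p) tau.
have tt : dot tau tau = 1 by rewrite /tau dot_cross2 hu kk uk; ring.
have dec i : v i - p = dot (v i - p) k *: k + x i *: tau.
  exact: (plane_decomp hu kk uk (hp i)).
have sum0 : \sum_i a i *: (v i - p) = 0.
  rewrite (eq_bigr (fun i => a i *: v i - a i *: p)); last by move=> i _; rewrite scalerBr.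
  by rewrite sumrB -scaler_suml a1 scale1r -pE subrr.
have aJ i : a i != 0 -> dot k (v i - p) = 0.
  move=> ai; have := congr1 (dot k) sum0; rewrite dot_sumr dot0r.
  move=> /eqP; rewrite -oppr_eq0 -sumrN psumr_eq0 => [|j _]; last first.
    by rewrite dotZr -mulrN mulr_ge0 // oppr_ge0.
  move=> /allP /(_ i (mem_index_enum _)) /=.
  by rewrite dotZr oppr_eq0 mulf_eq0 (negbTE ai) => /eqP.
have sumx : \sum_i a i * x i = 0.
  have := congr1 (fun z => dot z tau) sum0; rewrite /= dot_suml dot0l => {2}<-.
  by apply: eq_bigr => i _; rewrite dotZl.
(* A weighted mean equal to 0 has a nonpositive term of nonzero weight. Applied to [x] and to [- x],
   this gives vertices on the supporting line on both sides of [p]. *)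
have exneg (b : 'I_n -> R) : \sum_i a i * b i = 0 -> exists2 i, a i != 0 & b i <= 0.
  move=> hb; have [//|nex] := pselect (exists2 i, a i != 0 & b i <= 0).
  have hb' i : 0 <= a i * b i.
    have [->|ai] := eqVneq (a i) 0; first by rewrite mul0r.
    by rewrite mulr_ge0 // leNgt; apply/negP => bi; apply: nex; exists i => //; exact: ltW.
  have ab0 i : a i = 0.
    move/eqP: hb; rewrite psumr_eq0 // => /allP /(_ i (mem_index_enum _)) /=.
    rewrite mulf_eq0 => /orP[/eqP //|/eqP bi]; apply/eqP; have [//|ai] := eqVneq (a i) 0.
    by exfalso; apply: nex; exists i => //; rewrite bi.
  by move: a1; rewrite big1 // => /eqP; rewrite eq_sym oner_eq0.
have [i0 ai0 xi0] := exneg x sumx.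
pose Q i := (dot k (v i - p) == 0) && (x i <= 0).
have Qi0 : Q i0 by rewrite /Q aJ // eqxx.
have [j /andP[/eqP kj xj] jmax] := @arg_maxP _ _ _ i0 Q x Qi0.
have eqv i : dot k (v i - p) = 0 -> v i - p = x i *: tau.
  by move=> h; rewrite {1}(dec i) (dotC _ k) h scale0r add0r.
have [xj0|xjn] := eqVneq (x j) 0.
  exists j, 0; rewrite lexx ltr01 scale0r addr0 ltxx; split=> //.
  by apply/eqP; rewrite -subr_eq0 -oppr_eq0 opprB eqv // xj0 scale0r.
have xj' : x j < 0 by rewrite lt_neqAle xjn.
have [b ab xb] : exists2 i, a i != 0 & - x i <= 0.
  apply: (exneg (fun i => - x i)).
  by rewrite (eq_bigr (fun i => - (a i * x i))) ?sumrN ?sumx ?oppr0 // => i _; rewrite mulrN.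
have xb0 : 0 < x b.
  rewrite oppr_le0 le_eqVlt in xb; case/orP: xb => // /eqP xb.
  by have := jmax b; rewrite /Q aJ // eqxx -xb lexx => /(_ isT) /=; lra.
have kv0 i l : dot k (v i - v l) = dot k (v i - p) - dot k (v l - p).
  by rewrite !dotDr !dotNr; ring.
have sk0 : dot k (side v j) = 0.
  apply: le_anti; apply/andP; split; first by rewrite kv0 kj subr0.
  have := hor j b; have -> : v b - v j = (x b - x j) *: tau.
    by rewrite scalerBl -(eqv b (aJ _ ab)) -(eqv j kj); apply: rV3P; rewrite !mxE; ring.
  rewrite areaZr pmulr_rge0; last by lra.
  by rewrite /area dot_cross2 hu uk dotC; lra.
have [sj|sj] : side v j = tau \/ side v j = - tau.
- have uT : dot u tau = 0 by rewrite dot_crossl.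
  apply: (unit_area0 hu) => //; first exact: hpl.
  by rewrite areaC /area dot_cross2 hu uk (dotC _ k) sk0; ring.
- exists j, (- x j).
  have xS : x (ordS j) = x j + 1.
    by rewrite /x sideE addrAC [LHS]dotDl sj tt.
  have kS : dot k (v (ordS j) - p) = 0.
    by rewrite sideE addrAC [LHS]dotDr kj sk0 addr0.
  have : ~~ (x (ordS j) <= 0).
    apply/negP => h; have := jmax (ordS j); rewrite /Q kS eqxx h => /(_ isT) /=.
    rewrite xS; lra.
  rewrite -ltNge xS => h; split=> //; first by apply/andP; split; lra.
  rewrite sj scaleNr -eqv //; apply: rV3P; rewrite !mxE; ring.
(* A side running backwards along the supporting line has the polygon on the side of [k] too, so
   that the whole polygon would lie on the line. *)
- exfalso; apply: (not_collinear n0 ho kk uk).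
  have k0 i : dot k (v i - v j) = 0.
    apply: le_anti; apply/andP; split; first by rewrite kv0 kj subr0.
    have := hor j i; rewrite sj areaNl areaC opprK /area /tau dot_cross2 hu uk.
    by rewrite (dotC _ k) mulr0 subr0 mul1r.
  by move=> i; rewrite /side kv0; have := k0 i; have := k0 (ordS i); rewrite !kv0; lra.
Qed.

(** The (p_i, q_i) are plane vectors of equal length in a closed half-plane. For positive heights
    the two turns say p2/q2 <= p1/q1 and p3/q3 <= p4/q4, while failure of both alternatives says
    p1/q1 + p4/q4 < 0 < p2/q2 + p3/q3. *)
Lemma chain_scalar (R : realType) (p1 p2 p3 p4 q1 q2 q3 q4 L : R) :
  0 < L -> 0 <= q1 -> 0 <= q2 -> 0 <= q3 -> 0 <= q4 ->
  p1 ^+ 2 + q1 ^+ 2 = L -> p2 ^+ 2 + q2 ^+ 2 = L ->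
  p3 ^+ 2 + q3 ^+ 2 = L -> p4 ^+ 2 + q4 ^+ 2 = L ->
  - L < p1 * p2 + q1 * q2 -> - L < p3 * p4 + q3 * q4 ->
  0 <= q2 * p1 - p2 * q1 -> 0 <= p4 * q3 - q4 * p3 ->
  0 <= p1 * q4 + q1 * p4 \/ p2 * q3 + q2 * p3 <= 0.
Proof.
move=> L0 h1 h2 h3 h4 l1 l2 l3 l4 a1 a2 c1 c2.
have [|n1] := leP 0 (p1 * q4 + q1 * p4); first by left.
have [|n2] := leP (p2 * q3 + q2 * p3) 0; first by right.
exfalso.
have opp (x y : R) : x ^+ 2 = L -> y ^+ 2 = L -> x < 0 -> 0 < y -> x * y = - L.
  move=> hx hy x0 y0; have : (x - y) * (x + y) = 0.
    by rewrite -subr_sqr hx hy subrr.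
  move/eqP; rewrite mulf_eq0 => /orP[]/eqP h; first by lra.
  have -> : x = - y by lra.
  by rewrite -hy; ring.
(* With both alternatives failing, q2 = 0 or q3 = 0 would make two consecutive vectors opposite,
   against the strict bounds on the inner products. *)
have [q20|q2p] := eqVneq q2 0.
  subst q2; have p20 : 0 < p2 by nra.
  have q10 : q1 = 0 by nra.
  subst q1; have p10 : p1 < 0 by nra.
  have := opp p1 p2 _ _ p10 p20; rewrite expr0n /= !addr0 in l1 l2; move=> /(_ l1 l2); lra.
have [q30|q3p] := eqVneq q3 0.
  subst q3; have p30 : 0 < p3 by nra.
  have q40 : q4 = 0 by nra.
  subst q4; have p40 : p4 < 0 by nra.
  have := opp p4 p3 _ _ p40 p30; rewrite expr0n /= !addr0 in l3 l4; move=> /(_ l4 l3); lra.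
have q2' : 0 < q2 by rewrite lt_neqAle eq_sym q2p.
have q3' : 0 < q3 by rewrite lt_neqAle eq_sym q3p.
(* The comparison of cotangents, multiplied by q1 q2 q3 q4 so that q1 and q4 may still vanish. *)
have := mulr_gt0 q2' q3' => q23.
have m1 : (p1 * q4 + q1 * p4) * (q2 * q3) < 0 by rewrite nmulr_rlt0.
have m2 : 0 <= (p2 * q3 + q2 * p3) * (q1 * q4) by rewrite mulr_ge0 ?mulr_ge0 // ltW.
have m3 := mulr_ge0 c1 (mulr_ge0 h3 h4).
have m4 := mulr_ge0 c2 (mulr_ge0 h1 h2).
lra.
Qed.

Lemma side_area (R : realType) n (u : 'rV[R]_3) (v : 'I_n -> 'rV[R]_3) i j :
  oriented_polygon u v -> 0 <= area u (side v (ord_pred i)) (v j - v i).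
Proof.
case=> _ _ _ _ /(_ (ord_pred i) j).
have -> : v j - v (ord_pred i) = side v (ord_pred i) + (v j - v i).
  by rewrite (sideE_pred v i); apply: rV3P; rewrite !mxE; ring.
by rewrite areaDr areaxx add0r.
Qed.

Lemma side_areaS (R : realType) n (u : 'rV[R]_3) (v : 'I_n -> 'rV[R]_3) i :
  oriented_polygon u v -> 0 <= area u (side v (ord_pred i)) (side v i).
Proof. exact: side_area. Qed.

(** The diagonal cuts the boundary into two chains. As the turns of a convex polygon add up to 2 pi,
    along one of the chains the direction turns by at most pi; each alternative expresses this for
    the first and last side of its chain. The proof takes components of the four sides along and
    across the diagonal. *)
Lemma chain_choice (R : realType) n (u : 'rV[R]_3) (v : 'I_n -> 'rV[R]_3) a b :
  oriented_polygon u v -> v b - v a != 0 ->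
  0 <= area u (side v a) (side v (ord_pred b)) \/
  0 <= area u (side v b) (side v (ord_pred a)).
Proof.
move=> ho e0; have [hu hpl ss sd hor] := ho.
have su i : dot u (side v i) = 0 by exact: hpl.
set e := v b - v a in e0.
have L0 : 0 < dot e e.
  by rewrite lt_neqAle dotxx_ge0 andbT eq_sym; apply: contra e0 => /eqP /dotxx_eq0 ->.
have he : dot u e = 0 by exact: hpl.
have E1 : 0 <= area u (side v a) e by exact: hor.
have E2 : 0 <= area u (side v (ord_pred a)) e by exact: side_area.
have E3 : 0 <= area u e (side v b) by rewrite areaC -areaNr opprB; exact: hor.
have E4 : 0 <= area u e (side v (ord_pred b)) by rewrite areaC -areaNr opprB; exact: side_area.
have am i j := area_mul hu he (su i) (su j).
have dm i j := dot_mul hu he (su i) (su j).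
have sq i : dot (side v i) e ^+ 2 + area u e (side v i) ^+ 2 = dot e e.
  by have := dm i i; rewrite ss mul1r => ->; ring.
have sq' i : dot (side v i) e ^+ 2 + area u (side v i) e ^+ 2 = dot e e.
  by rewrite areaC sqrrN.
have dp i : - dot e e < dot (side v (ord_pred i)) (side v i) * dot e e.
  by have := sd i; nra.
have ap i : 0 <= area u (side v (ord_pred i)) (side v i) * dot e e.
  by rewrite mulr_ge0 ?dotxx_ge0 // side_areaS.
have [] := chain_scalar L0 E1 E2 E3 E4 (sq' _) (sq' _) (sq _) (sq _).
- by have := dp a; rewrite dm (areaC u e) (areaC u e (side v a)); lra.
- by have := dp b; rewrite dm; lra.
- by have := ap a; rewrite am (areaC u e) (areaC u e (side v _)); lra.
- by have := ap b; rewrite am; lra.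
- move=> h; left; rewrite -(pmulr_lge0 _ L0) am (areaC u e (side v a)); lra.
- move=> h; right; rewrite -(pmulr_lge0 _ L0) am (areaC u e (side v (ord_pred a))); lra.
Qed.

Definition vertex_free_sides (R : realType) n (v : 'I_n -> 'rV[R]_3) :=
  forall i j (t : R), 0 <= t < 1 -> v j = v i + t *: side v i -> t = 0.

(* For a minimal distance below 1 between distinct vertices a and b, the sides at
   a and b - 1 must be antiparallel, so a + 1 and b - 1 are again at that distance. *)
Lemma peel (R : realType) n (u : 'rV[R]_3) (v : 'I_n -> 'rV[R]_3) a b :
  oriented_polygon u v -> vertex_free_sides v -> injective v -> a != b ->
  dot (v b - v a) (v b - v a) < 1 ->
  (forall i j, i != j -> dot (v b - v a) (v b - v a) <= dot (v j - v i) (v j - v i)) ->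
  0 <= area u (side v a) (side v (ord_pred b)) ->
  side v (ord_pred b) = - side v a /\
  0 <= area u (side v (ordS a)) (side v (ord_pred (ord_pred b))).
Proof.
move=> ho hvf hinj ab e1 emin D0; have [hu hpl ss sd hor] := ho.
have su i : dot u (side v i) = 0 by exact: hpl.
set e := v b - v a in e1 emin.
have en0 : e != 0.
  by apply: contra ab; rewrite subr_eq0 => /eqP /hinj ->.
have inside i t : v b = v a + e -> forall j, v j = v i + t *: side v i -> 0 < t -> t < 1 -> False.
  by move=> _ j h t0 t1; have := hvf i j t; rewrite (ltW t0) t1 => /(_ isT h); lra.
have vb : v b = v a + e by rewrite /e addrC subrK.
set p := side v a + side v (ord_pred b); pose w := e - p.
have wE : v (ord_pred b) - v (ordS a) = w.
  by rewrite sideE_pred (sideE v) /w /p /e; apply: rV3P; rewrite !mxE; ring.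
(* Equal sides would have the same supporting line, [e] would be a multiple of a side of length
   below 1, and a vertex would fall strictly inside a side. *)
have par : side v (ord_pred b) = side v a -> False.
  move=> sE.
  have wA : 0 <= area u (side v a) w.
    have := hor a (ord_pred b); rewrite (_ : v _ - v a = w + side v a).
      by rewrite areaDr areaxx addr0.
    by rewrite -wE (sideE v); apply: rV3P; rewrite !mxE; ring.
  have wB : 0 <= area u (side v a) (- w).
    have := hor (ord_pred b) (ordS a); rewrite sE -wE opprB.
    done.
  have eA : area u (side v a) e = 0.
    have : area u (side v a) w = 0 by rewrite areaNr in wB; lra.
    by rewrite /w /p sE areaDr areaNr areaDr areaxx; lra.
  have he : dot u e = 0 by exact: hpl.
  have eE : e = dot e (side v a) *: side v a.
    have := area_sqr hu (su a) he; rewrite eA ss mul1r => h.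
    rewrite {1}(plane_decomp hu (ss a) (su a) he) [dot e (cross _ _)]dotC.
    by rewrite -/(area u _ _) eA scale0r addr0.
  set t := dot e _ in eE.
  have tt : t ^+ 2 < 1.
    by move: e1; rewrite eE dotZl dotZr ss; nra.
  have t0 : t != 0 by apply: contra en0 => /eqP t0; rewrite eE t0 scale0r.
  have [tn|tp] : t < 0 \/ 0 < t by case: ltgtP t0; auto.
    have sb : side v b = side v a.
      have h1 : 0 <= area u (side v a) (side v b).
        by rewrite -sE; apply: side_areaS ho.
      have h2 : 0 <= area u (side v b) (side v a) * (- t).
        by rewrite mulrC -areaZr scaleNr -eE opprB; exact: hor.
      have h3 : area u (side v a) (side v b) = 0.
        by rewrite areaC in h2 *; nra.
      have [//|h] := unit_area0 hu (su a) (su b) (ss a) (ss b) h3.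
      by exfalso; have := sd b; rewrite sE h dotNr ss; lra.
    apply: (@inside b (- t) vb a); [|lra|nra].
    by rewrite sb vb {1}eE scaleNr addrK.
  by apply: (@inside a t vb b) => //; [rewrite vb -eE|nra].
(* Here a and b are two sides apart, and the bound -1/2 on the inner product of those sides is
   exactly what gives length at least 1. *)
have [w0|wn0] := eqVneq w 0.
  exfalso; have /hinj h : v (ord_pred b) = v (ordS a).
    by apply/eqP; rewrite -subr_eq0 wE w0.
  have : e = side v a + side v (ordS a).
    by apply/eqP; rewrite -subr_eq0 -h -/p -/w w0.
  move=> eE; move: e1; rewrite eE dotDD !ss.
  by have := side_dotS a ho; lra.
have hmin : dot e e <= dot w w.
  rewrite -wE; apply: emin; apply: contra wn0 => /eqP h.
  by rewrite -wE h subrr.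
have ew : e = w + p by rewrite /w subrK.
(* By Cramer's rule [w] is a nonnegative combination of the two sides, both of which make
   nonnegative products with their sum [p]. Then |w + p|^2 >= |w|^2 + |p|^2, and minimality of |e|
   forces [p] to vanish. *)
have pw : area u (side v a) (side v (ord_pred b)) != 0 -> 0 <= dot w p.
  move=> Dn; have Dp : 0 < area u (side v a) (side v (ord_pred b)).
    by rewrite lt_neqAle eq_sym Dn.
  have hw : dot u w = 0 by rewrite -wE; exact: hpl.
  have h : area u (side v a) (side v (ord_pred b)) * dot w p =
      area u w (side v (ord_pred b)) * dot (side v a) p +
      area u (side v a) w * dot (side v (ord_pred b)) p.
    by rewrite -dotZl (area_cramer hu (su a) (su (ord_pred b)) hw) dotDl !dotZl.
  rewrite -(pmulr_rge0 _ Dp) h.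
  have [sp1 sp2] : 0 <= dot (side v a) p /\ 0 <= dot (side v (ord_pred b)) p.
    have := dot_lb (side v a) (side v (ord_pred b)).
    have /enorm1 -> := ss a; have /enorm1 -> := ss (ord_pred b).
    have pE x : dot x p = dot x (side v a) + dot x (side v (ord_pred b)) by exact: dotDr.
    by rewrite !pE !ss (dotC (side v (ord_pred b)) (side v a)); lra.
  have a1 : 0 <= area u (side v a) w.
    have := hor a (ord_pred b); rewrite (_ : v _ - v a = w + side v a).
      by rewrite areaDr areaxx addr0.
    by rewrite -wE (sideE v); apply: rV3P; rewrite !mxE; ring.
  have a2 : 0 <= area u w (side v (ord_pred b)).
    by have := hor (ord_pred b) (ordS a); rewrite -opprB wE areaNr -areaC.
  by rewrite addr_ge0 // mulr_ge0.
have sE : side v (ord_pred b) = - side v a.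
  have [D|D] := eqVneq (area u (side v a) (side v (ord_pred b))) 0.
    by have [/par|] := unit_area0 hu (su a) (su (ord_pred b)) (ss a) (ss (ord_pred b)) D.
  have p0 : p = 0.
    apply: dotxx_eq0; apply: le_anti; rewrite dotxx_ge0 andbT.
    by have := pw D; have := hmin; rewrite {1 2}ew dotDD; lra.
  by apply/eqP; rewrite -subr_eq0 opprK addrC -/p p0.
split=> //.
have we : w = e by rewrite /w /p sE subrr subr0.
set y1 := side v (ordS a); set y2 := side v (ord_pred (ord_pred b)).
have f1 : 0 <= area u (side v a) y1.
  by have := side_areaS (ordS a) ho; rewrite ordSK.
have f2 : 0 <= area u (side v a) y2.
  by have := side_areaS (ord_pred b) ho; rewrite sE areaNr areaC opprK.
have f3 : 0 <= area u y1 e by rewrite -we -wE; exact: hor.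
have f4 : 0 <= area u y2 (- e).
  by rewrite -we -wE opprB; exact: side_area.
have f5 : 0 <= area u (side v a) e by exact: hor.
have he : dot u e = 0 by exact: hpl.
have sa1 : dot (side v a) (side v a) = 1 by exact: ss.
have am x y := @area_mul _ u (side v a) x y hu (su a).
(* If [e] were parallel to the side at [a], its length below 1 would again put a vertex strictly
   inside a side. *)
have [E0|E0] := eqVneq (area u (side v a) e) 0.
  exfalso; have eE : e = dot e (side v a) *: side v a.
    rewrite {1}(plane_decomp hu (ss a) (su a) he) [dot e (cross _ _)]dotC.
    by rewrite -/(area u _ _) E0 scale0r addr0.
  set t := dot e _ in eE.
  have tt : t ^+ 2 < 1.
    by move: e1; rewrite eE dotZl dotZr ss; nra.
  have t0 : t != 0 by apply: contra en0 => /eqP t0; rewrite eE t0 scale0r.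
  have [tn|tp] : t < 0 \/ 0 < t by case: ltgtP t0; auto.
    apply: (@inside a (1 + t) vb (ord_pred b)); [|nra|nra].
    by rewrite sideE_pred sE opprK vb {1}eE scalerDl scale1r; apply: rV3P; rewrite !mxE; ring.
  by apply: (@inside a t vb b) => //; [rewrite vb -eE|nra].
have Ep : 0 < area u (side v a) e by rewrite lt_neqAle eq_sym E0.
have := am y1 y2 (su _) (su _); have := am y1 e (su _) he; have := am y2 e (su _) he.
rewrite sa1 !mulr1 areaNr in f4 *.
move=> k2 k1 ->; rewrite k1 in f3; rewrite k2 in f4.
rewrite -(pmulr_lge0 _ Ep).
nra.
Qed.

Lemma simple_vertex_free (R : realType) n (v : 'I_n -> 'rV[R]_3) :
  simple_polygon v -> vertex_free_sides v.
Proof.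
move=> hs i j t /andP[t0 t1] h; have [] // := hs i j t 0; rewrite ?lexx ?ltr01 ?t0 //.
by rewrite -h scale0r addr0.
Qed.

(** [peel] carries a shortest diagonal of length below 1, unchanged, to the vertices a + k and b -
    k. Halfway along the chain these coincide or are consecutive, so the diagonal would be 0 or a
    unit side. *)
Lemma vertex_dist (R : realType) n (u : 'rV[R]_3) (v : 'I_n -> 'rV[R]_3) a b :
  oriented_polygon u v -> vertex_free_sides v -> injective v -> a != b ->
  1 <= dot (v b - v a) (v b - v a).
Proof.
move=> ho hvf hinj ab; rewrite leNgt; apply/negP => h1.
pose F (x : 'I_n * 'I_n) := dot (v x.2 - v x.1) (v x.2 - v x.1).
have [[a0 b0] /= ab0 hmin] := @arg_minP _ _ _ (a, b) (fun x => x.1 != x.2) F ab.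
have {}h1 : F (a0, b0) < 1 by apply: le_lt_trans h1; exact: (hmin (a, b)).
rewrite /F /= in h1.
have {}hmin i j : i != j -> dot (v b0 - v a0) (v b0 - v a0) <= dot (v j - v i) (v j - v i).
  by move=> ij; exact: (hmin (i, j)).
have e0 : v b0 - v a0 != 0 by apply: contra ab0; rewrite subr_eq0 => /eqP /hinj ->.
clear a b ab F.
wlog D : a0 b0 ab0 h1 hmin e0 / 0 <= area u (side v a0) (side v (ord_pred b0)).
  move=> hw; have [D|D] := chain_choice ho e0; first exact: (hw a0 b0).
  have sw : dot (v a0 - v b0) (v a0 - v b0) = dot (v b0 - v a0) (v b0 - v a0).
    by rewrite -opprB dotNl dotNr opprK.
  apply: (hw b0 a0); [by rewrite eq_sym | by rewrite sw | by move=> i j; rewrite sw; exact: hmin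
    | by rewrite subr_eq0 eq_sym -subr_eq0 | exact: D].
set e := v b0 - v a0 in h1 hmin e0.
pose R' k := v (iter k (@ord_pred n) b0) - v (iter k (@ordS n) a0) = e /\
  0 <= area u (side v (iter k (@ordS n) a0)) (side v (ord_pred (iter k (@ord_pred n) b0))).
have hR k : R' k.
  elim: k => [|k [eE Dk]]; first by [].
  rewrite /R' /=; set a := iter k _ a0 in eE Dk *; set b := iter k _ b0 in eE Dk *.
  have ab : a != b by apply: contra e0 => /eqP ab; rewrite -eE ab subrr.
  have [] := peel ho hvf hinj ab _ _ Dk; rewrite ?eE // => sE D'.
  split=> //; rewrite sideE_pred (sideE v a) sE -eE; apply: rV3P; rewrite !mxE; ring.
have [m hm] := ordS_iter a0 b0.
have pS k i : iter k (@ord_pred n) (iter k (@ordS n) i) = i.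
  by elim: k i => // k IH i; rewrite iterS [iter k.+1 (@ordS n) i]iterSr IH ordSK.
have [hk _] := hR m./2.
have mE : m = (m./2 + (odd m + m./2))%N.
  by rewrite addnCA addnn odd_double_half.
move: hk; rewrite -hm {2}mE iterD pS iterD.
case: (odd m) => /= h.
  by have [_ _ ss _ _] := ho; move: h1; rewrite -h ss ltxx.
by move: e0; rewrite -h subrr eqxx.
Qed.

(** * The star configuration and its thickness *)

(** Circle of centre [p + k] through [p] in the plane of [k] and [u]. The coordinate r along [k]
    runs over [0, 2], which puts the circle on the outer side of the supporting plane at [p]. *)
Definition meridian (R : realType) (u p k : 'rV[R]_3) : set 'rV[R]_3 :=
  [set x | exists r s : R, (r - 1) ^+ 2 + s ^+ 2 = 1 /\ x = p + r *: k + s *: u].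

Definition parallel_set (R : realType) (n : nat) (u : 'rV[R]_3) (v : 'I_n -> 'rV[R]_3)
    (pr : 'rV[R]_3 -> 'rV[R]_3) : set 'rV[R]_3 :=
  [set x | (forall i, dot u (x - v i) = 0) /\ dot (x - pr x) (x - pr x) = 1].

Record star_config (R : realType) (n : nat) (u : 'rV[R]_3) (v k : 'I_n -> 'rV[R]_3)
    (pr : 'rV[R]_3 -> 'rV[R]_3) : Prop := StarConfig {
  sc_orient : oriented_polygon u v;
  sc_simple : simple_polygon v;
  sc_proj : projection (polygon_region v) pr;
  sc_unit : forall i, dot (k i) (k i) = 1;
  sc_plane : forall i, dot u (k i) = 0;
  sc_normal : forall i, normal_to (polygon_region v) (v i) (k i) }.

Lemma meridianN (R : realType) (u p k : 'rV[R]_3) : meridian (- u) p k = meridian u p k.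
Proof.
by apply/seteqP; split=> x [r [s [h ->]]]; exists r, (- s); rewrite sqrrN scaleNr ?scalerN ?opprK;
  split=> //; rewrite scalerN.
Qed.

Lemma unit_circle_meridian (R : realType) (u p k w : 'rV[R]_3) : dot u u = 1 ->
  dot k k = 1 -> dot u k = 0 -> w != 0 -> dot w u = 0 -> dot w k = 0 ->
  unit_circle (p + k) w = meridian u p k.
Proof.
move=> hu hk uk w0 wu wk; set a := enorm w.
have a0 : a != 0 by rewrite gt_eqF // enorm_gt0.
pose w' := a^-1 *: w.
have hw' : dot w' w' = 1.
  by rewrite /w' dotZl dotZr -enorm2 -/a; field.
have w'k : dot w' k = 0 by rewrite /w' dotZl wk mulr0.
have w'u : dot w' u = 0 by rewrite /w' dotZl wu mulr0.
have uE := plane_decomp hw' hk w'k w'u; rewrite uk scale0r add0r in uE.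
set m := cross w' k in uE; set kap := dot u m in uE.
have mm : dot m m = 1 by rewrite /m dot_cross2 hw' hk w'k; ring.
have kap1 : kap * kap = 1 by move: hu; rewrite uE dotZl dotZr mm mulr1.
have mE : m = kap *: u by rewrite uE scalerA kap1 scale1r.
apply/seteqP; split=> x.
  move=> [/enorm1 h1 h2]; set y := x - (p + k) in h1 h2.
  have w'y : dot w' y = 0 by rewrite /w' dotZl h2 mulr0.
  have yE := plane_decomp hw' hk w'k w'y; rewrite -/m mE scalerA in yE.
  set al := dot y k in yE; set be := _ * kap in yE.
  exists (al + 1), be; split.
    move: h1; rewrite yE dotDD !dotZl !dotZr hk hu (dotC k u) uk addrK; lra.
  rewrite (_ : x = y + (p + k)); last by rewrite /y subrK.
  by rewrite yE; apply: rV3P; rewrite !mxE; ring.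
move=> [r [s [h ->]]].
have -> : p + r *: k + s *: u = (p + k) + ((r - 1) *: k + s *: u).
  by apply: rV3P; rewrite !mxE; ring.
rewrite /unit_circle /= addrAC subrr add0r; split.
  by apply/enorm1; rewrite dotDD !dotZl !dotZr hk hu (dotC k u) uk; lra.
by rewrite dotDr !dotZr wk wu; ring.
Qed.

(** The point [c i] is at distance exactly 1 from the region and [v i] realises it, so [c i - v i]
    is an outer normal at [v i]. The sign of the plane normal is adjusted to orient the polygon; the
    circles do not depend on it. *)
Lemma star_setup (R : realType) (n : nat) (u : 'rV[R]_3)
    (v : 'I_n -> 'rV[R]_3) (c w : 'I_n -> 'rV[R]_3)
    (hn : (3 <= n)%N)
    (hP : convex_planar_polygon u v)
    (hside : forall i, enorm (side v i) = 1)
    (hangle : forall i, 0 <= turning_angle v i <= 2 * pi / 3)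
    (hc : forall i, outer_parallel_curve u v 1 (c i))
    (hw : forall i, w i != 0 /\ dot (w i) u = 0)
    (hthrough : forall i, unit_circle (c i) (w i) (v i)) :
  exists u' k pr, [/\ star_config u' v k pr,
    outer_parallel_curve u v 1 = parallel_set u' v pr,
    forall i, c i = v i + k i &
    forall i, unit_circle (c i) (w i) = meridian u' (v i) (k i)].
Proof.
have n0 : (0 < n)%N by apply: leq_trans hn.
have hd i : - (1 / 2) <= dot (side v (ord_pred i)) (side v i).
  by apply: turning_dot => //; have /andP[] := hangle i.
have [hs /enorm1 hu hpl _] := hP.
have [u' [u'E hu' hor]] := orientation n0 hP hside hd.
have [pr hpr] := region_projection v n0.
have dot0 x : dot u' x = 0 <-> dot u x = 0.
  by case: u'E => ->; rewrite // dotNl; split=> [/eqP|->]; rewrite ?oppr0 // oppr_eq0 => /eqP.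
have ho : oriented_polygon u' v.
  split=> //; [by move=> i j; apply/dot0|by move=> i; apply/enorm1].
have nk i : enorm (c i - v i) = 1 by have [h _] := hthrough i; rewrite enormB.
have ck i : dot u (c i - v i) = 0 by have [h _] := hc i.
exists u', (fun i => c i - v i), pr; split.
- split=> //; [by move=> i; apply/enorm1|by move=> i; apply/dot0|move=> i].
  apply: nearest_normal; [exact: region_convex|exact: region_vertex|move=> y hy].
  by rewrite nk; have [_ <-] := hc i; exact: dist_to_set_le.
- apply/seteqP; split=> x [h1 h2]; split.
  + by move=> i; apply/dot0.
  + by apply/enorm1; rewrite -(proj_dist _ hpr).
  + by move=> i; apply/dot0.
  + by rewrite (proj_dist _ hpr); apply/enorm1.
- by move=> i; rewrite addrC subrK.
- move=> i; have [w0 wu] := hw i.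
  have cE : c i = v i + (c i - v i) by rewrite addrC subrK.
  rewrite {1}cE; have [h1 h2] := hthrough i.
  have -> : meridian u' (v i) (c i - v i) = meridian u (v i) (c i - v i).
    by case: u'E => ->; rewrite ?meridianN.
  apply: unit_circle_meridian => //; first exact/enorm1.
  by rewrite -opprB dotNr h2 oppr0.
Qed.

Lemma meridian_bounds (R : realType) (r s : R) :
  (r - 1) ^+ 2 + s ^+ 2 = 1 -> 0 <= r /\ r <= 2.
Proof. by move=> h; have := sqr_ge0 s; split; nra. Qed.

Lemma sc_vertex (R : realType) (n : nat) (u : 'rV[R]_3) (v k : 'I_n -> 'rV[R]_3) pr i j :
  star_config u v k pr -> dot (k i) (v j - v i) <= 0.
Proof. by case=> _ _ _ _ _ /(_ i); apply; exact: region_vertex. Qed.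

Lemma sc_dist (R : realType) (n : nat) (u : 'rV[R]_3) (v k : 'I_n -> 'rV[R]_3) pr i j :
  star_config u v k pr -> i != j -> 1 <= dot (v j - v i) (v j - v i).
Proof.
move=> hc ij; apply: (vertex_dist (sc_orient hc)) => //.
  exact/simple_vertex_free/(sc_simple hc).
exact/simple_polygon_inj/(sc_simple hc).
Qed.

Lemma meridian_sep (R : realType) (n : nat) (u : 'rV[R]_3) (v k : 'I_n -> 'rV[R]_3) pr i j x :
  star_config u v k pr -> meridian u (v j) (k j) x ->
  dot (v j - v i) (v j) <= dot (v j - v i) x.
Proof.
move=> hc [r [s [h ->]]]; have [hu hpl _ _ _] := sc_orient hc.
have [r0 _] := meridian_bounds h.
have h1 : dot (v j - v i) (k j) >= 0.
  by rewrite dotC -opprB dotNr oppr_ge0; exact: sc_vertex hc.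
have h2 : dot (v j - v i) u = 0 by rewrite dotC.
rewrite !dotDr !dotZr h2 mulr0 addr0 lerDl; exact: mulr_ge0.
Qed.

(** Each circle lies beyond the plane through its vertex orthogonal to [v j - v i], because [k] is
    an outer normal; these two planes are at least 1 apart. *)
Lemma meridian_dist (R : realType) (n : nat) (u : 'rV[R]_3) (v k : 'I_n -> 'rV[R]_3) pr i j x y :
  star_config u v k pr -> i != j -> meridian u (v i) (k i) x -> meridian u (v j) (k j) y ->
  1 <= enorm (x - y).
Proof.
move=> hc ij hx hy; have h1 := meridian_sep j hc hx; have h2 := meridian_sep i hc hy.
have h3 := sc_dist hc ij; rewrite enorm_ge // expr1n.
have := dot_sqr_le (v j - v i) (y - x).
have -> : dot (y - x) (y - x) = dot (x - y) (x - y) by rewrite -opprB dotNl dotNr opprK.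
have h4 : dot (v j - v i) (v j - v i) <= dot (v j - v i) (y - x).
  have e1 : dot (v i - v j) (v i) = - dot (v j - v i) (v i) by rewrite -opprB dotNl.
  have e2 : dot (v i - v j) x = - dot (v j - v i) x by rewrite -opprB dotNl.
  rewrite e1 e2 in h1.
  have e3 : dot (v j - v i) (v j - v i) = dot (v j - v i) (v j) - dot (v j - v i) (v i).
    by rewrite [LHS]dotDr dotNr.
  by rewrite [X in X <= _]e3 [X in _ <= X]dotDr dotNr; lra.
move: h3 h4; set A := dot _ (v j - v i); set B := dot _ (y - x); set D := dot (x - y) _.
move=> A1 AB BAD.
have : A * A <= A * D by nra.
rewrite ler_pM2l; lra.
Qed.

Lemma parallel_vertex_dist (R : realType) (n : nat) (u : 'rV[R]_3) (v k : 'I_n -> 'rV[R]_3)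
    pr i x :
  star_config u v k pr -> parallel_set u v pr x -> 1 <= enorm (x - v i).
Proof.
move=> hc [_ /enorm1 <-]; rewrite -(proj_dist x (sc_proj hc)).
exact/dist_to_set_le/region_vertex.
Qed.

(** Let f be the foot [v i + r *: k i] of the point of the circle. The squared distance is |x - f|^2
    + s^2, so |x - f| >= |r - 1| is enough. For r <= 1 this is the triangle inequality with |x - v
    i| >= 1; for r > 1 the supporting plane at [v i] bounds the height of x along [k i] by 1, while
    f has height r. *)
Lemma parallel_meridian_dist (R : realType) (n : nat) (u : 'rV[R]_3)
    (v k : 'I_n -> 'rV[R]_3) pr i x y :
  star_config u v k pr -> parallel_set u v pr x -> meridian u (v i) (k i) y ->
  1 <= enorm (x - y).
Proof.
move=> hc hx [r [s [h ->]]]; have [hu hpl _ _ _] := sc_orient hc.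
have hv := parallel_vertex_dist i hc hx; have [hxp hxd] := hx.
have [r0 r2] := meridian_bounds h.
have hk := sc_unit hc i; have uk := sc_plane hc i.
have suff_h : (r - 1) ^+ 2 <= dot (x - (v i + r *: k i)) (x - (v i + r *: k i)) ->
    1 <= enorm (x - (v i + r *: k i + s *: u)).
  move=> hh; rewrite enorm_ge // expr1n opprD addrA dotBB !dotZl !dotZr hu.
  have -> : dot (x - (v i + r *: k i)) u = 0.
    by rewrite opprD addrA dotC dotDr hxp dotNr dotZr uk; ring.
  by lra.
apply: suff_h; rewrite -enorm2.
have [r1|r1] := leP r 1.
  have := enorm_tri x (v i + r *: k i) (v i).
  rewrite [v i + _ - _]addrAC subrr add0r enormZ.
  have /enorm1 -> := hk; rewrite mulr1 ger0_norm // => ht.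
  rewrite -[(r - 1) ^+ 2]sqrrN ler_pXn2r ?nnegrE ?enorm_ge0 //; lra.
rewrite ler_pXn2r ?nnegrE ?enorm_ge0 ?subr_ge0 ?(ltW r1) //.
have := dot_lb (k i) (x - (v i + r *: k i)).
have /enorm1 -> := hk; rewrite mul1r => ht.
have kx : dot (k i) (x - v i) <= 1.
  have h1 : dot (k i) (pr x - v i) <= 0.
    by apply: (sc_normal hc); have [] := sc_proj hc x.
  have h2 : dot (k i) (x - pr x) <= 1.
    by apply: le_trans (dot_ub _ _) _; have /enorm1 -> := hk; have /enorm1 -> := hxd; rewrite mulr1.
  have -> : x - v i = (x - pr x) + (pr x - v i) by rewrite subrKA.
  by rewrite dotDr; lra.
have : dot (k i) (x - (v i + r *: k i)) = dot (k i) (x - v i) - r.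
  by rewrite opprD addrA [LHS]dotDr dotNr dotZr hk mulr1.
lra.
Qed.

Lemma star_thickness (R : realType) (n : nat) (u : 'rV[R]_3) (v k : 'I_n -> 'rV[R]_3)
    pr (L : 'I_n.+1 -> set 'rV[R]_3) : (1 < n)%N -> star_config u v k pr ->
  L ord0 = parallel_set u v pr ->
  (forall i, L (lift ord0 i) = meridian u (v i) (k i)) ->
  LThi L = 1 /\ forall i j x y, i != j -> L i x -> L j y -> 1 <= enorm (x - y).
Proof.
move=> n1 hc h0 hi.
have hd i j x y : i != j -> L i x -> L j y -> 1 <= enorm (x - y).
  case: (unliftP ord0 i) => [i' ->|->]; case: (unliftP ord0 j) => [j' ->|->]; rewrite ?hi ?h0.
  - by rewrite (inj_eq lift_inj) => ij; exact: meridian_dist hc ij.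
  - by move=> _ hx hy; rewrite enormB; exact: parallel_meridian_dist hc hy hx.
  - by move=> _ hx hy; exact: parallel_meridian_dist hc hx hy.
  - by rewrite eqxx.
split=> //.
pose i0 := Ordinal (ltnW n1); pose i1 := ordS i0.
have i01 : i0 != i1 by rewrite -val_eqE /= modn_small.
have hv i : meridian u (v i) (k i) (v i).
  by exists 0, 0; rewrite !scale0r !addr0; split=> //; ring.
have [_ _ ss _ _] := sc_orient hc.
(* The value 1 is attained between consecutive vertices, each lying on its own circle at r = s =
   0. *)
have mem1 : [set r | exists i j x y,
         [/\ i != j, L i x, L j y & r = enorm (x - y)]] 1.
  exists (lift ord0 i0), (lift ord0 i1), (v i0), (v i1).
  rewrite (inj_eq lift_inj) i01 !hi; split=> //.
  by rewrite enormB; apply/esym/enorm1; exact: ss.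
apply: le_anti; apply/andP; split.
  by apply: ge_inf => //; exists 1 => _ [i [j [x [y [ij hx hy ->]]]]]; exact: hd ij hx hy.
apply: lb_le_inf; first by exists 1.
by move=> _ [i [j [x [y [ij hx hy ->]]]]]; exact: hd ij hx hy.
Qed.

(** * One-sided derivative of the thickness *)

Lemma enorm_add_lb (R : realType) (x y : 'rV[R]_3) t : 0 < enorm x ->
  enorm x + t * (dot x y / enorm x) <= enorm (x + t *: y).
Proof.
move=> a0; rewrite -(ler_pM2r a0).
have := dot_ub (x + t *: y) x; rewrite dotDl dotZl -enorm2 (dotC y x).
rewrite mulrDl -expr2 -mulrA divfK ?gt_eqF //.
Qed.

Lemma enorm_add_ub (R : realType) (x y : 'rV[R]_3) t M : 1 <= enorm x -> enorm y <= M ->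
  0 <= t -> t * M <= 1 / 2 ->
  enorm (x + t *: y) <= enorm x + t * (dot x y / enorm x) + t ^+ 2 * M ^+ 2.
Proof.
move=> a1 yM t0 tM; have a0 : 0 < enorm x by lra.
have bM : - M <= dot x y / enorm x.
  rewrite ler_pdivlMr //; have := dot_lb x y.
  have : enorm x * enorm y <= enorm x * M by rewrite ler_pM2l.
  lra.
set b := _ / _ in bM *.
have tb : - (1 / 2) <= t * b.
  have : t * - M <= t * b by rewrite ler_wpM2l.
  lra.
have Mge : 0 <= M by apply: le_trans yM; exact: enorm_ge0.
have q0 : 0 <= t ^+ 2 * M ^+ 2 by rewrite mulr_ge0 ?sqr_ge0.
have xy : dot x y = b * enorm x by rewrite /b divfK // gt_eqF.
rewrite enorm_le; last by lra.
rewrite dotDD !dotZl !dotZr -!enorm2 xy.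
have yy : enorm y ^+ 2 <= M ^+ 2 by rewrite ler_pXn2r ?nnegrE ?enorm_ge0.
have tyy : t ^+ 2 * enorm y ^+ 2 <= t ^+ 2 * M ^+ 2 by rewrite ler_wpM2l ?sqr_ge0.
move: tyy q0; set q := t ^+ 2 * M ^+ 2; set w := enorm x + t * b.
have w2 : 1 / 2 <= w by rewrite /w; lra.
move=> tyy q0.
have : enorm x ^+ 2 + 2 * (t * (b * enorm x)) <= w ^+ 2.
  by rewrite /w; have := sqr_ge0 (t * b); lra.
have : w ^+ 2 + q <= (w + q) ^+ 2 by nra.
lra.
Qed.

(* Infima taken over near-minimisers make the one-sided derivative of a minimum
   exist without any compactness of the index set. *)
Lemma danskin (R : realType) (Z : Type) (D E : Z -> 'rV[R]_3) (M : R) (z0 : Z) :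
  (forall z, 1 <= enorm (D z)) -> (forall z, enorm (E z) <= M) ->
  enorm (D z0) = 1 -> dot (D z0) (E z0) < 0 ->
  exists2 d, t^-1 * (inf [set enorm (D z + t *: E z) | z in setT] - 1) @[t --> 0^'+] --> d
    & d < 0.
Proof.
move=> hD hE hz0 hneg.
have M0 : 0 <= M by apply: le_trans (hE z0); exact: enorm_ge0.
pose b z := dot (D z) (E z) / enorm (D z).
have a0 z : 0 < enorm (D z) by apply: lt_le_trans (hD z).
have bM z : - M <= b z.
  rewrite ler_pdivlMr //; have := dot_lb (D z) (E z).
  have : enorm (D z) * enorm (E z) <= enorm (D z) * M by rewrite ler_pM2l.
  lra.
(* Rates of change over the pairs within e of the minimal distance. The infimum of [S e] grows as e
   shrinks, and its supremum is the derivative. *)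
pose S (e : R) := [set b z | z in [set z | enorm (D z) <= 1 + e]].
have S0 e : 0 < e -> S e !=set0.
  by move=> e0; exists (b z0), z0 => //=; rewrite hz0; lra.
have Slb e : has_lbound (S e) by exists (- M) => _ [z _ <-].
have Sle e z : enorm (D z) <= 1 + e -> inf (S e) <= b z.
  by move=> h; apply: ge_inf => //; exists z.
pose T := [set inf (S e) | e in [set e | 0 < e]].
have bz0 e : 0 < e -> inf (S e) <= b z0 by move=> e0; apply: Sle; rewrite hz0; lra.
have Tub : has_ubound T by exists (b z0) => _ [e e0 <-]; exact: bz0.
have T0 : T !=set0 by exists (inf (S 1)), 1 => //=.
have supT : has_sup T by [].
pose d := sup T.
have dneg : d < 0.
  apply: le_lt_trans (_ : b z0 < 0); last by rewrite /b hz0 divr1.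
  by apply: ge_sup => // _ [e e0 <-]; exact: bz0.
have md e : 0 < e -> inf (S e) <= d by move=> e0; apply: ub_le_sup => //; exists e.
exists d => //.
pose g t := inf [set enorm (D z + t *: E z) | z in setT].
have g_le t z : g t <= enorm (D z + t *: E z).
  by apply: ge_inf; [exists 0 => _ [y _ <-]; exact: enorm_ge0|exists z].
have g_ge t x : (forall z, x <= enorm (D z + t *: E z)) -> x <= g t.
  by move=> h; apply: lb_le_inf; [exists (enorm (D z0 + t *: E z0)), z0|move=> _ [z _ <-]].
apply/cvgrPdist_le => eta eta0.
have [_ [e0 /= e00 <-] he0] := sup_adherent eta0 supT.
rewrite -/d in he0.
(* The upper bound takes a pair from [S (t ^+ 2)] whose rate is within t of the infimum: t^2 is lost
   on its distance, t^2 on its rate, and M^2 t^2 on the second-order term of the norm. *)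
pose K := 2 + M ^+ 2.
have K0 : 0 < K by rewrite /K; have := sqr_ge0 M; lra.
have c1 : 0 < e0 / (M + 1) by rewrite divr_gt0 //; lra.
have c2 : 0 < eta / K by rewrite divr_gt0.
have c3 : 0 < 1 / (2 * (M + 1)) by rewrite divr_gt0 // mulr_gt0 //; lra.
near=> t.
have t0 : 0 < t by near: t; exact: nbhs_right_gt.
have t1 : t < e0 / (M + 1) by near: t; exact: nbhs_right_lt.
have t2 : t < eta / K by near: t; exact: nbhs_right_lt.
have t3 : t < 1 / (2 * (M + 1)) by near: t; exact: nbhs_right_lt.
have {}t1 : t * M <= e0.
  by move: t1; rewrite ltr_pdivlMr; [nra|lra].
have {}t2 : t * K <= eta by move: t2; rewrite ltr_pdivlMr //; exact: ltW.
have {}t3 : t * M <= 1 / 2.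
  by move: t3; rewrite ltr_pdivlMr; [nra|lra].
have lower : t * (d - eta) <= g t - 1.
  rewrite lerBrDr addrC; apply: g_ge => z.
  apply: le_trans (enorm_add_lb (E z) t (a0 z)); rewrite -/(b z).
  have [h|h] := leP (enorm (D z)) (1 + e0).
    have := Sle _ _ h; have := hD z => h1 h2.
    have : t * (d - eta) <= t * b z by rewrite ler_pM2l //; lra.
    lra.
  (* A pair farther than 1 + e0 stays at distance at least 1 because t M <= e0, and the bound to be
     proved is at most 1 since d is negative. *)
  have : t * - M <= t * b z by rewrite ler_pM2l.
  have : t * (d - eta) <= 0 by rewrite pmulr_rle0 //; lra.
  lra.
have upper : g t - 1 <= t * (d + eta).
  have t20 : 0 < t ^+ 2 by rewrite exprn_gt0.
  have hi : has_inf (S (t ^+ 2)) by split=> //; exact: S0.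
  have [_ [z /= hz <-] hb] := inf_adherent t0 hi.
  have := g_le t z; have := enorm_add_ub (hD z) (hE z) (ltW t0) t3; rewrite -/(b z).
  have hbd : t * b z <= t * (d + t).
    by rewrite ler_pM2l //; have := md _ t20; lra.
  have : t * (t * K) <= t * eta by rewrite ler_pM2l.
  rewrite /K; lra.
rewrite ler_distlC; apply/andP; split.
  by rewrite mulrC ler_pdivlMr // mulrC.
by rewrite mulrC ler_pdivrMr // mulrC.
Unshelve. all: by end_near. Qed.

(** * First variation of length *)

Lemma arclength_lip (R : realType) l (g : R -> 'rV[R]_3) a b :
  arclength_closed_curve l g -> a <= b -> enorm (g b - g a) <= b - a.
Proof.
move=> [_ _ hlen]; rewrite le_eqVlt => /orP[/eqP ->|ab].
  by rewrite !subrr enorm0.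
rewrite -lee_fin -(hlen _ _ ab); apply: ereal_sup_ubound.
by exists [:: b]; [exact: itv_partition1|rewrite /= big_nat1].
Qed.

Lemma arclength_dist (R : realType) l (g : R -> 'rV[R]_3) a b :
  arclength_closed_curve l g -> enorm (g b - g a) <= `|b - a|.
Proof.
move=> hg; have [ab|/ltW ba] := leP a b.
  by rewrite ger0_norm ?subr_ge0 //; exact: arclength_lip hg ab.
by rewrite enormB distrC ger0_norm ?subr_ge0 //; exact: arclength_lip hg ba.
Qed.

(** Bounds on chords by increments of [F] telescope over a partition; the supremum over partitions
    replaces the chord by the arclength. *)
Lemma arclength_le (R : realType) l (g : R -> 'rV[R]_3) (F : R -> R) k a b :
  arclength_closed_curve l g -> 0 < k -> a < b ->
  (forall s t, a <= s -> s < t -> t <= b -> k * enorm (g t - g s) <= F t - F s) ->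
  k * (b - a) <= F b - F a.
Proof.
move=> [_ _ hlen] k0 ab hF; rewrite mulrC -ler_pdivlMr // -lee_fin -(hlen _ _ ab).
apply: ge_ereal_sup => _ [s hs <-]; rewrite lee_fin ler_pdivlMr // mulr_suml.
pose p := nth b (a :: s).
apply: (@le_trans _ _ (\sum_(0 <= i < size s) (F (p i.+1) - F (p i)))); last first.
  by rewrite telescope_sumr // /p /= (itv_partition_nth_size _ hs).
rewrite !big_nat; apply: ler_sum => i /andP[_ hi]; rewrite mulrC -!/(p _).
apply: hF; rewrite /p.
- by apply: itv_partition_nth_ge => //; exact: ltnW.
- by case: hs => /(pathP b) h _; exact: h.
- by apply: itv_partition_nth_le.
Qed.

Lemma periodicz (R : realType) (V : zmodType) (g : R -> V) l (m : int) x :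
  periodic g l -> g (x + m%:~R * l) = g x.
Proof.
move=> hp; have hn (k : nat) y : g (y + k%:R * l) = g y.
  elim: k y => [|k IH] y; first by rewrite mul0r addr0.
  by rewrite -addn1 natrD mulrDl mul1r addrA hp IH.
case: m => k; first exact: hn.
by rewrite NegzE mulrNz mulNr -[LHS](hn k.+1) pmulrn subrK.
Qed.

Lemma arclength_inj (R : realType) l (S : set 'rV[R]_3) (g : R -> 'rV[R]_3) s t :
  simple_arclength_param S l g -> s < t -> t < s + l -> g s <> g t.
Proof.
move=> [[l0 hp _] hinj _] st tsl e.
pose m := Num.floor (s / l).
have hm : m%:~R * l <= s < (m + 1)%:~R * l.
  rewrite -ler_pdivlMr // -ltr_pdivrMr //; exact: floor_itv.
rewrite intrD mulrDl mul1r in hm; case/andP: hm => hm1 hm2.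
pose x := s - m%:~R * l; pose y := t - m%:~R * l.
have gx : g x = g s by rewrite /x -mulNr -mulrNz periodicz.
have gy : g y = g t by rewrite /y -mulNr -mulrNz periodicz.
have [yl|ly] := ltP y l.
  have : x = y.
    by apply: hinj; [apply/andP; rewrite /x; split; lra|apply/andP; rewrite /y in yl *; split; lra|rewrite gx gy e].
  rewrite /x /y; lra.
have gy' : g (y - l) = g y by rewrite -[LHS]hp subrK.
have : x = y - l.
  by apply: hinj; [apply/andP; rewrite /x; split; lra|apply/andP; rewrite /y in ly *; split; lra|rewrite gx gy' gy e].
rewrite /x /y; lra.
Qed.

(* A plane set with a 1-Lipschitz unit normal nu along which it lies on one
   side of its tangent lines; both L_0 and the circles are of this form. *)
Record convex_front (R : realType) (u : 'rV[R]_3) (S : set 'rV[R]_3)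
    (nu : 'rV[R]_3 -> 'rV[R]_3) : Prop := ConvexFront {
  cf_u : dot u u = 1;
  cf_unit : forall x, S x -> dot (nu x) (nu x) = 1;
  cf_nu : forall x, S x -> dot u (nu x) = 0;
  cf_plane : forall x y, S x -> S y -> dot u (x - y) = 0;
  cf_side : forall x y, S x -> S y -> dot (x - y) (nu y) <= 0;
  cf_lip : forall x y, S x -> S y -> enorm (nu x - nu y) <= enorm (x - y) }.

(** For z = x - y, convexity gives <z, nu y> <= 0 <= <z, nu x>, and the two products differ by at
    most |z|^2. So z is almost orthogonal to the normal at [x0], and its tangential component
    carries almost all of its length. *)
Lemma front_graph (R : realType) (u : 'rV[R]_3) (S : set 'rV[R]_3) nu x0 x y r :
  convex_front u S nu -> S x0 -> S x -> S y -> 0 <= r -> r <= 1 / 3 ->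
  enorm (x - x0) <= r -> enorm (y - x0) <= r ->
  `|dot (x - y) (nu x0)| <= 3 * r * enorm (x - y) /\
  (1 - 3 * r) * enorm (x - y) <= `|dot (x - y) (cross u (nu x0))|.
Proof.
move=> hS S0 Sx Sy r0 r1 hx hy.
set z := x - y; set A := dot z (nu x0); set B := dot z _.
have z0 : 0 <= enorm z by exact: enorm_ge0.
have z2r : enorm z <= 2 * r.
  by have := enorm_tri x x0 y; rewrite (enormB x0 y) -/z; lra.
have hA : `|A| <= 3 * r * enorm z.
  have e1 : A = dot z (nu y) + dot z (nu x0 - nu y) by rewrite /A -dotDr addrC subrK.
  have h1 : dot z (nu y) <= 0 by exact: (cf_side hS).
  have h2 : - (enorm z * enorm z) <= dot z (nu y).
    have h3 : 0 <= dot z (nu x).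
      by have := cf_side hS Sy Sx; rewrite -opprB dotNl oppr_le0.
    have e2 : dot z (nu y) = dot z (nu x) + dot z (nu y - nu x).
      by rewrite -dotDr addrC subrK.
    have h4 := dot_lb z (nu y - nu x).
    have h5 : enorm z * enorm (nu y - nu x) <= enorm z * enorm z.
      by rewrite ler_wpM2l // /z (enormB x y); exact: (cf_lip hS).
    lra.
  have h6 : `|dot z (nu x0 - nu y)| <= enorm z * r.
    apply: le_trans (dot_le _ _) _; rewrite ler_wpM2l //.
    by apply: le_trans (cf_lip hS S0 Sy) _; rewrite enormB.
  have h7 : enorm z * enorm z <= enorm z * (2 * r) by rewrite ler_wpM2l.
  move: h6; rewrite e1 !ler_norml => /andP[h8 h9]; apply/andP; split; lra.
split=> //.
have zE := plane_decomp (cf_u hS) (cf_unit hS S0) (cf_nu hS S0) (cf_plane hS Sx Sy).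
have z2 : enorm z ^+ 2 = A ^+ 2 + B ^+ 2.
  have {}zE : z = A *: nu x0 + B *: cross u (nu x0) := zE.
  rewrite enorm2 zE dotDD !dotZl !dotZr dot_crossr.
  by rewrite dot_cross2 (cf_u hS) (cf_unit hS S0) (cf_nu hS S0); ring.
have A2 : A ^+ 2 <= (3 * r * enorm z) ^+ 2.
  rewrite -(real_normK (num_real A)) ler_pXn2r // nnegrE ?mulr_ge0 //; lra.
rewrite -(@ler_pXn2r _ 2) ?nnegrE ?mulr_ge0 //; last by lra.
rewrite real_normK ?num_real //.
have : 0 <= r * (1 - 3 * r) * enorm z ^+ 2 by rewrite !mulr_ge0 ?sqr_ge0 //; lra.
rewrite !exprMn in A2 *; lra.
Qed.

Lemma arclength_cont (R : realType) l (g : R -> 'rV[R]_3) :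
  arclength_closed_curve l g -> continuous g.
Proof.
move=> hg x; apply: econt_near => e e0; near=> y.
apply: le_lt_trans (arclength_dist _ _ hg) _.
near: y; exact: (@near_dist _ R^o).
Unshelve. all: by end_near. Qed.

(** The tangential coordinate of [g] is continuous and injective on a window shorter than a period,
    hence monotone: the curve never turns back. The sign is its direction of travel, and
    [arclength_le] makes the monotonicity quantitative. The bound l / 3 keeps the window below one
    period; 1 / 12 makes the graph estimates usable. *)
Lemma curve_sign (R : realType) (u : 'rV[R]_3) (S : set 'rV[R]_3) nu l g a r0 :
  convex_front u S nu -> simple_arclength_param S l g ->
  0 < r0 -> r0 <= 1 / 12 -> r0 <= l / 3 ->
  exists2 sg : R, sg = 1 \/ sg = -1 & forall r s t : R, r <= r0 ->
    a - r <= s -> s < t -> t <= a + r ->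
    (1 - 3 * r) * (t - s) <= sg * dot (g t - g s) (cross u (nu (g a))).
Proof.
move=> hS hg r00 r012 r0l; have [hc hinj hrange] := hg.
have Sg x : S (g x) by rewrite -hrange; exists x.
set tau := cross u (nu (g a)).
pose h x := dot (g x) tau.
have near_a r x : a - r <= x -> x <= a + r -> enorm (g x - g a) <= r.
  move=> h1 h2; apply: le_trans (arclength_dist _ _ hc) _.
  by rewrite ler_norml; apply/andP; split; lra.
have hgr r x y : 0 <= r -> r <= r0 -> a - r <= x -> x <= a + r -> a - r <= y -> y <= a + r ->
    (1 - 3 * r) * enorm (g x - g y) <= `|h x - h y|.
  move=> r1 r2 x1 x2 y1 y2; have r3 : r <= 1 / 3 by lra.
  have [_] := front_graph hS (Sg a) (Sg x) (Sg y) r1 r3 (near_a _ _ x1 x2) (near_a _ _ y1 y2).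
  by rewrite -/tau [dot (g x - g y) tau]dotDl dotNl.
have hcont : continuous h.
  move=> x; apply: (@dot_cont _ _ g (fun=> tau) x); [exact: arclength_cont hc x|exact: contC].
have injI : {in `[a - r0, a + r0] &, injective h}.
  move=> x y; rewrite !in_itv /= => /andP[x1 x2] /andP[y1 y2] hxy.
  have := hgr r0 x y (ltW r00) (lexx _) x1 x2 y1 y2; rewrite hxy subrr normr0 => hle.
  have : enorm (g x - g y) = 0.
    apply: le_anti; rewrite enorm_ge0 andbT; rewrite pmulr_rle0 in hle => //; lra.
  move=> /enorm_eq0 /eqP; rewrite subr_eq0 => /eqP gxy.
  have [xy|yx|//] := ltgtP x y.
    by exfalso; apply: (arclength_inj hg xy) gxy; lra.
  by exfalso; apply: (arclength_inj hg yx) (esym gxy); lra.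
have in_I r x : r <= r0 -> a - r <= x -> x <= a + r -> x \in `[a - r0, a + r0].
  by move=> r1 x1 x2; rewrite in_itv /=; apply/andP; split; lra.
have main sg : sg = 1 \/ sg = -1 ->
    (forall x y, x \in `[a - r0, a + r0] -> y \in `[a - r0, a + r0] -> x < y ->
       sg * h x < sg * h y) ->
    forall r s t : R, r <= r0 -> a - r <= s -> s < t -> t <= a + r ->
    (1 - 3 * r) * (t - s) <= sg * dot (g t - g s) tau.
  move=> hsg hmono r s t rr s1 st t1.
  have r1 : 0 <= r by lra.
  have := @arclength_le _ _ _ (fun x => sg * h x) (1 - 3 * r) s t hc _ st.
  rewrite -mulrBr dotDl dotNl; apply; first by lra.
  move=> x y sx xy yt.
  apply: le_trans (hgr r y x r1 rr _ _ _ _) _; try lra.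
  have : sg * h x < sg * h y.
    by apply: hmono => //; apply: (in_I r) => //; lra.
  rewrite -mulrBr -subr_gt0 -mulrBr.
  case: hsg => ->; rewrite ?mul1r ?mulN1r => hh; first by rewrite gtr0_norm.
  by rewrite ltr0_norm //; lra.
have [hm|hm] := itv_continuous_inj_mono (continuous_subspaceT hcont) injI.
  exists 1; first by left.
  by apply: main; [left|move=> x y hx hy xy; rewrite !mul1r; exact: hm].
exists (-1); first by right.
by apply: main; [right|move=> x y hx hy xy; rewrite !mulN1r ltrN2; exact: hm].
Qed.

Definition curve_derivative (R : realType) (g : R -> 'rV[R]_3) (a : R) (T : 'rV[R]_3) :=
  forall e : R, 0 < e -> exists2 d : R, 0 < d &
    forall h : R, `|h| < d -> enorm (g (a + h) - g a - h *: T) <= e * `|h|.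

(** An arclength parametrization is only known to be Lipschitz. Its derivative exists because chords
    are almost tangential and have almost full speed; the sign is locally constant, so the tangent
    varies as continuously as the normal. *)
Lemma curve_tangent (R : realType) (u : 'rV[R]_3) (S : set 'rV[R]_3) nu l g s0 :
  convex_front u S nu -> simple_arclength_param S l g ->
  exists2 sg : R, sg = 1 \/ sg = -1 & exists2 d : R, 0 < d &
    forall a, `|a - s0| < d -> curve_derivative g a (sg *: cross u (nu (g a))).
Proof.
move=> hS hg; have [hc hinj hrange] := hg; have [l0 _ _] := hc.
have Sg x : S (g x) by rewrite -hrange; exists x.
pose r0 := Num.min (1 / 12) (l / 3) : R.
have r00 : 0 < r0 by rewrite lt_min; apply/andP; split; lra.
have r012 : r0 <= 1 / 12 by rewrite ge_min lexx.
have r0l : r0 <= l / 3 by rewrite ge_min lexx orbT.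
have [sg hsg hsign] := curve_sign s0 hS hg r00 r012 r0l.
have tu a : dot (cross u (nu (g a))) (cross u (nu (g a))) = 1.
  by rewrite dot_cross2 (cf_u hS) (cf_unit hS (Sg a)) (cf_nu hS (Sg a)); ring.
exists sg => //; exists (r0 / 2); first by lra.
move=> a; rewrite ltr_distl => /andP[a1 a2].
have [sg' hsg' hsign'] := curve_sign a hS hg r00 r012 r0l.
(* One chord, from a to a + r0 / 4, is tested against the tangents at [a] and at [s0]; these differ
   by at most r0, too little for opposite signs. *)
have sgE : sg' = sg.
  pose t := a + r0 / 4.
  have p1 := hsign r0 a t (lexx _); have p2 := hsign' r0 a t (lexx _).
  have {}p1 : (1 - 3 * r0) * (t - a) <= sg * dot (g t - g a) (cross u (nu (g s0))).
    by apply: p1; rewrite /t; lra.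
  have {}p2 : (1 - 3 * r0) * (t - a) <= sg' * dot (g t - g a) (cross u (nu (g a))).
    by apply: p2; rewrite /t; lra.
  have p3 : `|dot (g t - g a) (cross u (nu (g a)) - cross u (nu (g s0)))| <= (t - a) * r0.
    apply: le_trans (dot_le _ _) _; apply: ler_pM; rewrite ?enorm_ge0 //.
      by apply: arclength_lip hc _; rewrite /t; lra.
    have -> : cross u (nu (g a)) - cross u (nu (g s0)) = cross u (nu (g a) - nu (g s0)).
      by rewrite crossDr crossNr.
    rewrite enorm_le ?(ltW r00) // dot_cross2 (cf_u hS) mul1r.
    apply: (@le_trans _ _ (dot (nu (g a) - nu (g s0)) (nu (g a) - nu (g s0)))).
      by rewrite lerBlDr lerDl -expr2 sqr_ge0.
    rewrite -enorm_le ?(ltW r00) //; apply: le_trans (cf_lip hS (Sg _) (Sg _)) _.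
    by apply: le_trans (arclength_dist _ _ hc) _; rewrite ler_norml; apply/andP; split; lra.
  have e1 : dot (g t - g a) (cross u (nu (g a))) = dot (g t - g a) (cross u (nu (g s0)))
      + dot (g t - g a) (cross u (nu (g a)) - cross u (nu (g s0))).
    by rewrite -dotDr subrKC.
  move: p1 p2 p3 e1; set A := dot _ _; set B := dot _ _; set D := dot _ _.
  have tE : t - a = r0 / 4 by rewrite /t; ring.
  rewrite tE ler_norml => p1 p2 /andP[p3 p4] e1.
  have : 0 < r0 * r0 by rewrite mulr_gt0.
  have : r0 * r0 <= r0 * (1 / 12) by rewrite ler_pM2l.
  case: hsg p1 => ->; case: hsg' p2 => -> //; lra.
subst sg'.
move=> e e0; pose r := Num.min r0 (e / 6).
have rr0 : r <= r0 by rewrite ge_min lexx.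
have re : r <= e / 6 by rewrite ge_min lexx orbT.
have r1 : 0 < r by rewrite lt_min r00 /=; lra.
exists r => // h hr.
set v := g (a + h) - g a.
have vh : enorm v <= `|h| by have := arclength_dist a (a + h) hc; rewrite addrAC subrr add0r.
have r3 : r <= 1 / 3 by lra.
have ga : enorm (g a - g a) <= r by rewrite subrr enorm0 ltW.
have gh : enorm (g (a + h) - g a) <= r by apply: le_trans vh _; exact: ltW.
have [hA _] := front_graph hS (Sg a) (Sg (a + h)) (Sg a) (ltW r1) r3 gh ga.
rewrite -/v in hA.
have {}hA : `|dot v (nu (g a))| <= 3 * r * `|h|.
  by apply: le_trans hA _; rewrite ler_wpM2l //; lra.
set tau := cross u (nu (g a)).
have hB : `|dot v tau - h * sg| <= 3 * r * `|h|.
  have Bub := dot_le v tau; have /enorm1 t1 := tu a; rewrite -/tau in t1.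
  rewrite t1 mulr1 in Bub; have {}Bub := le_trans Bub vh.
  have [h0|h0|h0] := ltgtP h 0; last first.
  - by rewrite h0 normr0 in Bub *; rewrite mul0r subr0 mulr0.
  - have rh : 0 <= r * h by rewrite pmulr_rge0 // ltW.
    rewrite (gtr0_norm h0) in Bub hr *.
    have hh : (1 - 3 * r) * h <= sg * dot v tau.
      rewrite (_ : (1 - 3 * r) * h = (1 - 3 * r) * (a + h - a)); last by ring.
      by apply: (hsign' r a (a + h) rr0); lra.
    move: Bub; rewrite !ler_norml => /andP[b1 b2].
    by case: hsg hh => -> hh; apply/andP; split; lra.
  - have rh : r * h <= 0 by rewrite pmulr_rle0 // ltW.
    rewrite (ltr0_norm h0) in Bub hr *.
    have hh : (1 - 3 * r) * - h <= sg * - dot v tau.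
      rewrite (_ : (1 - 3 * r) * - h = (1 - 3 * r) * (a - (a + h))); last by ring.
      by rewrite -dotNl opprB; apply: (hsign' r (a + h) a rr0); lra.
    move: Bub; rewrite !ler_norml => /andP[b1 b2].
    by case: hsg hh => -> hh; apply/andP; split; lra.
have vE := plane_decomp (cf_u hS) (cf_unit hS (Sg a)) (cf_nu hS (Sg a)) (cf_plane hS (Sg (a + h)) (Sg a)).
rewrite -/v -/tau in vE.
have -> : v - h *: (sg *: tau) = dot v (nu (g a)) *: nu (g a) + (dot v tau - h * sg) *: tau.
  by rewrite {1}vE scalerBl scalerA addrA.
apply: le_trans (enormD _ _) _; rewrite !enormZ.
have /enorm1 -> := cf_unit hS (Sg a); have /enorm1 -> := tu a; rewrite !mulr1.
have : r * `|h| <= e / 6 * `|h| by rewrite ler_wpM2r.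
lra.
Qed.

Lemma cross_le (R : realType) (u x : 'rV[R]_3) : dot u u = 1 -> enorm (cross u x) <= enorm x.
Proof.
move=> hu; rewrite enorm_le ?enorm_ge0 // enorm2 dot_cross2 hu mul1r.
by rewrite lerBlDr lerDl -expr2 sqr_ge0.
Qed.

(** Continuous induction, for a function that need not be differentiable. The supremum c of the
    points reached by the bound satisfies it by the left estimate at c, and the right estimate goes
    past c unless c = b. *)
Lemma local_le (R : realType) (F : R -> R) (a b e : R) : a <= b ->
  (forall s : R, a <= s <= b -> exists2 d : R, 0 < d & forall s' : R, `|s' - s| < d ->
     (s <= s' -> F s - F s' <= e * (s' - s)) /\ (s' <= s -> F s' - F s <= e * (s - s'))) ->
  F a - F b <= e * (b - a).
Proof.
move=> ab hF.
pose A := [set x | a <= x <= b /\ F a - F x <= e * (x - a)].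
have Aa : A a by split; rewrite ?lexx ?ab // !subrr mulr0.
have hsup : has_sup A by split; [exists a|exists b => x [/andP[]]].
pose c := sup A.
have ac : a <= c by apply: ub_le_sup => //; case: hsup.
have cb : c <= b by apply: ge_sup; [exists a|move=> x [/andP[]]].
have hacb : a <= c <= b by rewrite ac cb.
have [d d0 hd] := hF c hacb.
have Ac : A c.
  have [x Ax hx] := sup_adherent d0 hsup; rewrite -/c in hx.
  have xc : x <= c by apply: ub_le_sup => //; case: hsup.
  have xd : `|x - c| < d by rewrite ler0_norm; lra.
  have [_ /(_ xc) h2] := hd x xd.
  have [_ h3] := Ax; split; first by rewrite ac cb.
  lra.
have [cltb|] := ltP c b; last first.
  move=> bc; have e1 : c = b by apply: le_anti; rewrite cb bc.
  by have [_] := Ac; rewrite e1.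
exfalso; pose y := Num.min b (c + d / 2).
have cy : c < y by rewrite lt_min cltb /=; lra.
have yb : y <= b by rewrite ge_min lexx.
have yd : y <= c + d / 2 by rewrite ge_min lexx orbT.
have yd' : `|y - c| < d by rewrite ger0_norm; lra.
have [/(_ (ltW cy)) h1 _] := hd y yd'.
have : A y.
  by split; [apply/andP; split; lra|have [_] := Ac; lra].
move=> Ay; have : y <= c by apply: ub_le_sup => //; case: hsup.
lra.
Qed.

Lemma derivable_cvg (R : realType) (V : normedModType R) (f : R -> V) a :
  derivable f a 1 -> h^-1 *: (f (h + a) - f a) @[h --> 0^'] --> derive1 f a.
Proof.
have e : (fun h : R => h^-1 *: ((f \o shift a) (h *: 1) - f a)) =
    (fun h => h^-1 *: (f (h + a) - f a)).
  by apply/funext => h /=; rewrite /shift /= scaler1.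
by rewrite /derivable e /derive1.
Qed.

Lemma derive_cd (R : realType) (f : R -> 'rV[R]_3) a :
  derivable f a 1 -> curve_derivative f a (derive1 f a).
Proof.
move=> /derivable_cvg /cvgrPdist_lt hf e e0.
have /hf : 0 < e / 2 by lra.
move=> /nbhs_normP /= [d /= d0 hd]; exists d => // h hh.
have [->|h0] := eqVneq h 0.
  by rewrite addr0 subrr scale0r subr0 enorm0 normr0 mulr0.
have := hd h; rewrite /ball_ /= sub0r normrN => /(_ hh h0) hlt.
have -> : f (a + h) - f a - h *: derive1 f a =
    - (h *: (derive1 f a - h^-1 *: (f (h + a) - f a))).
  by rewrite scalerBr scalerA divff // scale1r opprB (addrC h).
rewrite enormN enormZ mulrC ler_wpM2r //.
by apply: le_trans (enorm_le_norm _) _; lra.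
Qed.

Lemma cd_derive (R : realType) (f : R -> 'rV[R]_3) a T :
  curve_derivative f a T -> derive1 f a = T.
Proof.
move=> hf; rewrite /derive1; apply: cvg_lim => //.
apply/cvgrPdist_lt => e e0; have e20 : 0 < e / 2 by lra.
have [d d0 hd] := hf _ e20.
near=> h.
have h0 : h != 0 by near: h; exact: nbhs_dnbhs_neq.
have hh : `|h| < d.
  by near: h; apply: dnbhs0_lt.
apply: le_lt_trans (norm_le_enorm _) _.
have -> : T - h^-1 *: (f (h + a) - f a) = - (h^-1 *: (f (a + h) - f a - h *: T)).
  by rewrite [in RHS]scalerBr scalerA mulVf // scale1r opprB (addrC h).
rewrite enormN enormZ normfV mulrC ltr_pdivrMr ?normr_gt0 //.
apply: le_lt_trans (hd _ hh) _; rewrite ltr_pM2r ?normr_gt0 //; lra.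
Unshelve. all: by end_near. Qed.

Lemma antiderivative (R : realType) (f : R -> R) l : continuous f -> 0 < l ->
  exists W : R -> R, \int[@lebesgue_measure R]_(s in `[0, l]) f s = W l - W 0 /\
    forall x : R, 0 <= x <= l -> forall e : R, 0 < e -> exists2 d : R, 0 < d &
      forall h : R, `|h| < d -> `|W (x + h) - W x - h * f x| <= e * `|h|.
Proof.
move=> cf l0.
(* Integration starts at -1, and integrability is taken up to l + 1, so that 0 and l are interior
   points with two-sided derivatives. *)
pose W x := \int[@lebesgue_measure R]_(s in `[(-1 : R), x]) f s.
have hi : (@lebesgue_measure R).-integrable `[(-1 : R), l + 1] (EFin \o f).
  apply: continuous_compact_integrable; first exact: segment_compact.
  exact: continuous_subspaceT.
have hW x : 0 <= x <= l -> derivable W x 1 /\ derive1 W x = f x.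
  move=> /andP[x0 xl].
  apply: (continuous_FTC1_closed (u := l + 1) _ hi) => //; try lra.
  exact: cf.
exists W; split.
  rewrite /Rintegral (continuous_FTC2 (F := W)) //.
  - exact: continuous_subspaceT.
  - split.
    + by move=> x /[!in_itv] /= /andP[x1 x2]; apply: (hW x _).1; rewrite !ltW.
    + apply: cvg_at_right_filter; apply: differentiable_continuous.
      by apply/derivable1_diffP; apply: (hW 0 _).1; rewrite lexx ltW.
    + apply: cvg_at_left_filter; apply: differentiable_continuous.
      by apply/derivable1_diffP; apply: (hW l _).1; rewrite lexx ltW.
  - by move=> x /[!in_itv] /= /andP[x1 x2]; apply: (hW x _).2; rewrite !ltW.
move=> x hx e e0; have [/(@derivable_cvg R R^o) hd dE] := hW x hx.
move: hd; rewrite dE => /cvgrPdist_lt /(_ e e0) /nbhs_normP /= [d /= d0 hd].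
exists d => // h hh.
have [->|h0] := eqVneq h 0.
  by rewrite addr0 subrr mul0r subr0 normr0 mulr0.
have := hd h; rewrite /ball_ /= sub0r normrN => /(_ hh h0) hlt.
have -> : W (x + h) - W x - h * f x =
    - (h * (f x - h^-1 * (W (h + x) - W x))).
  by rewrite [in RHS]mulrBr mulrA divff // mul1r opprB (addrC h).
rewrite normrN normrM mulrC ler_wpM2r //; exact: ltW.
Qed.

(** When the foot is fixed the normal moves with the curve, so the tangent turns by - h nu up to a
    small error. This contributes - h <nu, c>, the only place where the sign of <nu, c> matters; the
    other terms are the derivative of xi or of order e |h|. The extra factor h covers both signs of
    h. *)
Lemma arc_step (R : realType) (u T nu c xd dx rho : 'rV[R]_3) (h e K sg : R) :
  dot u u = 1 -> dot nu nu = 1 -> dot u nu = 0 -> sg * sg = 1 ->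
  T = sg *: cross u nu -> enorm rho <= e * `|h| ->
  enorm (dx - h *: xd) <= e * `|h| -> enorm dx <= K * `|h| -> enorm (c + dx) <= K ->
  `|h| <= e -> 0 <= dot nu c -> 0 <= e -> 0 <= K ->
  h * (dot (T + sg *: cross u (h *: T + rho)) (c + dx) - dot T c - h * dot T xd) <=
  e * (2 * K + 1) * h ^+ 2.
Proof.
move=> hu hn un sg1 TE hr hdx hdK hcK he hnc e0 K0.
have TT : dot T T = 1.
  by rewrite TE dotZl dotZr mulrA sg1 dot_cross2 hu hn un; ring.
have uT : sg *: cross u T = - nu.
  rewrite TE crossZr scalerA sg1 scale1r cross_cross hu un; apply: rV3P; rewrite !mxE; ring.
have -> : T + sg *: cross u (h *: T + rho) = T - h *: nu + sg *: cross u rho.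
  rewrite crossDr crossZr scalerDr scalerA mulrC -scalerA uT; apply: rV3P; rewrite !mxE; ring.
set E1 := dot T (dx - h *: xd); set E2 := dot nu dx; set E3 := dot (sg *: cross u rho) (c + dx).
have -> : dot (T - h *: nu + sg *: cross u rho) (c + dx) - dot T c - h * dot T xd =
    E1 - h * dot nu c - h * E2 + E3.
  by rewrite /E1 /E2 /E3 !dotE !mxE /=; ring.
have /enorm1 T1 := TT; have /enorm1 n1 := hn.
have b1 : `|E1| <= e * `|h| by apply: le_trans (dot_le _ _) _; rewrite T1 mul1r.
have b2 : `|E2| <= K * `|h| by apply: le_trans (dot_le _ _) _; rewrite n1 mul1r.
have b3 : `|E3| <= e * `|h| * K.
  apply: le_trans (dot_le _ _) _; apply: ler_pM; rewrite ?enorm_ge0 //.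
  rewrite enormZ; have -> : `|sg| = 1.
    have : (`|sg| - 1) * (`|sg| + 1) = 0.
      have : `|sg| ^+ 2 = 1 by rewrite real_normK ?num_real // expr2.
      by move=> h1; rewrite -subr_sqr h1 expr1n subrr.
    by have := normr_ge0 sg; move=> h1 /eqP; rewrite mulf_eq0 => /orP[]/eqP; lra.
  by rewrite mul1r; apply: le_trans (cross_le _ hu) hr.
have a1 : h * E1 <= `|h| * (e * `|h|).
  by apply: le_trans (ler_norm _) _; rewrite normrM ler_wpM2l.
have a3 : h * E3 <= `|h| * (e * `|h| * K).
  by apply: le_trans (ler_norm _) _; rewrite normrM ler_wpM2l.
have a2 : - (h * h * E2) <= `|h| * `|h| * (K * e).
  apply: le_trans (ler_norm _) _; rewrite normrN !normrM ler_wpM2l ?mulr_ge0 //.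
  by apply: le_trans b2 _; rewrite ler_wpM2l.
have a4 : 0 <= h * h * dot nu c by rewrite mulr_ge0 // -expr2 sqr_ge0.
have hh : `|h| * `|h| = h ^+ 2 by rewrite -expr2 real_normK ?num_real.
have -> : e * (2 * K + 1) * h ^+ 2 = `|h| * (e * `|h|) + `|h| * (e * `|h| * K) + `|h| * `|h| * (K * e).
  by rewrite -hh; ring.
lra.
Qed.

Lemma derive1_periodic (R : realType) (V : normedModType R) (g : R -> V) l :
  periodic g l -> periodic (derive1 g) l.
Proof.
move=> hp x; rewrite /derive1.
rewrite (_ : (fun h => h^-1 *: (g (h + (x + l)) - g (x + l))) =
  (fun h => h^-1 *: (g (h + x) - g x))) //.
by apply/funext => h; rewrite addrA !hp.
Qed.

Lemma smooth_cont (R : realType) (xi : R -> 'rV[R]_3) :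
  smooth xi -> continuous (derive1 xi).
Proof.
move=> hx s; apply: differentiable_continuous; apply/derivable1_diffP.
exact: (hx 1%N s).
Qed.

(** The displacement [z] is parallel to [T] and within |h| / 2 of h T, hence points the same way as
    h T; so <z, dB> >= 0 becomes h <T, dB> >= 0. *)
Lemma seg_step (R : realType) (u T nu z c dx dB xd : 'rV[R]_3) (h e : R) :
  0 <= dot z dB -> z = dot z T *: T -> enorm (z - h *: T) <= `|h| / 2 -> dot T T = 1 ->
  enorm (dx - h *: xd) <= e * `|h| ->
  h * (dot T (c + (dx - dB)) - dot T c - h * dot T xd) <= e * h ^+ 2.
Proof.
move=> hz zE hzh TT hdx; have /enorm1 T1 := TT.
have hdot : `|dot z T - h| <= `|h| / 2.
  have -> : dot z T - h = dot (z - h *: T) T by rewrite dotDl dotNl dotZl TT mulr1.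
  by apply: le_trans (dot_le _ _) _; rewrite T1 mulr1.
have hB : 0 <= h * dot T dB.
  have [h0|h0|->] := ltgtP h 0; last by rewrite mul0r.
  - rewrite nmulr_rge0 //; rewrite (ltr0_norm h0) ler_norml in hdot.
    have zT : dot z T < 0 by case/andP: hdot => _; lra.
    by move: hz; rewrite {1}zE dotZl nmulr_rge0.
  - rewrite pmulr_rge0 //; rewrite (gtr0_norm h0) ler_norml in hdot.
    have zT : 0 < dot z T by case/andP: hdot; lra.
    by move: hz; rewrite {1}zE dotZl pmulr_rge0.
have -> : dot T (c + (dx - dB)) - dot T c - h * dot T xd = dot T (dx - h *: xd) - dot T dB.
  by rewrite !dotE !mxE; ring.
have : h * dot T (dx - h *: xd) <= `|h| * (e * `|h|).
  apply: le_trans (ler_norm _) _; rewrite normrM ler_wpM2l //.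
  by apply: le_trans (dot_le _ _) _; rewrite T1 mul1r.
have hh : `|h| * `|h| = h ^+ 2 by rewrite -expr2 real_normK ?num_real.
have -> : e * h ^+ 2 = `|h| * (e * `|h|) by rewrite -hh; ring.
lra.
Qed.

(* G = <gamma', xi - B> is periodic and grows at most as fast as the integral of
   <gamma', xi'>: on arcs the normal part of xi - B only decreases G, and on
   straight parts the strut field B is stretched along gamma'. *)
Lemma first_variation (R : realType) (u : 'rV[R]_3) (S : set 'rV[R]_3) nu l
    (g xi B : R -> 'rV[R]_3) :
  convex_front u S nu -> simple_arclength_param S l g ->
  smooth xi -> periodic xi l -> periodic B l ->
  (forall s, exists2 d : R, 0 < d & forall s' : R, `|s' - s| < d ->
     [/\ g s' - nu (g s') = g s - nu (g s), B s' = B s & 0 <= dot (nu (g s)) (xi s - B s)] \/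
     (nu (g s') = nu (g s) /\ 0 <= dot (g s' - g s) (B s' - B s))) ->
  0 <= \int[@lebesgue_measure R]_(s in `[0, l]) dot (derive1 g s) (derive1 xi s).
Proof.
move=> hS hg hxi xil Bl hB; have [hc hinj hrange] := hg; have [l0 gl _] := hc.
have Sg x : S (g x) by rewrite -hrange; exists x.
clear hrange.
set T := derive1 g.
have hT s0 : exists2 sg : R, sg * sg = 1 & exists2 d : R, 0 < d & forall a, `|a - s0| < d ->
    curve_derivative g a (T a) /\ T a = sg *: cross u (nu (g a)).
  have [sg hsg [d d0 hd]] := curve_tangent s0 hS hg.
  exists sg; first by case: hsg => ->; rewrite ?mulrNN mulr1.
  exists d => // a ha; have cd := hd a ha.
  by have TE : T a = _ := cd_derive cd; rewrite TE.
have nrm1 (sg : R) : sg * sg = 1 -> `|sg| = 1.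
  move=> h; have : `|sg| ^+ 2 = 1 by rewrite real_normK ?num_real // expr2.
  by move=> /eqP; rewrite sqrp_eq1 // => /eqP.
have hcf : continuous (fun s => dot (T s) (derive1 xi s)).
  move=> s; apply: (@dot_cont _ _ T (derive1 xi)); last exact: smooth_cont.
  apply: econt_near => e e0; have [sg sg1 [d d0 hd]] := hT s.
  near=> y.
  have yd : `|y - s| < d by rewrite distrC; near: y; exact: (@near_dist _ R^o).
  have ye : `|s - y| < e by near: y; exact: (@near_dist _ R^o).
  have [|_ ->] := hd s; first by rewrite subrr normr0.
  have [//|_ ->] := hd y.
  rewrite -scalerBr -crossNr -crossDr enormZ nrm1 // mul1r.
  apply: le_lt_trans (cross_le _ (cf_u hS)) _.
  apply: le_lt_trans (cf_lip hS (Sg _) (Sg _)) _.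
  exact: le_lt_trans (arclength_dist _ _ hc) ye.
have [W [-> hW]] := antiderivative hcf l0.
pose G s := dot (T s) (xi s - B s).
have Gl : G l = G 0.
  have per (V : Type) (f : R -> V) : (forall x, f (x + l) = f x) -> f l = f 0.
    by move=> /(_ 0); rewrite add0r.
  by rewrite /G (per _ T (derive1_periodic gl)) (per _ xi xil) (per _ B Bl).
have hxi' s : curve_derivative xi s (derive1 xi s) by apply: derive_cd; exact: (hxi 0%N s).
suff loc (e : R) : 0 < e -> forall s : R, 0 <= s <= l -> exists2 d : R, 0 < d & forall s' : R, `|s' - s| < d ->
     (s <= s' -> (W s - G s) - (W s' - G s') <= e * (s' - s)) /\
     (s' <= s -> (W s' - G s') - (W s - G s) <= e * (s - s')).
  apply/ler_addgt0Pl => e e0.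
  have e' : 0 < e / l by rewrite divr_gt0.
  have := local_le (ltW l0) (loc _ e'); rewrite Gl subr0 divfK ?gt_eqF //; lra.
move=> e0 s hs; have [sg sg1 [d1 d10 hd1]] := hT s.
have [cdT TE] : curve_derivative g s (T s) /\ T s = sg *: cross u (nu (g s)).
  by apply: hd1; rewrite subrr normr0.
have [d2 d20 hd2] := hB s.
set c := xi s - B s in hd2; set xd := derive1 xi s.
pose K := enorm c + enorm xd + 1.
have K1 : 1 <= K by rewrite /K; have := enorm_ge0 c; have := enorm_ge0 xd; lra.
pose e1 := Num.min (1 / 2) (e / 2 / (2 * K + 1)).
have K21 : 0 < 2 * K + 1 by lra.
have e10 : 0 < e1 by rewrite lt_min; apply/andP; split; [lra|rewrite divr_gt0 //; lra].
have e1h : e1 <= 1 / 2 by rewrite ge_min lexx.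
have e1K : e1 * (2 * K + 1) <= e / 2.
  by rewrite -ler_pdivlMr // ge_min lexx orbT.
clearbody e1.
have [d3 d30 hd3] := cdT _ e10; have [d4 d40 hd4] := hxi' s _ e10; rewrite -/xd in hd4.
have e2 : 0 < e / 2 by lra.
have [d5 d50 hd5] := hW s hs _ e2.
pose d := Num.min e1 (Num.min (Num.min d1 d2) (Num.min d3 (Num.min d4 d5))).
have d0 : 0 < d by rewrite /d !lt_min e10 d10 d20 d30 d40 d50.
exists d => // s' hs'; pose h := s' - s.
have : `|h| < d by [].
rewrite /d !lt_min => /and3P[he /andP[h1 h2] /and3P[h3 h4 h5]].
have s'E : s' = s + h by rewrite /h subrKC.
(* Multiplication by h puts the forward and the backward estimate into one inequality. *)
suff key : h * (G s' - G s - h * dot (T s) xd) <= e / 2 * h ^+ 2.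
  have := hd5 h h5; rewrite -s'E ler_norml => /andP[w1 w2].
  have [hn|hp|h0] := ltgtP h 0; last first.
  - have e3 : s' = s by rewrite s'E h0 addr0.
    by rewrite e3 !subrr mulr0.
  - have hss : s < s' by rewrite -subr_gt0.
    split; last by move=> hss'; move: hss; rewrite ltNge hss'.
    move=> _; rewrite (gtr0_norm hp) in w1 w2.
    have : G s' - G s - h * dot (T s) xd <= e / 2 * h.
      by rewrite -(ler_pM2l hp); apply: le_trans key _; rewrite expr2 mulrCA.
    by rewrite -/h; rewrite -/T -/xd in w1 w2; move: w1 w2; clear; lra.
  - have hss : s' < s by rewrite -subr_lt0.
    split; first by move=> hss'; move: hss; rewrite ltNge hss'.
    move=> _; rewrite (ltr0_norm hn) in w1 w2.
    have : e / 2 * h <= G s' - G s - h * dot (T s) xd.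
      by rewrite -(ler_nM2l hn); apply: le_trans key _; rewrite expr2 mulrCA.
    have -> : s - s' = - h by rewrite /h opprB.
    by rewrite -/T -/xd in w1 w2; move: w1 w2; clear; lra.
have hh2 : 0 <= h ^+ 2 by exact: sqr_ge0.
have hxd := hd4 h h4; rewrite -s'E in hxd.
have hgd := hd3 h h3; rewrite -s'E in hgd.
set dx := xi s' - xi s in hxd; set z := g s' - g s in hgd.
have [_ TE'] := hd1 s' h1.
have nn := cf_unit hS (Sg s); have un := cf_nu hS (Sg s).
have TT : dot (T s) (T s) = 1.
  by rewrite TE dotZl dotZr mulrA sg1 dot_cross2 (cf_u hS) nn un; ring.
have dxe : enorm dx <= `|h| * (enorm xd + e1).
  have -> : dx = (dx - h *: xd) + h *: xd by rewrite subrK.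
  have := enormD (dx - h *: xd) (h *: xd); rewrite (enormZ h xd) => hle; apply: le_trans hle _.
  rewrite mulrDr [leLHS]addrC lerD2l [leRHS]mulrC; exact: hxd.
case: (hd2 s' h2) => [[eP eB hnc]|[en hz]].
- apply: (@le_trans _ _ (e1 * (2 * K + 1) * h ^+ 2)); last by rewrite ler_wpM2r.
  have := @arc_step _ u (T s) (nu (g s)) c xd dx (z - h *: T s) h e1 K sg
    (cf_u hS) nn un sg1 TE hgd hxd _ _ (ltW he) hnc (ltW e10) _.
  have -> : T s + sg *: cross u (h *: T s + (z - h *: T s)) = T s'.
    have zE : z = nu (g s') - nu (g s).
      have gE : g s' = g s - nu (g s) + nu (g s') by rewrite -eP subrK.
      by rewrite /z {1}gE addrAC [X in X + _]addrAC subrr add0r addrC.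
    by rewrite subrKC TE' TE -scalerDr -crossDr zE subrKC.
  have -> : c + dx = xi s' - B s' by rewrite eB /c /dx; apply: rV3P; rewrite !mxE; ring.
  apply.
  + apply: le_trans dxe _; rewrite [leLHS]mulrC ler_wpM2r // /K; move: (enorm_ge0 c) e1h; clear; lra.
  + have -> : xi s' - B s' = c + dx by rewrite eB /c /dx; apply: rV3P; rewrite !mxE; ring.
    apply: le_trans (enormD _ _) _; rewrite /K -addrA lerD2l.
    apply: le_trans dxe _.
    have : `|h| * (enorm xd + e1) <= 1 / 2 * (enorm xd + e1).
      rewrite ler_wpM2r ?addr_ge0 ?enorm_ge0 ?(ltW e10) //.
      exact: le_trans (ltW he) e1h.
    by move: (enorm_ge0 xd) e1h; clear; lra.
  + by move: K1; clear; lra.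
- have TsE : T s' = T s by rewrite TE' TE en.
  have zT : z = dot z (T s) *: T s.
    have zn : dot z (nu (g s)) = 0.
      have a1 := cf_side hS (Sg s') (Sg s); have a2 := cf_side hS (Sg s) (Sg s').
      rewrite en -opprB dotNl in a2; rewrite /z; move: a1 a2; clear; lra.
    have zE : z = dot z (nu (g s)) *: nu (g s) + dot z (cross u (nu (g s))) *: cross u (nu (g s)).
      exact: (plane_decomp (cf_u hS) nn un (cf_plane hS (Sg s') (Sg s))).
    rewrite {1}zE zn scale0r add0r.
    by rewrite TE dotZr scalerA mulrAC sg1 mul1r.
  have zh : enorm (z - h *: T s) <= `|h| / 2.
    apply: le_trans hgd _; rewrite [leLHS]mulrC ler_wpM2l //; move: e1h; clear; lra.
  have := @seg_step _ u (T s) (nu (g s)) z c dx (B s' - B s) xd h e1 hz zT zh TT hxd.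
  have -> : c + (dx - (B s' - B s)) = xi s' - B s'.
    by rewrite /c /dx; apply: rV3P; rewrite !mxE; ring.
  rewrite -/(G s) -{1}TsE -/(G s') => hk; apply: le_trans hk _.
  rewrite ler_wpM2r //; apply: le_trans e1K; rewrite ler_peMr ?(ltW e10) //.
  by move: K1; clear; lra.
Unshelve. all: by end_near. Qed.

Lemma perp_line (R : realType) (u s nu z : 'rV[R]_3) : dot u u = 1 -> dot s s = 1 ->
  dot u s = 0 -> dot nu nu = 1 -> dot u nu = 0 -> dot nu s = 0 -> dot u z = 0 ->
  dot nu z = 0 -> z = dot z s *: s.
Proof.
move=> hu hs us hn un ns uz nz.
have nE := plane_decomp hu hs us un; rewrite ns scale0r add0r in nE.
have k0 : dot nu (cross u s) != 0.
  by apply/eqP => k0; move: hn; rewrite nE k0 scale0r dot0l => /esym /eqP; rewrite oner_eq0.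
have : dot z (cross u s) = 0.
  move: nz; rewrite nE dotZl => /eqP; rewrite mulf_eq0 (negbTE k0) /= => /eqP h.
  by rewrite dotC.
by move=> h; rewrite {1}(plane_decomp hu hs us uz) h scale0r addr0.
Qed.

Lemma meridian_front (R : realType) (u p k : 'rV[R]_3) : dot u u = 1 -> dot k k = 1 ->
  dot u k = 0 -> convex_front (cross u k) (meridian u p k) (fun x => x - (p + k)).
Proof.
move=> hu hk uk.
have hc x : meridian u p k x -> exists r s : R, (r - 1) ^+ 2 + s ^+ 2 = 1 /\
    x - (p + k) = (r - 1) *: k + s *: u.
  move=> [r [s [h ->]]]; exists r, s; split=> //.
  by apply: rV3P; rewrite !mxE; ring.
have h1 x : meridian u p k x -> dot (x - (p + k)) (x - (p + k)) = 1.
  move=> /hc [r [s [h ->]]].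
  by rewrite dotDD !dotZl !dotZr hk hu (dotC k u) uk; lra.
have h2 x : meridian u p k x -> dot (cross u k) (x - (p + k)) = 0.
  move=> /hc [r [s [h ->]]].
  by rewrite dotDr !dotZr ![dot (cross u k) _]dotC dot_crossr dot_crossl; ring.
split=> //.
- by rewrite dot_cross2 hu hk uk; ring.
- move=> x y hx hy; have -> : x - y = (x - (p + k)) - (y - (p + k)).
    by rewrite opprB addrA subrK.
  by rewrite [LHS]dotDr dotNr !h2 // subrr.
- move=> x y hx hy; set a := y - (p + k).
  have -> : x - y = (x - (p + k)) - a by rewrite opprB addrA subrK.
  rewrite dotDl dotNl h1 //.
  have := dot_ub (x - (p + k)) a; have /enorm1 -> := h1 x hx.
  by have /enorm1 -> := h1 y hy; lra.
- by move=> x y _ _; rewrite opprB addrA subrK.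
Qed.

Lemma region_plane (R : realType) (n : nat) (u : 'rV[R]_3) (v : 'I_n -> 'rV[R]_3) i q :
  (forall i j, dot u (v j - v i) = 0) -> polygon_region v q -> dot u (q - v i) = 0.
Proof.
move=> h hq; rewrite dotDr dotNr (region_eq (m := dot u (v i)) _ hq) ?subrr //.
by move=> j; have := h i j; rewrite dotDr dotNr => /eqP; rewrite subr_eq0 => /eqP.
Qed.

Lemma parallel_front (R : realType) (n : nat) (u : 'rV[R]_3) (v k : 'I_n -> 'rV[R]_3)
    pr : (0 < n)%N -> star_config u v k pr ->
  convex_front u (parallel_set u v pr) (fun x => x - pr x).
Proof.
move=> n0 hc; have [hu hpl _ _ _] := sc_orient hc; have hp := sc_proj hc.
pose i0 := Ordinal n0.
have hpr x : dot u (pr x - v i0) = 0 by apply: region_plane => //; have [] := hp x.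
split=> //.
- by move=> x [].
- move=> x [h _]; have -> : x - pr x = (x - v i0) - (pr x - v i0) by rewrite opprB addrA subrK.
  by rewrite [LHS]dotDr dotNr hpr h subrr.
- move=> x y [hx _] [hy _]; have -> : x - y = (x - v i0) - (y - v i0) by rewrite opprB addrA subrK.
  by rewrite [LHS]dotDr dotNr hx hy subrr.
- move=> x y [_ hx] [_ hy].
  have -> : x - y = (pr x - pr y) + ((x - pr x) - (y - pr y)).
    by apply: rV3P; rewrite !mxE; ring.
  rewrite dotDl; set a := x - pr x; set b := y - pr y.
  have h1 : dot (pr x - pr y) b <= 0.
    by rewrite dotC; have [_] := hp y; apply; have [] := hp x.
  have h2 : dot (a - b) b = dot a b - dot b b by rewrite dotDl dotNl.
  have := dot_ub a b; have /enorm1 -> := hx; have /enorm1 -> := hy; rewrite h2 hy; lra.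
- by move=> x y _ _; exact: proj_nu_lip hp.
Qed.

(** Simplicity makes the side and the parameter functions of the point, so the interpolation
    descends to points; the end t = 1 of a side is read as the start of the next one. *)
Lemma side_interpolation (R : realType) (n : nat) (v X : 'I_n -> 'rV[R]_3) :
  simple_polygon v -> exists f : 'rV[R]_3 -> 'rV[R]_3, forall i (t : R), 0 <= t <= 1 ->
    f (v i + t *: side v i) = X i + t *: (X (ordS i) - X i).
Proof.
move=> hs.
pose Q p b := exists i (t : R), [/\ 0 <= t < 1, p = v i + t *: side v i &
   b = X i + t *: (X (ordS i) - X i)].
exists (fun p => xget 0 [set b | Q p b]).
have main i (t : R) : 0 <= t < 1 ->
    xget 0 [set b | Q (v i + t *: side v i) b] = X i + t *: (X (ordS i) - X i).
  move=> ht; have : Q (v i + t *: side v i) (xget 0 [set b | Q (v i + t *: side v i) b]).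
    by apply: (@xgetPex _ 0 [set b | Q (v i + t *: side v i) b]); exists (X i + t *: (X (ordS i) - X i)), i, t.
  by move=> [j [t' [ht' e ->]]]; have [-> ->] := hs _ _ _ _ ht ht' e.
move=> i t /andP[t0]; rewrite le_eqVlt => /orP[/eqP ->|t1]; last by apply: main; rewrite t0.
rewrite !scale1r -sideE addrC subrK.
have := main (ordS i) 0; rewrite lexx ltr01 !scale0r !addr0; exact.
Qed.

Lemma enorm_near (R : realType) (T : topologicalType) (f : T -> 'rV[R]_3) (x : T) :
  {for x, continuous f} -> f x != 0 -> \forall y \near x, f y != 0.
Proof.
move=> hf /enorm_gt0 h0; near=> y; apply/eqP => e.
have : enorm (f x - f y) < enorm (f x) by near: y; exact: econt_at.
by rewrite e subr0 ltxx.
Unshelve. all: by end_near. Qed.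

Lemma ordS_neq n (i : 'I_n) : (1 < n)%N -> ordS i != i.
Proof.
move=> n1; rewrite -val_eqE /=; have := ltn_ord i; rewrite leq_eqVlt => /orP[/eqP e|h].
  by rewrite e modnn; apply/eqP => e'; move: n1; rewrite -e -e'.
by rewrite modn_small // gtn_eqF.
Qed.

(* The field X given at the vertices is interpolated affinely along the sides and
   pulled back by pr. *)
Lemma central_nonneg (R : realType) (n : nat) (u : 'rV[R]_3) (v k X : 'I_n -> 'rV[R]_3)
    pr l (g xi : R -> 'rV[R]_3) : (1 < n)%N -> star_config u v k pr ->
  simple_arclength_param (parallel_set u v pr) l g -> smooth xi -> periodic xi l ->
  (forall i s, enorm (g s - v i) = 1 -> 0 <= dot (g s - v i) (xi s - X i)) ->
  (forall i, 0 <= dot (side v i) (X (ordS i) - X i)) ->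
  0 <= \int[@lebesgue_measure R]_(s in `[0, l]) dot (derive1 g s) (derive1 xi s).
Proof.
move=> n1 hc hg hxi xil hX1 hX2.
have [hu hpl ss sd hor] := sc_orient hc; have hp := sc_proj hc.
have su i : dot u (side v i) = 0 by exact: hpl.
have hS := parallel_front (ltnW n1) hc.
have [f hf] := side_interpolation X (sc_simple hc).
have [hcl _ hrange] := hg; have [_ gl _] := hcl.
have Sg x : parallel_set u v pr (g x) by rewrite -hrange; exists x.
have gc := arclength_cont hcl.
apply: (@first_variation R u _ _ l g xi (fun s => f (pr (g s))) hS hg hxi xil).
  by move=> s; rewrite /= gl.
move=> s.
(* Both conditions are closed in y and there are finitely many of them, so a point near [g s] can
   only lie on arcs and straight parts that also contain [g s]. *)
pose arc i y := pr y = v i.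
pose seg i y := [/\ dot (y - pr y) (side v i) = 0, dot (y - pr y) (pr y - v i) = 0 &
  0 <= dot (pr y - v i) (side v i) <= 1].
have cover y : parallel_set u v pr y -> exists i, arc i y \/ seg i y.
  move=> Sy; have [Cy ny] := hp y.
  have [i [t [ht e hk]]] := face (ltnW n1) (sc_orient hc) (cf_unit hS Sy) (cf_nu hS Sy) Cy ny.
  exists i; have [t0|t0] := eqVneq t 0; first by left; rewrite /arc e t0 scale0r addr0.
  have tp : 0 < t by rewrite lt_neqAle eq_sym t0; case/andP: ht.
  right; split; first exact: hk.
    by rewrite {2}e addrAC subrr add0r dotZr hk // mulr0.
  rewrite e addrAC subrr add0r dotZl ss mulr1; case/andP: ht => a b; rewrite a; exact: ltW.
have cpr : {for s, continuous (fun x => pr (g x))}.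
  by apply: (@contcomp _ _ _ g pr); [exact: gc|exact: proj_cont hp (g s)].
have cnu : {for s, continuous (fun x => g x - pr (g x))}.
  exact: (contB (gc s) cpr).
have FF : Filter (nbhs s) by exact: nbhs_filter.
have nbA i : \forall x \near s, arc i (g x) -> arc i (g s).
  have [h|h] := pselect (arc i (g s)); first by near=> x.
  have h' : pr (g s) - v i != 0 by apply/eqP => /eqP; rewrite subr_eq0 => /eqP.
  have hn := enorm_near (f := fun x => pr (g x) - v i) (contB cpr (@contC _ _ (v i) s)) h'.
  near=> x; move=> hx; exfalso.
  have : pr (g x) - v i != 0 by near: x.
  by rewrite hx subrr eqxx.
have nbS i : \forall x \near s, seg i (g x) -> seg i (g s).
  have cb := contB cpr (@contC _ _ (v i) s).
  have c1 := dot_cont cnu (@contC _ _ (side v i) s).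
  have c2 := dot_cont cnu cb.
  have c3 := dot_cont cb (@contC _ _ (side v i) s).
  have [h1|h1] := eqVneq (dot (g s - pr (g s)) (side v i)) 0; last first.
    have H := @cvgr_neq0 R R^o _ _ _ _ _ c1 h1.
    near=> x; move=> [hh _ _]; exfalso.
    have : dot (g x - pr (g x)) (side v i) != 0 by near: x; exact: H.
    by rewrite hh eqxx.
  have [h2|h2] := eqVneq (dot (g s - pr (g s)) (pr (g s) - v i)) 0; last first.
    have H := @cvgr_neq0 R R^o _ _ _ _ _ c2 h2.
    near=> x; move=> [_ hh _]; exfalso.
    have : dot (g x - pr (g x)) (pr (g x) - v i) != 0 by near: x; exact: H.
    by rewrite hh eqxx.
  have [h3|h3] := leP 0 (dot (pr (g s) - v i) (side v i)); last first.
    have H := cvgr_lt _ c3 _ h3.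
    near=> x; move=> [_ _ /andP[hh _]]; exfalso.
    have : dot (pr (g x) - v i) (side v i) < 0 by near: x; exact: H.
    by rewrite ltNge hh.
  have [h4|h4] := leP (dot (pr (g s) - v i) (side v i)) 1; last first.
    have H := cvgr_gt _ c3 _ h4.
    near=> x; move=> [_ _ /andP[_ hh]]; exfalso.
    have : 1 < dot (pr (g x) - v i) (side v i) by near: x; exact: H.
    by rewrite ltNge hh.
  by near=> x => _; split=> //; rewrite h3 h4.
(* Two unit normals of one side are equal or opposite, and opposite ones are at distance 2. *)
have nb2 : \forall x \near s, enorm ((g s - pr (g s)) - (g x - pr (g x))) < 1.
  exact: (econt_at (f := fun x => g x - pr (g x))).
have [d d0 hd] := near_R (filterI (filterI (filter_forall FF nbA) (filter_forall FF nbS)) nb2).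
exists d => // s' /hd [[hbA hbS] hlt].
have [i [ha'|hs']] := cover _ (Sg s'); have h1 := hbA i; have h2 := hbS i.
  have ha := h1 ha'; left.
  have pE : pr (g s') = pr (g s) by rewrite ha ha'.
  have fE : f (v i) = X i.
    by have := hf i 0; rewrite lexx ler01 !scale0r !addr0; exact.
  have h0 := cf_unit hS (Sg s).
  split; [by rewrite !subKr| by rewrite pE|].
  by rewrite ha fE; apply: hX1; rewrite -ha; exact/enorm1.
have hs := h2 hs'; right.
have line y : parallel_set u v pr y -> seg i y ->
    pr y = v i + dot (pr y - v i) (side v i) *: side v i /\
    f (pr y) = X i + dot (pr y - v i) (side v i) *: (X (ordS i) - X i).
  move=> Sy [e1 e2 e3].
  have pE : pr y - v i = dot (pr y - v i) (side v i) *: side v i.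
    apply: (perp_line hu (ss i) (su i) (cf_unit hS Sy) (cf_nu hS Sy) e1 _ e2).
    by apply: region_plane => //; have [] := hp y.
  have pE' : pr y = v i + dot (pr y - v i) (side v i) *: side v i.
    by rewrite -pE addrC subrK.
  by split=> //; rewrite {1}pE'; apply: hf.
have nuE : g s' - pr (g s') = g s - pr (g s).
  have [e1 _ _] := hs; have [e1' _ _] := hs'.
  have a0 : area u (g s - pr (g s)) (g s' - pr (g s')) = 0.
    have := area_mul hu (su i) (cf_nu hS (Sg s)) (cf_nu hS (Sg s')).
    by rewrite ss mulr1 e1 e1' => ->; rewrite mul0r mulr0 subrr.
  have [//|e] := unit_area0 hu (cf_nu hS (Sg s)) (cf_nu hS (Sg s')) (cf_unit hS (Sg s)) (cf_unit hS (Sg s')) a0.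
  exfalso; move: hlt; rewrite e opprK enorm_lt // dotDD (cf_unit hS (Sg s)) expr1n.
  lra.
split=> //.
have [p1 f1] := line _ (Sg s) hs; have [p2 f2] := line _ (Sg s') hs'.
set t := dot (pr (g s) - v i) _ in p1 f1; set t' := dot (pr (g s') - v i) _ in p2 f2.
have -> : g s' - g s = (t' - t) *: side v i.
  have -> : g s' - g s = pr (g s') - pr (g s).
    have e2 : g s' = (g s - pr (g s)) + pr (g s') by rewrite -nuE subrK.
    by rewrite {1}e2; apply: rV3P; rewrite !mxE; ring.
  by rewrite p1 p2; apply: rV3P; rewrite !mxE; ring.
have -> : f (pr (g s')) - f (pr (g s)) = (t' - t) *: (X (ordS i) - X i).
  by rewrite f1 f2; apply: rV3P; rewrite !mxE; ring.
by rewrite dotZl dotZr mulrA mulr_ge0 // -expr2 sqr_ge0.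
Unshelve. all: by end_near. Qed.

Lemma circle_nonneg (R : realType) (u p k : 'rV[R]_3) l (g xi : R -> 'rV[R]_3) X :
  dot u u = 1 -> dot k k = 1 -> dot u k = 0 ->
  simple_arclength_param (meridian u p k) l g -> smooth xi -> periodic xi l ->
  (forall s, 0 <= dot (g s - (p + k)) (xi s - X)) ->
  0 <= \int[@lebesgue_measure R]_(s in `[0, l]) dot (derive1 g s) (derive1 xi s).
Proof.
move=> hu hk uk hg hxi xil hX.
apply: (@first_variation R _ _ _ l g xi (fun=> X) (meridian_front p hu hk uk) hg hxi xil) => //.
by move=> s; exists 1 => // s' _; left; split=> //; rewrite !subKr.
Qed.

Lemma periodic_bounded (R : realType) (f : R -> 'rV[R]_3) l : 0 < l -> periodic f l ->
  continuous f -> exists M : R, forall s, enorm (f s) <= M.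
Proof.
move=> l0 hp cf.
have [x _ hx] : exists2 c, c \in `[0, l]%R & forall t, t \in `[0, l]%R -> enorm (f t) <= enorm (f c).
  apply: (EVT_max (ltW l0)); apply: continuous_subspaceT => x.
  by apply: (@contcomp _ _ _ f (@enorm R)); [exact: cf|exact: enorm_cont].
exists (enorm (f x)) => s.
pose m := Num.floor (s / l).
have hm : m%:~R * l <= s < (m + 1)%:~R * l.
  rewrite -ler_pdivlMr // -ltr_pdivrMr //; exact: floor_itv.
rewrite intrD mulrDl mul1r in hm; case/andP: hm => hm1 hm2.
rewrite -(periodicz (- m) s hp); apply: hx.
by rewrite in_itv /= mulrNz mulNr; apply/andP; split; lra.
Qed.

Lemma star_critical (R : realType) (n : nat) (u : 'rV[R]_3) (v k : 'I_n -> 'rV[R]_3) pr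
    (l : 'I_n.+1 -> R) (gamma : 'I_n.+1 -> R -> 'rV[R]_3) : (1 < n)%N ->
  star_config u v k pr ->
  simple_arclength_param (parallel_set u v pr) (l ord0) (gamma ord0) ->
  (forall i, simple_arclength_param (meridian u (v i) (k i)) (l (lift ord0 i))
     (gamma (lift ord0 i))) ->
  link_critical l gamma.
Proof.
move=> n1 hc h0 hi xi hxi hneg.
have [hu hpl ss sd hor] := sc_orient hc.
have l0 i : 0 < l i.
  by case: (unliftP ord0 i) => [i' ->|->]; [have [[]] := hi i'|have [[]] := h0].
have r0 : range (gamma ord0) = parallel_set u v pr by case: h0.
have ri i : range (gamma (lift ord0 i)) = meridian u (v i) (k i) by case: (hi i).
have [hthi hdist] := @star_thickness R n u v k pr (fun i => range (gamma i)) n1 hc r0 ri.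
have [[i [j [s [t [ij d1 dneg]]]]]|hno] := pselect (exists i j s t,
    [/\ i != j, enorm (gamma i s - gamma j t) = 1 &
        dot (gamma i s - gamma j t) (xi i s - xi j t) < 0]); last first.
  have hcon i j s t : i != j -> enorm (gamma i s - gamma j t) = 1 ->
      0 <= dot (gamma i s - gamma j t) (xi i s - xi j t).
    by move=> ij d1; rewrite leNgt; apply/negP => hlt; apply: hno; exists i, j, s, t.
  exfalso; move: hneg; rewrite ltNge => /negP; apply.
  apply: sumr_ge0 => i _; have [hxs hxp] := hxi i.
  case: (unliftP ord0 i) hxs hxp => [i' ->|->] hxs hxp.
    (* The centre of a circle lies on the central curve at distance 1 from every point of the
       circle. The field to compare with is therefore constant, the value of xi at that centre. *)
    have [s0 _ hs0] : range (gamma ord0) (v i' + k i').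
      rewrite r0; split=> [j|].
        have -> : v i' + k i' - v j = (v i' - v j) + k i' by rewrite addrAC.
        by rewrite dotDr hpl (sc_plane hc) addr0.
      have -> : pr (v i' + k i') = v i'.
        apply: (proj_eq (sc_proj hc)); first exact: region_vertex.
        by rewrite addrAC subrr add0r; exact: (sc_normal hc).
      by rewrite addrAC subrr add0r (sc_unit hc).
    apply: (circle_nonneg hu (sc_unit hc i') (sc_plane hc i') (hi i') hxs hxp (X := xi ord0 s0)).
    move=> s; rewrite -hs0; apply: hcon; first by rewrite eq_sym neq_lift.
    have hS := meridian_front (v i') hu (sc_unit hc i') (sc_plane hc i').
    rewrite hs0; apply/enorm1; apply: (cf_unit hS).
    by rewrite -ri; exists s.
  (* The vertex is a point of its circle, and the motion there is the nodal value of the transported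
     field. Struts from the vertex to its arc give the normal condition, struts between consecutive
     circles the stretching along the sides. *)
  have hv i' : exists s, gamma (lift ord0 i') s = v i'.
    have [s _ hs] : range (gamma (lift ord0 i')) (v i').
      by rewrite ri; exists 0, 0; rewrite !scale0r !addr0; split=> //; ring.
    by exists s.
  pose sv i' := projT1 (cid (hv i')).
  have hsv i' : gamma (lift ord0 i') (sv i') = v i' by exact: (projT2 (cid (hv i'))).
  apply: (central_nonneg n1 hc h0 hxs hxp (X := fun i' => xi (lift ord0 i') (sv i'))).
    by move=> i' s; rewrite -hsv; apply: hcon; exact: neq_lift.
  move=> i'; rewrite /side -!hsv; apply: hcon.
    by rewrite (inj_eq lift_inj); exact: ordS_neq.
  by rewrite !hsv; apply/enorm1; exact: ss.
have hM i' : exists M : R, forall s, enorm (xi i' s) <= M.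
  have [hxs hxp] := hxi i'; apply: periodic_bounded (l0 i') hxp _ => x.
  by apply: differentiable_continuous; apply/derivable1_diffP; exact: (hxs 0%N x).
pose M i' := projT1 (cid (hM i')).
have hMi i' s' : enorm (xi i' s') <= M i' by exact: (projT2 (cid (hM i'))).
have M0 i' : 0 <= M i' by apply: le_trans (hMi i' 0); exact: enorm_ge0.
pose MM := \sum_i' M i'.
have hMM i' : M i' <= MM by rewrite /MM (bigD1 i') //= lerDl sumr_ge0.
pose Z := {z : ('I_n.+1 * 'I_n.+1) * (R * R) | z.1.1 != z.1.2}.
pose D (z : Z) := gamma (val z).1.1 (val z).2.1 - gamma (val z).1.2 (val z).2.2.
pose E (z : Z) := xi (val z).1.1 (val z).2.1 - xi (val z).1.2 (val z).2.2.
have z0P : ((i, j), (s, t)).1.1 != ((i, j), (s, t)).1.2 by [].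
have [d hd d0] := @danskin R Z D E (MM + MM) (exist _ ((i, j), (s, t)) z0P)
  (fun z => hdist _ _ _ _ (valP z) (ex_intro2 _ _ _ I erefl) (ex_intro2 _ _ _ I erefl))
  (fun z => le_trans (enormD _ _) (lerD (le_trans (hMi _ _) (hMM _))
     (le_trans (eq_ind_r (fun a => a <= _) (hMi _ _) (enormN _)) (hMM _)))) d1 dneg.
exists d => //; rewrite /is_delta_LThi hthi.
rewrite (_ : (fun t => t^-1 * (LThi (perturb gamma xi t) - 1)) =
  (fun t => t^-1 * (inf [set enorm (D z + t *: E z) | z in setT] - 1))) //.
apply/funext => tau; congr (_ * (inf _ - _)); apply/seteqP; split=> [r|r].
  move=> [i' [j' [_ [_ [ij' [a _ <-] [b _ <-] ->]]]]].
  exists (exist _ ((i', j'), (a, b)) ij') => //.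
  by rewrite /D /E /=; congr enorm; apply: rV3P; rewrite !mxE; ring.
move=> [[[[i' j'] [a b]] ij'] _ <-].
exists i', j', (gamma i' a + tau *: xi i' a), (gamma j' b + tau *: xi j' b).
split=> //; [by exists a|by exists b|].
by rewrite /D /E /=; congr enorm; apply: rV3P; rewrite !mxE; ring.
Qed.

(** * Linking of the central curve with the circles *)

(** A positive inner product keeps the turn from (A, B) to (A', B') within a right angle, where it
    is the arc tangent of the cross product over the inner product; adding it to an angle of the
    first vector gives one of the second. *)
Lemma rotate_step (R : realType) (A B A' B' al rho : R) :
  0 < rho -> A = rho * cos al -> B = rho * sin al -> 0 < A * A' + B * B' ->
  exists2 rho' : R, 0 < rho' &
    A' = rho' * cos (al + atan ((A * B' - B * A') / (A * A' + B * B'))) /\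
    B' = rho' * sin (al + atan ((A * B' - B * A') / (A * A' + B * B'))).
Proof.
move=> r0 hA hB d0; set c := A * B' - B * A'; set d := A * A' + B * B' in d0 *.
set th := atan (c / d).
have c0 : 0 < cos th.
  by apply: cos_gt0_pihalf; rewrite atan_gtNpi2 atan_ltpi2.
have ht : sin th / cos th = c / d by rewrite -[RHS]atanK.
pose q := cos th / d; have q0 : 0 < q by rewrite divr_gt0.
have hcos : cos th = q * d by rewrite /q divfK // gt_eqF.
have hsin : sin th = q * c.
  by rewrite -[sin th](divfK (lt0r_neq0 c0)) ht /q; field; rewrite gt_eqF.
have AB : A ^+ 2 + B ^+ 2 = rho ^+ 2.
  by rewrite hA hB !exprMn -mulrDr cos2Dsin2 mulr1.
have e1 : cos al * d - sin al * c = A' * rho.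
  apply: (mulfI (lt0r_neq0 r0)).
  have -> : rho * (cos al * d - sin al * c) = A * d - B * c by rewrite hA hB; ring.
  have -> : rho * (A' * rho) = A' * rho ^+ 2 by ring.
  by rewrite -AB /d /c; ring.
have e2 : sin al * d + cos al * c = B' * rho.
  apply: (mulfI (lt0r_neq0 r0)).
  have -> : rho * (sin al * d + cos al * c) = B * d + A * c by rewrite hA hB; ring.
  have -> : rho * (B' * rho) = B' * rho ^+ 2 by ring.
  by rewrite -AB /d /c; ring.
exists (q * rho)^-1; first by rewrite invr_gt0 mulr_gt0.
have qr : q * rho != 0 by rewrite gt_eqF // mulr_gt0.
have f1 : cos (al + th) = q * rho * A'.
  by rewrite cosD hcos hsin -mulrA (mulrC rho) -e1; ring.
have f2 : sin (al + th) = q * rho * B'.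
  by rewrite sinD hcos hsin -mulrA (mulrC rho) -e2; ring.
by rewrite f1 f2 !mulKf.
Qed.

(* Lift the angle along s only: for small s-steps the angle increments are
   atan's, continuous and 2pi-periodic in phi. *)
Lemma no_contraction (R : realType) (A B : R * R -> R) :
  continuous A -> continuous B ->
  (forall s t : R, 0 <= s <= 1 -> A (s, t) ^+ 2 + B (s, t) ^+ 2 != 0) ->
  (forall t, A (0, t) = cos t) -> (forall t, B (0, t) = sin t) ->
  (forall s, A (s, 2 * pi) = A (s, 0)) -> (forall s, B (s, 2 * pi) = B (s, 0)) ->
  (forall t, A (1, t) = A (1, 0)) -> (forall t, B (1, t) = B (1, 0)) -> False.
Proof.
move=> cA cB hAB hA0 hB0 hA2 hB2 hA1 hB1.
pose K : set (R * R) := `[(0 : R), 1] `*` `[(0 : R), 2 * pi].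
have cK : compact K by apply: compact_setX; exact: segment_compact.
pose P (h : R) (z : R * R) := 0 < A z * A (z.1 + h, z.2) + B z * B (z.1 + h, z.2).
(* At h = 0 the product is A^2 + B^2 > 0; compactness of [K] gives one step size valid at all
   parameters. *)
have nP : \forall h \near (0 : R), K `<=` P h.
  have nc := iffLR (compact_near_coveringP K) cK.
  apply: (nc R (nbhs (0 : R)) P (nbhs_filter 0)) => [[s t] [/= hs ht]].
  rewrite in_itv /= in hs.
  pose f (zh : (R * R) * R) := A zh.1 * A (zh.1.1 + zh.2, zh.1.2) + B zh.1 * B (zh.1.1 + zh.2, zh.1.2).
  have cf : {for ((s, t), 0), continuous f}.
    have cc (C : R * R -> R) : continuous C ->
        {for ((s, t), 0), continuous (fun zh : (R * R) * R => C (zh.1.1 + zh.2, zh.1.2))}.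
      move=> cC.
      apply: (@contcomp _ _ _ (fun zh : (R * R) * R => (zh.1.1 + zh.2, zh.1.2)) C); last exact: cC.
      have c1 : {for ((s, t), 0), continuous (fun zh : (R * R) * R => zh.1.1)}.
        by apply: (@contcomp _ _ _ fst fst); [exact: contFst|exact: contFst].
      have c2 : {for ((s, t), 0), continuous (fun zh : (R * R) * R => zh.1.2)}.
        by apply: (@contcomp _ _ _ fst snd); [exact: contFst|exact: contSnd].
      by apply: contPair c2; apply: contD c1 _; exact: contSnd.
    have cc' (C : R * R -> R) : continuous C -> {for ((s, t), 0), continuous (fun zh : (R * R) * R => C zh.1)}.
      by move=> cC; apply: (@contcomp _ _ _ fst C); [exact: contFst|exact: cC].
    exact: (contD (contM (cc' _ cA) (cc _ cA)) (contM (cc' _ cB) (cc _ cB))).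
  have f0 : 0 < f ((s, t), 0).
    rewrite /f /= addr0 -!expr2 lt_neqAle eq_sym hAB //=.
    by rewrite addr_ge0 ?sqr_ge0.
  exact: (cvgr_gt _ cf _ f0).
have [d d0 hd] := near_R nP.
pose N := (Num.truncn d^-1).+1.
have N0 : 0 < N%:R :> R by rewrite ltr0n.
have hN : N%:R^-1 < d.
  by rewrite -[d]invrK ltf_pV2 ?posrE ?invr_gt0 //; exact: truncnS_gt.
pose h := (N%:R^-1 : R).
have h0 : 0 < h by rewrite invr_gt0.
have hP (m : nat) (t : R) : (m < N)%N -> 0 <= t <= 2 * pi -> P h (m%:R * h, t).
  move=> mN ht; apply: hd; first by rewrite subr0 gtr0_norm.
  split=> /=; rewrite in_itv //=; apply/andP; split; first by rewrite mulr_ge0 // ltW.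
  by rewrite ler_pdivrMr // mul1r ler_nat ltnW.
pose a m t := A (m%:R * h, t); pose b m t := B (m%:R * h, t).
have hPab m (t : R) : (m < N)%N -> 0 <= t <= 2 * pi -> 0 < a m t * a m.+1 t + b m t * b m.+1 t.
  by move=> mN ht; have := hP m t mN ht; rewrite /P /= /a /b -natr1 mulrDl mul1r.
pose th m t := atan ((a m t * b m.+1 t - b m t * a m.+1 t) / (a m t * a m.+1 t + b m t * b m.+1 t)).
(* Lifted angle after m steps in s, starting from t itself at s = 0. *)
pose Psi m t := t + \sum_(i < m) th i t.
have lift m (t : R) : (m <= N)%N -> 0 <= t <= 2 * pi -> exists2 rho : R, 0 < rho &
    a m t = rho * cos (Psi m t) /\ b m t = rho * sin (Psi m t).
  move=> + ht; elim: m => [|m IH] mN.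
    by exists 1 => //; rewrite /a /b /Psi big_ord0 addr0 !mul0r !mul1r hA0 hB0.
  have [rho r0 [e1 e2]] := IH (ltnW mN).
  have := rotate_step r0 e1 e2 (hPab m t mN ht).
  by rewrite /Psi big_ord_recr /= addrA.
have ca m x : {for x, continuous (a m)}.
  apply: (@contcomp _ _ _ (fun t => (m%:R * h, t)) A); last exact: cA.
  by apply: contPair; [exact: contC|exact: contI].
have cb m x : {for x, continuous (b m)}.
  apply: (@contcomp _ _ _ (fun t => (m%:R * h, t)) B); last exact: cB.
  by apply: contPair; [exact: contC|exact: contI].
have cPsi m (x : R) : (m <= N)%N -> 0 <= x <= 2 * pi -> {for x, continuous (Psi m)}.
  move=> + hx; elim: m => [|m IH] mN.
    rewrite (_ : Psi 0%N = id); first exact: cvg_id.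
    by apply/funext => t; rewrite /Psi big_ord0 addr0.
  rewrite (_ : Psi m.+1 = (fun t => Psi m t + th m t)); last first.
    by apply/funext => t; rewrite /Psi big_ord_recr /= addrA.
  apply: (contD (IH (ltnW mN))).
  apply: (@contcomp _ _ _ _ (@atan R)); last exact: continuous_atan.
  apply: contM.
    apply: contB; apply: contM; by [exact: ca|exact: cb].
  apply: contV; first by rewrite gt_eqF // hPab.
  apply: contD; apply: contM; by [exact: ca|exact: cb].
have p0 := pi_gt0 R.
have z2 : 0 <= (0 : R) <= 2 * pi by rewrite lexx /=; lra.
have per : Psi N (2 * pi) = Psi N 0 + 2 * pi.
  rewrite /Psi add0r addrC; congr (_ + _); apply: eq_bigr => i _.
  by rewrite /th /a /b !hA2 !hB2.
(* The lift still gains 2 pi over a period, although at s = 1 the loop is a single point. Where the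
   gain is pi, this point would have two opposite directions. *)
have [t ht hPt] : exists2 t, t \in `[(0 : R), 2 * pi]%R & Psi N t = Psi N 0 + pi.
  apply: IVT.
  - lra.
  - apply: continuous_in_subspaceT => x; rewrite inE /= in_itv /= => hx.
    exact: cPsi.
  - rewrite per ge_min le_max; apply/andP; split; apply/orP; [left|right]; lra.
rewrite in_itv /= in ht.
have [r1 r10 [e1 e2]] := lift N 0 (leqnn _) z2.
have [r2 r20 [e3 e4]] := lift N t (leqnn _) ht.
have Nh : N%:R * h = 1 by rewrite /h mulfV // gt_eqF.
rewrite hPt /a /b Nh hA1 hB1 cosDpi sinDpi in e3 e4.
rewrite /a /b Nh in e1 e2.
have r12 : r1 + r2 != 0 by rewrite gt_eqF // addr_gt0.
have c0 : cos (Psi N 0) = 0.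
  by apply: (mulfI r12); rewrite mulr0 mulrDl -e1 e3; ring.
have s0 : sin (Psi N 0) = 0.
  by apply: (mulfI r12); rewrite mulr0 mulrDl -e2 e4; ring.
have := cos2Dsin2 (Psi N 0); rewrite c0 s0 expr0n addr0 => /esym /eqP.
by rewrite oner_eq0.
Qed.

(* If h separated the two curves, shrinking the image of the meridian inside the
   convex set E would contract, off the parallel curve, a loop winding once. *)
Lemma homeo_not_separating (R : realType) (n : nat) (u : 'rV[R]_3)
    (v k : 'I_n -> 'rV[R]_3) pr i (h h' : 'rV[R]_3 -> 'rV[R]_3) (E : 'rV[R]_3 -> Prop) :
  star_config u v k pr -> continuous h -> continuous h' -> cancel h h' -> cancel h' h ->
  (forall x y (t : R), 0 <= t <= 1 -> E x -> E y -> E ((1 - t) *: x + t *: y)) ->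
  (forall x, parallel_set u v pr x -> ~ E (h x)) ->
  (forall x, meridian u (v i) (k i) x -> E (h x)) -> False.
Proof.
move=> hc ch ch' hK h'K cE hX hY.
have [hu hpl ss sd hor] := sc_orient hc; have hp := sc_proj hc.
have hk := sc_unit hc i; have uk := sc_plane hc i.
pose c (t : R) : 'rV[R]_3 := v i + (1 - cos t) *: k i + sin t *: u.
have cm t : meridian u (v i) (k i) (c t).
  exists (1 - cos t), (sin t); split=> //.
  by have := cos2Dsin2 t; lra.
(* [al] is 1 minus the distance from the region to the shadow [q x] in the plane. The pair ([al],
   [ht]) is (cos t, sin t) along the meridian and vanishes only on the parallel curve, so it counts
   the windings around that curve. *)
pose ht (x : 'rV[R]_3) : R := dot u (x - v i).
pose q (x : 'rV[R]_3) : 'rV[R]_3 := x - ht x *: u.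
pose al (x : 'rV[R]_3) : R := 1 - enorm (q x - pr (q x)).
have qc t : q (c t) = v i + (1 - cos t) *: k i /\ ht (c t) = sin t.
  have e : ht (c t) = sin t.
    rewrite /ht /c (_ : _ - v i = (1 - cos t) *: k i + sin t *: u).
      by rewrite dotDr !dotZr uk hu; ring.
    by apply: rV3P; rewrite !mxE; ring.
  by split=> //; rewrite /q e /c addrK.
have alc t : al (c t) = cos t.
  have [e _] := qc t; rewrite /al e.
  have c1 : 0 <= 1 - cos t by rewrite subr_ge0; exact: cos_le1.
  have -> : pr (v i + (1 - cos t) *: k i) = v i.
    apply: (proj_eq hp); first exact: region_vertex.
    rewrite addrAC subrr add0r => y hy; rewrite dotZl.
    by rewrite mulr_ge0_le0 //; exact: (sc_normal hc).
  rewrite addrAC subrr add0r enormZ; have /enorm1 -> := hk.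
  by rewrite ger0_norm // mulr1 subKr.
have zero x : al x = 0 -> ht x = 0 -> parallel_set u v pr x.
  move=> a0 h0; have qx : q x = x by rewrite /q h0 scale0r subr0.
  split=> [j|].
    have -> : x - v j = (x - v i) + (v i - v j) by rewrite addrA subrK.
    by rewrite dotDr hpl addr0.
  by apply/enorm1; rewrite /al qx in a0; lra.
have cht : continuous ht.
  move=> x; have c1 : {for x, continuous (fun x : 'rV[R]_3 => x - v i)}.
    by apply: contB; [exact: contI|exact: contC].
  exact: (dot_cont (@contC _ _ u x) c1).
have cq : continuous q.
  move=> x; change {for x, continuous (fun x : 'rV[R]_3 => x - ht x *: u)}; apply: contB; first exact: contI.
  by apply: contZ; [exact: cht|exact: contC].
have cal : continuous al.
  move=> x; change {for x, continuous (fun x : 'rV[R]_3 => 1 - enorm (q x - pr (q x)))}; apply: contB; first exact: contC.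
  apply: (@contcomp _ _ _ (fun x => q x - pr (q x)) (@enorm R)); last exact: enorm_cont.
  apply: contB; first exact: cq.
  by apply: (@contcomp _ _ _ q pr); [exact: cq|exact: proj_cont hp (q x)].
have cc : continuous c.
  move=> t; change {for t, continuous (fun t : R => v i + (1 - cos t) *: k i + sin t *: u)}; apply: contD; last first.
    by apply: contZ; [exact: continuous_sin|exact: contC].
  apply: contD; first exact: contC.
  apply: contZ; last exact: contC.
  by apply: contB; [exact: contC|exact: continuous_cos].
pose z (st : R * R) : 'rV[R]_3 := (1 - st.1) *: h (c st.2) + st.1 *: h (c 0).
have cz : continuous z.
  move=> st; change {for st, continuous (fun st : R * R => (1 - st.1) *: h (c st.2) + st.1 *: h (c 0))}; apply: contD; last by apply: contZ; [exact: contFst|exact: contC].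
  apply: contZ; first by apply: contB; [exact: contC|exact: contFst].
  apply: (@contcomp _ _ _ (fun st : R * R => c st.2) h); last exact: ch.
  by apply: (@contcomp _ _ _ snd c); [exact: contSnd|exact: cc].
have c2 : c (2 * pi) = c 0.
  by rewrite /c mulr_natl cos2pi sin2pi cos0 sin0.
have ch'z : continuous (fun st => h' (z st)).
  by move=> st; apply: (@contcomp _ _ _ z h'); [exact: cz|exact: ch'].
apply: (@no_contraction R (fun st => al (h' (z st))) (fun st => ht (h' (z st)))).
- by move=> st; apply: (@contcomp _ _ _ (fun st => h' (z st)) al); [exact: ch'z|exact: cal].
- by move=> st; apply: (@contcomp _ _ _ (fun st => h' (z st)) ht); [exact: ch'z|exact: cht].
- move=> s t hs; apply/eqP => e.
  have a0 : al (h' (z (s, t))) = 0.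
    apply/eqP; rewrite -sqrf_eq0; apply/eqP.
    by have := sqr_ge0 (al (h' (z (s, t)))); have := sqr_ge0 (ht (h' (z (s, t)))); lra.
  have h0 : ht (h' (z (s, t))) = 0.
    apply/eqP; rewrite -sqrf_eq0; apply/eqP.
    by have := sqr_ge0 (al (h' (z (s, t)))); have := sqr_ge0 (ht (h' (z (s, t)))); lra.
  apply: (hX _ (zero _ a0 h0)); rewrite h'K.
  by apply: cE => //; exact: hY.
- by move=> t; rewrite /z /= subr0 scale1r scale0r addr0 hK alc.
- by move=> t; rewrite /z /= subr0 scale1r scale0r addr0 hK; have [_] := qc t.
- by move=> s; rewrite /z /= c2.
- by move=> s; rewrite /z /= c2.
- by move=> t; rewrite /z /= subrr !scale0r.
- by move=> t; rewrite /z /= subrr !scale0r.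
Qed.

Lemma star_not_split (R : realType) (n : nat) (u : 'rV[R]_3) (v k : 'I_n -> 'rV[R]_3) pr i :
  star_config u v k pr ->
  ~ split_pair (parallel_set u v pr) (meridian u (v i) (k i)) /\
  ~ split_pair (meridian u (v i) (k i)) (parallel_set u v pr).
Proof.
move=> hc; split=> -[X' [Y' [w [d [[H [_ hH _ hI]] hX hY]]]]];
  have [|ch [h' [ch' hK h'K]]] := hH 1; rewrite ?ler01 ?lexx //.
- have iX := hI true; have iY := hI false; rewrite /= in iX iY.
  apply: (@homeo_not_separating R n u v k pr i (H 1) h' (fun y => d < dot w y) hc) => //.
  + move=> x y t /andP[t0 t1] hx hy; rewrite dotDr !dotZr.
    by have [->|tp] := eqVneq t 0; [|have : 0 < t by rewrite lt_neqAle eq_sym tp]; nra.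
  + move=> x hx; have : X' (H 1 x) by rewrite -iX; exists x.
    by move=> /hX h1 h2; have := lt_trans h1 h2; rewrite ltxx.
  + by move=> x hx; apply: hY; rewrite -iY; exists x.
- have iX := hI true; have iY := hI false; rewrite /= in iX iY.
  apply: (@homeo_not_separating R n u v k pr i (H 1) h' (fun y => dot w y < d) hc) => //.
  + move=> x y t /andP[t0 t1] hx hy; rewrite dotDr !dotZr.
    by have [->|tp] := eqVneq t 0; [|have : 0 < t by rewrite lt_neqAle eq_sym tp]; nra.
  + move=> x hx; have : Y' (H 1 x) by rewrite -iY; exists x.
    by move=> /hY h1 h2; have := lt_trans h1 h2; rewrite ltxx.
  + by move=> x hx; apply: hX; rewrite -iX; exists x.
Qed.

Lemma homeo_id (R : realType) : homeo (fun x : 'rV[R]_3 => x).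
Proof. by split; [move=> x; exact: contI|exists (fun x => x); split=> // x; exact: contI]. Qed.

Lemma isotopic_refl (R : realType) (I : Type) (L : I -> set 'rV[R]_3) : ambient_isotopic L L.
Proof.
exists (fun _ x => x); split=> //.
- by apply: continuous_subspaceT => z; exact: contSnd.
- by move=> t _; exact: homeo_id.
- by move=> i; rewrite image_id.
Qed.

(** The product with [v j - v i] is at most its value at [v i] on one circle and at least 1 more on
    the other; the plane at 1 / 2 separates them without any motion. *)
Lemma meridians_split (R : realType) (n : nat) (u : 'rV[R]_3) (v k : 'I_n -> 'rV[R]_3) pr i j :
  star_config u v k pr -> i != j ->
  split_pair (meridian u (v i) (k i)) (meridian u (v j) (k j)).
Proof.
move=> hc ij; exists (meridian u (v i) (k i)), (meridian u (v j) (k j)), (v j - v i),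
  (dot (v j - v i) (v i) + 1 / 2); split; first exact: isotopic_refl.
- move=> x hx; have := meridian_sep j hc hx.
  have e y : dot (v i - v j) y = - dot (v j - v i) y by rewrite -opprB dotNl.
  by rewrite !e; lra.
- move=> y hy; have := meridian_sep i hc hy.
  have := sc_dist hc ij; rewrite [X in 1 <= X]dotDr dotNr; lra.
Qed.

Lemma star_linked (R : realType) (n : nat) (u : 'rV[R]_3) (v k : 'I_n -> 'rV[R]_3) pr
    (L : 'I_n.+1 -> set 'rV[R]_3) : star_config u v k pr ->
  L ord0 = parallel_set u v pr ->
  (forall i, L (lift ord0 i) = meridian u (v i) (k i)) ->
  forall i j, star i j <-> linked_components L i j.
Proof.
move=> hc h0 hi i j; rewrite /star /linked_components.
have nl (x : 'I_n) : (lift ord0 x == ord0) = false by rewrite eq_sym; exact/negbTE/neq_lift.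
have nl' (x : 'I_n) : lift ord0 x <> ord0 by apply/eqP; rewrite nl.
case: (unliftP ord0 i) => [i' ->|->]; case: (unliftP ord0 j) => [j' ->|->].
- rewrite !nl !hi /=; split=> // -[ij []].
  by apply: (meridians_split hc); apply/eqP => e; apply: ij; rewrite e.
- rewrite nl eqxx h0 hi /=; split=> // _; split; first exact: nl'.
  exact: (star_not_split i' hc).2.
- rewrite nl eqxx h0 hi /=; split=> // _; split; first by move/esym; exact: nl'.
  exact: (star_not_split j' hc).1.
- by rewrite eqxx; split=> // -[].
Qed.

(** * Connected sums of Hopf links *)

Lemma isotopyI (R : realType) (H : R -> 'rV[R]_3 -> 'rV[R]_3) (I : Type)
    (L : I -> set 'rV[R]_3) :
  (forall (t : R) x, 0 <= t <= 1 -> {for (t, x), continuous (fun z => H z.1 z.2)}) ->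
  (forall t : R, 0 <= t <= 1 -> homeo (H t)) -> (forall x, H 0 x = x) ->
  ambient_isotopic L (fun i => H 1 @` L i).
Proof.
move=> hc hh h0; exists H; split=> //.
by apply: continuous_in_subspaceT => -[t x]; rewrite inE /= => ht; exact: hc.
Qed.

Lemma homeo_comp (R : realType) (f g : 'rV[R]_3 -> 'rV[R]_3) :
  homeo f -> homeo g -> homeo (f \o g).
Proof.
move=> [cf [f' [cf' fK f'K]]] [cg [g' [cg' gK g'K]]]; split.
  by move=> x; apply: (@contcomp _ _ _ g f); [exact: cg|exact: cf].
exists (g' \o f'); split=> [x|x|x] /=; last 2 first.
- by rewrite fK gK.
- by rewrite g'K f'K.
- by apply: (@contcomp _ _ _ f' g'); [exact: cf'|exact: cg'].
Qed.

(** Undo the final map, then run the isotopy backwards. In this form no continuity in time of the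
    inverse maps is required. *)
Lemma isotopic_sym (R : realType) (I : Type) (L L' : I -> set 'rV[R]_3) :
  ambient_isotopic L L' -> ambient_isotopic L' L.
Proof.
move=> [H [cH hH h0 h1]].
have i1 : 0 <= (1 : R) <= 1 by rewrite ler01 lexx.
have [ch [h' [ch' hK h'K]]] := hH 1 i1.
have hh' : homeo h' by split=> //; exists (H 1).
exists (fun t => H (1 - t) \o h'); split.
- apply/subspace_continuousP => -[t x] /= ht.
  have /subspace_continuousP cH' := cH.
  have ht' : 0 <= 1 - t <= 1 by case/andP: ht => a b; apply/andP; split; lra.
  have cphi : {for (t, x), continuous (fun z : R * 'rV[R]_3 => (1 - z.1, h' z.2))}.
    apply: contPair; first by apply: contB; [exact: contC|exact: contFst].
    by apply: (@contcomp _ _ _ snd h'); [exact: contSnd|exact: ch'].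
  move=> W hW; have HW := cphi _ (cH' (1 - t, h' x) ht' W hW).
  refine (@filterS _ (nbhs (t, x)) (nbhs_filter (t, x)) _ _ _ HW) => z /= hz Az.
  by apply: hz; case/andP: Az => a b; apply/andP; split; lra.
- move=> t /andP[a b]; apply: homeo_comp; last exact: hh'.
  by apply: hH; apply/andP; split; lra.
- by move=> x /=; rewrite subr0 h'K.
- move=> i; rewrite subrr -h1; apply/seteqP; split=> x /=.
    by move=> [_ [y hy <-] <-]; rewrite hK h0.
  by move=> hx; exists (H 1 x); [exists x|rewrite hK h0].
Qed.

Lemma hopf_iso (R : realType) n (I : finType) (L L' : I -> set 'rV[R]_3) :
  ambient_isotopic L' L -> hopf_sum n L -> hopf_sum n L'.
Proof. by move=> h1 h2; apply: hopf_sum_isotopic h2 _; exact: isotopic_sym. Qed.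

Lemma translation_isotopy (R : realType) (b : 'rV[R]_3) (I : Type) (L : I -> set 'rV[R]_3) :
  ambient_isotopic L (fun i => (fun x => x + b) @` L i).
Proof.
have := @isotopyI R (fun t x => x + t *: b) I L; rewrite scale1r; apply.
- move=> t x _ /=; apply: contD; first exact: contSnd.
  by apply: contZ; [exact: contFst|exact: contC].
- move=> t _; split.
    move=> x; change {for x, continuous (fun x : 'rV[R]_3 => x + t *: b)}.
    by apply: contD; [exact: contI|exact: contC].
  exists (fun x => x - t *: b); split=> x; rewrite ?addrK ?subrK //.
  change {for x, continuous (fun x : 'rV[R]_3 => x - t *: b)}.
  by apply: contB; [exact: contI|exact: contC].
- by move=> x; rewrite scale0r addr0.
Qed.

(** Householder reflection in the plane orthogonal to [b]. Rotations are handled as products of two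
    of these, since a single one reverses orientation. *)
Definition refl (R : realType) (b x : 'rV[R]_3) : 'rV[R]_3 :=
  x - (2 * dot b x / dot b b) *: b.

Lemma dot_nz (R : realType) (b : 'rV[R]_3) : b != 0 -> dot b b != 0.
Proof. by move=> h; apply: contra h => /eqP /dotxx_eq0 ->. Qed.

Lemma reflK (R : realType) (b : 'rV[R]_3) : b != 0 -> involutive (refl b).
Proof.
move=> /dot_nz b0 x; rewrite /refl [dot b (_ - _)]dotDr dotNr dotZr.
rewrite (_ : 2 * (dot b x - _) / _ = - (2 * dot b x / dot b b)); last by field.
by rewrite scaleNr opprK subrK.
Qed.

Lemma refl_dot (R : realType) (b x y : 'rV[R]_3) : b != 0 ->
  dot (refl b x) (refl b y) = dot x y.
Proof.
move=> /dot_nz b0; rewrite /refl; set p := _ / _; set q := 2 * dot b y / _.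
have -> : dot (x - p *: b) (y - q *: b) =
    dot x y - q * dot b x - p * dot b y + p * q * dot b b.
  by rewrite !dotE !mxE; ring.
by rewrite /p /q; field.
Qed.

Lemma refl_perp (R : realType) (b x : 'rV[R]_3) : dot b x = 0 -> refl b x = x.
Proof. by move=> h; rewrite /refl h mulr0 mul0r scale0r subr0. Qed.

Lemma refl_swap (R : realType) (x y : 'rV[R]_3) : x != y -> dot x x = dot y y ->
  refl (x - y) x = y.
Proof.
rewrite -subr_eq0 => /dot_nz h0 e; rewrite /refl.
have -> : 2 * dot (x - y) x / dot (x - y) (x - y) = 1.
  have e2 : dot (x - y) (x - y) = 2 * dot (x - y) x.
    by rewrite dotBB -e dotDl dotNl (dotC y x); ring.
  by rewrite -e2 divff.
by rewrite scale1r subKr.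
Qed.

Lemma refl_cont (R : realType) (T : topologicalType) (b f : T -> 'rV[R]_3) (z : T) :
  b z != 0 -> {for z, continuous b} -> {for z, continuous f} ->
  {for z, continuous (fun w => refl (b w) (f w))}.
Proof.
move=> b0 cb cf.
have c1 := contM (contM (@contC _ _ (2 : R) z) (dot_cont cb cf)) (@contV T R (fun w => dot (b w) (b w)) z (dot_nz b0) (dot_cont cb cb)).
exact: (contB cf (contZ c1 cb)).
Qed.

Lemma refl_homeo (R : realType) (b : 'rV[R]_3) : b != 0 -> homeo (refl b).
Proof.
move=> b0; have c : continuous (refl b).
  by move=> x; exact: (@refl_cont _ _ (fun=> b) id x b0 (@contC _ _ b x) (@contI _ x)).
by split=> //; exists (refl b); split=> //; exact: reflK.
Qed.

Lemma reflZ (R : realType) (c : R) (b x : 'rV[R]_3) : c != 0 -> refl (c *: b) x = refl b x.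
Proof.
move=> c0; rewrite /refl dotZl dotZl dotZr scalerA; have [->|b0] := eqVneq b 0.
  by rewrite !scaler0.
have := dot_nz b0 => d0; congr (_ - _ *: _); field.
by rewrite d0 c0.
Qed.

(* Moving b to a along a segment joins the rotation [refl a \o refl b] to the
   identity; if the segment meets 0, then a and b are parallel. *)
Lemma refl2_isotopy (R : realType) (a b : 'rV[R]_3) (I : Type) (L : I -> set 'rV[R]_3) :
  a != 0 -> b != 0 -> ambient_isotopic L (fun i => (refl a \o refl b) @` L i).
Proof.
move=> a0 b0; pose bt (t : R) := (1 - t) *: a + t *: b.
have [[t [ht tz]]|hnz] := pselect (exists t : R, 0 <= t <= 1 /\ bt t = 0).
  have t0 : t != 0.
    by apply: contra a0 => /eqP t0; move: tz; rewrite /bt t0 subr0 scale1r scale0r addr0 => ->.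
  have e : b = - ((1 - t) / t) *: a.
    have h : t *: b = - (1 - t) *: a.
      by apply/eqP; rewrite -subr_eq0 scaleNr opprK addrC; apply/eqP.
    by rewrite -[LHS]scale1r -[X in X *: b](mulVf t0) -scalerA h scalerA mulrN (mulrC t^-1).
  have c0 : - ((1 - t) / t) != 0 by apply: contra b0 => /eqP c0; rewrite e c0 scale0r.
  rewrite (_ : (fun i => _) = L); first exact: isotopic_refl.
  apply/funext => i; rewrite (_ : refl a \o refl b = id) ?image_id //.
  by apply/funext => x /=; rewrite e reflZ // reflK.
have nz (t : R) : 0 <= t <= 1 -> bt t != 0.
  by move=> ht; apply/eqP => e; apply: hnz; exists t.
have := @isotopyI R (fun t => refl a \o refl (bt t)) I L.
have -> : bt 1 = b by rewrite /bt subrr scale0r scale1r add0r.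
apply.
- move=> t x ht /=.
  have c1 : {for (t, x), continuous (fun z : R * 'rV[R]_3 => bt z.1)}.
    apply: contD; apply: contZ; try exact: contC; try exact: contFst.
    by apply: contB; [exact: contC|exact: contFst].
  have c2 := @refl_cont _ _ _ _ (t, x) (nz _ ht) c1 (@contSnd _ _ (t, x)).
  exact: (@refl_cont _ _ (fun=> a) _ _ a0 (@contC _ _ a _) c2).
- by move=> t ht; apply: homeo_comp; apply: refl_homeo => //; exact: nz.
- by move=> x /=; rewrite /bt subr0 scale1r scale0r addr0 reflK.
Qed.

(** * Radial deformation of plane convex bodies *)

Definition pl (R : realType) (x : 'rV[R]_3) : 'rV[R]_3 := vec3 (x 0 0) (x 0 1) 0.
Definition ez (R : realType) : 'rV[R]_3 := vec3 0 0 1.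
Definition ex (R : realType) : 'rV[R]_3 := vec3 1 0 0.

Lemma pl_ez (R : realType) (x : 'rV[R]_3) : x = pl x + x 0 2%:R *: ez R.
Proof. by apply: rV3P; rewrite !mxE /=; ring. Qed.

Lemma plZ (R : realType) (c : R) (x : 'rV[R]_3) : pl (c *: x) = c *: pl x.
Proof. by apply: rV3P; rewrite !mxE /=; ring. Qed.

Lemma plB (R : realType) (x y : 'rV[R]_3) : pl (x - y) = pl x - pl y.
Proof. by apply: rV3P; rewrite !mxE /=; ring. Qed.

Lemma plD (R : realType) (x y : 'rV[R]_3) : pl (x + y) = pl x + pl y.
Proof. by apply: rV3P; rewrite !mxE /=; ring. Qed.

Lemma pl_pl (R : realType) (x : 'rV[R]_3) : pl (pl x) = pl x.
Proof. by apply: rV3P; rewrite !mxE. Qed.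

Lemma pl_id (R : realType) (x : 'rV[R]_3) : x 0 2%:R = 0 -> pl x = x.
Proof. by move=> h; apply: rV3P; rewrite !mxE. Qed.

Lemma pl2 (R : realType) (x : 'rV[R]_3) : pl x 0 2%:R = 0.
Proof. by rewrite mxE. Qed.

Lemma pl_le (R : realType) (x : 'rV[R]_3) : enorm (pl x) <= enorm x.
Proof.
rewrite enorm_le ?enorm_ge0 // enorm2 !dotE !mxE /=.
by have := sqr_ge0 (x 0 2%:R); nra.
Qed.

Lemma pl_cont (R : realType) : continuous (@pl R).
Proof. by apply: (@elip _ _ 1) => // x y; rewrite mul1r -plB pl_le. Qed.

Definition convex_fun (R : realType) (F : 'rV[R]_3 -> R) :=
  forall x y (t : R), 0 <= t <= 1 -> F ((1 - t) *: x + t *: y) <= (1 - t) * F x + t * F y.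

(** [F <= 0] describes a compact convex region of the plane z = 0. Working with the function makes
    the intersection with a half-plane a maximum, and the boundary the equation [F = 0] once [F] is
    negative somewhere inside. *)
Record body (R : realType) (F : 'rV[R]_3 -> R) : Prop := Body {
  body_cont : continuous F;
  body_convex : convex_fun F;
  body_bound : exists M : R, forall x : 'rV[R]_3, x 0 2%:R = 0 -> F x <= 0 -> enorm x <= M }.

(** Convexity and [F 0 < 0] make every point strictly before one with [F <= 0] strictly interior, so
    a ray from 0 crosses the level 0 at most once. *)
Lemma ray_lt (R : realType) (F : 'rV[R]_3 -> R) (x : 'rV[R]_3) (r s : R) : convex_fun F -> F 0 < 0 ->
  0 <= r -> r < s -> F (s *: x) <= 0 -> F (r *: x) < 0.
Proof.
move=> cF F0 r0 rs Fs; have s0 : 0 < s by apply: le_lt_trans rs.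
pose t := r / s.
have t0 : 0 <= t by rewrite divr_ge0 // ltW.
have t1 : t < 1 by rewrite ltr_pdivrMr // mul1r.
have := cF 0 (s *: x) t; rewrite t0 (ltW t1) => /(_ isT).
rewrite scaler0 add0r scalerA /t divfK ?gt_eqF // -/t => h.
apply: le_lt_trans h _.
have : (1 - t) * F 0 < 0 by rewrite pmulr_rlt0 // subr_gt0.
have : t * F (s *: x) <= 0 by rewrite mulr_ge0_le0.
lra.
Qed.

(* The default value 1, taken at [x = 0], makes the rescaling by a quotient of
   radial functions the identity on the vertical axis. *)
Definition rad (R : realType) (F : 'rV[R]_3 -> R) (x : 'rV[R]_3) : R :=
  xget 1 [set r | 0 < r /\ F (r *: x) = 0].

Lemma ray_cont (R : realType) (F : 'rV[R]_3 -> R) (x : 'rV[R]_3) : continuous F ->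
  continuous (fun r : R => F (r *: x)).
Proof.
move=> cF r; apply: (@contcomp _ _ _ (fun r : R => r *: x) F); last exact: cF.
by apply: contZ; [exact: contI|exact: contC].
Qed.

Lemma rad_ex (R : realType) (F : 'rV[R]_3 -> R) (x : 'rV[R]_3) : body F -> F 0 < 0 ->
  x 0 2%:R = 0 -> x != 0 -> 0 < rad F x /\ F (rad F x *: x) = 0.
Proof.
move=> hF F0 x2 x0; apply: (@xgetPex _ 1 [set r | 0 < r /\ F (r *: x) = 0]).
have [M hM] := body_bound hF; have ex0 := enorm_gt0 x0.
have M0 : 0 <= M.
  by apply: le_trans (hM 0 _ (ltW F0)); [exact: enorm_ge0|rewrite mxE].
pose r := (M + 1) / enorm x.
have r0 : 0 < r by rewrite divr_gt0 //; lra.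
have Fr : 0 < F (r *: x).
  rewrite ltNge; apply/negP => h.
  have := hM (r *: x); rewrite mxE x2 mulr0 => /(_ erefl h).
  by rewrite enormZ gtr0_norm // /r divfK ?gt_eqF //; lra.
have [c hc hFc] : exists2 c, c \in `[0, r]%R & F (c *: x) = 0.
  apply: IVT; first exact: ltW.
    by apply: continuous_subspaceT; exact: ray_cont (body_cont hF).
  by rewrite scale0r ge_min le_max (ltW F0) (ltW Fr) orbT.
exists c; split=> //; move: hc; rewrite in_itv /= => /andP[c0 _].
rewrite lt_neqAle c0 andbT; apply/eqP => e; move: hFc; rewrite -e scale0r => e0.
by rewrite e0 ltxx in F0.
Qed.

Lemma rad_lt (R : realType) (F : 'rV[R]_3 -> R) (x : 'rV[R]_3) (r : R) : body F -> F 0 < 0 ->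
  x 0 2%:R = 0 -> x != 0 -> 0 <= r -> (F (r *: x) < 0) = (r < rad F x).
Proof.
move=> hF F0 x2 x0 r0; have [p0 pE] := rad_ex hF F0 x2 x0.
apply/idP/idP => h; last by apply: (ray_lt (body_convex hF) F0 r0 h); rewrite pE.
rewrite ltNge; apply/negP; rewrite le_eqVlt => /orP[/eqP e|lt].
  by rewrite -e pE ltxx in h.
have := ray_lt (body_convex hF) F0 (ltW p0) lt (ltW h).
by rewrite pE ltxx.
Qed.

Lemma rad_gt (R : realType) (F : 'rV[R]_3 -> R) (x : 'rV[R]_3) (r : R) : body F -> F 0 < 0 ->
  x 0 2%:R = 0 -> x != 0 -> 0 <= r -> (0 < F (r *: x)) = (rad F x < r).
Proof.
move=> hF F0 x2 x0 r0; have [p0 pE] := rad_ex hF F0 x2 x0.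
apply/idP/idP => h.
  rewrite ltNge le_eqVlt; apply/negP => /orP[/eqP e|lt].
    by rewrite e pE ltxx in h.
  by have := ray_lt (x := x) (body_convex hF) F0 r0 lt; rewrite pE lexx => /(_ isT); rewrite ltNge (ltW h).
rewrite ltNge; apply/negP => hh.
have := ray_lt (body_convex hF) F0 (ltW p0) h hh; by rewrite pE ltxx.
Qed.

Lemma rad_eq (R : realType) (F : 'rV[R]_3 -> R) (x : 'rV[R]_3) (r : R) : body F -> F 0 < 0 ->
  x 0 2%:R = 0 -> x != 0 -> 0 < r -> F (r *: x) = 0 -> rad F x = r.
Proof.
move=> hF F0 x2 x0 r0 e; apply: le_anti; apply/andP; split.
  by rewrite leNgt -(rad_lt hF F0 x2 x0 (ltW r0)) e ltxx.
rewrite leNgt; apply/negP => h.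
by have := rad_gt hF F0 x2 x0 (ltW r0); rewrite h e ltxx.
Qed.

Lemma rad_scale (R : realType) (F : 'rV[R]_3 -> R) (x : 'rV[R]_3) (c : R) : body F -> F 0 < 0 ->
  x 0 2%:R = 0 -> x != 0 -> 0 < c -> rad F (c *: x) = rad F x / c.
Proof.
move=> hF F0 x2 x0 c0; have [p0 pE] := rad_ex hF F0 x2 x0.
apply: rad_eq => //; [by rewrite mxE x2 mulr0|by rewrite scaler_eq0 gt_eqF|exact: divr_gt0|].
by rewrite scalerA divfK // gt_eqF.
Qed.

Lemma rad_cont (R : realType) (F : 'rV[R]_3 -> R) (x : 'rV[R]_3) : body F -> F 0 < 0 ->
  pl x != 0 -> {for x, continuous (fun y => rad F (pl y))}.
Proof.
move=> hF F0 x0; have [p0 pE] := rad_ex hF F0 (pl2 x) x0.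
have cr (r : R) : {for x, continuous (fun y => F (r *: pl y))}.
  have c1 : {for x, continuous (fun y : 'rV[R]_3 => r *: pl y)}.
    by apply: contZ; [exact: contC|exact: pl_cont].
  by apply: (@contcomp _ _ _ (fun y : 'rV[R]_3 => r *: pl y) F x c1); exact: (body_cont hF).
have npl := enorm_near (@pl_cont R x) x0.
have key (e : R) : 0 < e -> \forall y \near x, `|rad F (pl x) - rad F (pl y)| < e.
  move=> e0; pose e' := Num.min e (rad F (pl x)).
  have e'0 : 0 < e' by rewrite lt_min e0 p0.
  have e'e : e' <= e by rewrite ge_min lexx.
  have e'p : e' <= rad F (pl x) by rewrite ge_min lexx orbT.
  have r1 : 0 <= rad F (pl x) - e' by rewrite subr_ge0.
  have h1 : F ((rad F (pl x) - e') *: pl x) < 0 by rewrite rad_lt ?pl2 //; lra.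
  have h2 : 0 < F ((rad F (pl x) + e') *: pl x) by rewrite rad_gt ?pl2 // ?ltrDl ?e'0 //; lra.
  have n1 := cvgr_lt _ (cr (rad F (pl x) - e')) _ h1.
  have n2 := cvgr_gt _ (cr (rad F (pl x) + e')) _ h2.
  near=> y.
  have y0 : pl y != 0 by near: y.
  have : F ((rad F (pl x) - e') *: pl y) < 0 by near: y; exact: n1.
  rewrite (rad_lt hF F0 (pl2 y) y0 r1) => l1.
  have : 0 < F ((rad F (pl x) + e') *: pl y) by near: y; exact: n2.
  have r2 : 0 <= rad F (pl x) + e' by lra.
  rewrite (rad_gt hF F0 (pl2 y) y0 r2) => l2.
  by rewrite ltr_norml; apply/andP; split; lra.
have kk : forall e : R, 0 < e -> exists2 d : R, 0 < d & forall y, `|x - y| < d -> `|rad F (pl x) - rad F (pl y)| < e.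
  move=> e /key /nbhs_normP [d /= d0 hd]; exists d => // y hy; exact: hd.
exact: (@cont_dist R 'rV[R]_3 R^o _ x kk).
Unshelve. all: by end_near. Qed.

(** On the axis the factor [mu] need not be continuous; it is bounded and multiplies a vector that
    tends to 0. *)
Lemma scale_cont (R : realType) (T : topologicalType) (f : T -> 'rV[R]_3) (mu : T -> R)
    (z : T) (K : R) :
  {for z, continuous f} -> (\forall w \near z, `|mu w| <= K) ->
  (pl (f z) != 0 -> {for z, continuous mu}) ->
  {for z, continuous (fun w => f w + (mu w - 1) *: pl (f w))}.
Proof.
move=> cf hK cm; have [p0|p0] := eqVneq (pl (f z)) 0; last first.
  have cp : {for z, continuous (fun w => pl (f w))}.
    by apply: (@contcomp _ _ _ f (@pl R)); [exact: cf|exact: pl_cont].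
  exact: (contD cf (contZ (contB (cm p0) (@contC _ _ (1 : R) z)) cp)).
apply: econt_near => e e0; rewrite p0 scaler0 addr0.
have K0 : 0 < `|K| + 2 by rewrite ltr_wpDl.
have e1 : 0 < e / (`|K| + 2) by rewrite divr_gt0.
near=> w.
have h1 : enorm (f z - f w) < e / (`|K| + 2) by near: w; exact: econt_at.
have h2 : `|mu w| <= K by near: w.
have h3 : enorm (pl (f w)) <= enorm (f z - f w).
  have e3 : pl (f w) = pl (f w - f z) by rewrite plB p0 subr0.
  by rewrite e3; apply: le_trans (pl_le _) _; rewrite enormB.
rewrite opprD addrA; apply: le_lt_trans (enormD _ _) _; rewrite enormN enormZ.
rewrite ltr_pdivlMr // in h1; apply: le_lt_trans h1.
have h4 : `|mu w - 1| <= `|K| + 1.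
  apply: le_trans (ler_normB _ _) _; rewrite normr1 lerD2r.
  by apply: le_trans h2 _; exact: ler_norm.
have h5 : `|mu w - 1| * enorm (pl (f w)) <= (`|K| + 1) * enorm (f z - f w).
  by apply: ler_pM; rewrite ?enorm_ge0.
apply: le_trans (lerD (lexx _) h5) _; rewrite -{1}[enorm _]mul1r -mulrDl mulrC.
by rewrite (_ : 1 + (`|K| + 1) = `|K| + 2) //; ring.
Unshelve. all: by end_near. Qed.

Lemma rad0 (R : realType) (F : 'rV[R]_3 -> R) : F 0 < 0 -> rad F 0 = 1.
Proof.
move=> F0; apply: xgetPN => r [_]; rewrite scaler0 => e.
by rewrite e ltxx in F0.
Qed.

Lemma rad_pos (R : realType) (F : 'rV[R]_3 -> R) x : body F -> F 0 < 0 ->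
  0 < rad F (pl x).
Proof.
move=> hF F0; have [->|h] := eqVneq (pl x) 0; first by rewrite rad0.
by have [] := rad_ex hF F0 (pl2 x) h.
Qed.

(** The product is the distance from 0 to the boundary in the direction of [pl x]: bounded because
    the body is, and bounded below because [F] is negative near 0. Thus quotients of two radial
    functions stay bounded, though each of them blows up at the axis. *)
Lemma rad_bounds (R : realType) (F : 'rV[R]_3 -> R) : body F -> F 0 < 0 ->
  exists m M : R, [/\ 0 < m, 0 < M & forall x : 'rV[R]_3, pl x != 0 ->
    m <= rad F (pl x) * enorm (pl x) <= M].
Proof.
move=> hF F0; have [M hM] := body_bound hF.
have c0 : {for (0 : 'rV[R]_3), continuous F} by exact: (body_cont hF).
have nF : \forall y \near (0 : 'rV[R]_3), F y < 0 by exact: (cvgr_lt _ c0 _ F0).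
move: nF => /nbhs_normP [m /= m0 hm].
have M1 : 0 < `|M| + 1 by apply: ltr_wpDl.
exists m, (`|M| + 1); split; [exact: m0|exact: M1|].
move=> x x0; have [p0 pE] := rad_ex hF F0 (pl2 x) x0.
have e : rad F (pl x) * enorm (pl x) = enorm (rad F (pl x) *: pl x).
  by rewrite enormZ gtr0_norm.
rewrite e; apply/andP; split; last first.
  apply: (@le_trans _ _ M); first by apply: hM; rewrite ?pE // mxE pl2 mulr0.
  by apply: le_trans (ler_norm _) _; rewrite lerDl.
rewrite leNgt; apply/negP => h.
have := hm (rad F (pl x) *: pl x); rewrite /ball_ /= pE ltxx sub0r normrN.
by move=> h'; have := h' (le_lt_trans (norm_le_enorm _) h).
Qed.

Lemma ratio_bound (R : realType) (F F' : 'rV[R]_3 -> R) : body F -> F 0 < 0 ->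
  body F' -> F' 0 < 0 ->
  exists2 K : R, 0 < K & forall x, rad F' (pl x) / rad F (pl x) <= K.
Proof.
move=> hF F0 hF' F'0; have [m [M [m0 M0 h]]] := rad_bounds hF F0.
have [m' [M' [m'0 M'0 h']]] := rad_bounds hF' F'0.
have q0 : 0 < M' / m by rewrite divr_gt0.
exists (1 + M' / m); first by rewrite addr_gt0.
move=> x; have [e|x0] := eqVneq (pl x) 0.
  by rewrite e !rad0 // divr1; lra.
have p0 := rad_pos x hF F0; have /andP[a _] := h x x0; have /andP[_ b] := h' x x0.
have e0 := enorm_gt0 x0.
have -> : rad F' (pl x) / rad F (pl x) =
    (rad F' (pl x) * enorm (pl x)) / (rad F (pl x) * enorm (pl x)).
  by field; rewrite !gt_eqF.
apply: (@le_trans _ _ (M' / m)); last by lra.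
rewrite ler_pdivrMr ?mulr_gt0 //; apply: le_trans b _.
by rewrite mulrAC ler_pdivlMr // ler_wpM2l // ltW.
Qed.

(* Every point is pushed along the horizontal ray from the z-axis, by a factor
   that carries the boundary of the first body to that of the second. *)
Lemma radial_isotopy (R : realType) (F F' : 'rV[R]_3 -> R) : body F -> F 0 < 0 ->
  body F' -> F' 0 < 0 ->
  exists H H' : 'rV[R]_3 -> 'rV[R]_3, [/\
    forall (I : Type) (L : I -> set 'rV[R]_3), ambient_isotopic L (fun i => H @` L i),
    cancel H H' /\ cancel H' H,
    forall x : 'rV[R]_3, exists2 k : R, 0 < k & H x = k *: pl x + x 0 2%:R *: ez R,
    forall x : 'rV[R]_3, x 0 2%:R = 0 -> (F x < 0) = (F' (H x) < 0) /\ (F x <= 0) = (F' (H x) <= 0) &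
    forall (y : 'rV[R]_3) (r s : R), y 0 2%:R = 0 -> y != 0 -> F y = 0 -> F' y = 0 -> 0 <= r ->
      H (r *: y + s *: ez R) = r *: y + s *: ez R].
Proof.
move=> hF F0 hF' F'0.
pose k (x : 'rV[R]_3) : R := rad F' (pl x) / rad F (pl x).
have k0 x : 0 < k x by rewrite divr_gt0 // rad_pos.
have [K K0 hK] := ratio_bound hF F0 hF' F'0.
have [K2 K20 hK2] := ratio_bound hF' F'0 hF F0.
have kh (c : R) x y : 0 < c -> pl y = c *: pl x -> k y = k x.
  move=> c0 e; rewrite /k e; have [->|x0] := eqVneq (pl x) 0; first by rewrite scaler0.
  rewrite !rad_scale ?pl2 //; have := rad_pos x hF F0 => p0.
  by field; rewrite !gt_eqF.
(* The interpolated factor is constant along each ray from the axis, so dividing by it inverts the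
   map. The bounds on both quotients keep it away from 0 and infinity, which gives continuity on the
   axis. *)
pose ka (t : R) x := (1 - t) + t * k x.
have kaL (t : R) x : 0 <= t <= 1 -> (1 + K2)^-1 <= ka t x.
  move=> /andP[t0 t1].
  have k2 : (1 + K2)^-1 <= k x.
    rewrite -[k x]invrK lef_pV2 ?posrE ?invr_gt0 ?addr_gt0 //.
    by apply: le_trans (_ : K2 <= _); [rewrite /k invf_div; exact: hK2|lra].
  have k1 : (1 + K2)^-1 <= 1 by rewrite invf_le1 ?addr_gt0 //; lra.
  rewrite /ka; have : (1 - t) * (1 + K2)^-1 <= (1 - t) * 1 by rewrite ler_wpM2l // subr_ge0.
  have : t * (1 + K2)^-1 <= t * k x by rewrite ler_wpM2l.
  lra.
have ka0 (t : R) x : 0 <= t <= 1 -> 0 < ka t x.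
  by move=> ht; apply: lt_le_trans (kaL t x ht); rewrite invr_gt0 addr_gt0.
have ck x : pl x != 0 -> {for x, continuous k}.
  move=> x0; apply: contM; first exact: rad_cont.
  by apply: contV; [rewrite gt_eqF // rad_pos|exact: rad_cont].
have cka (t : R) x : pl x != 0 -> {for (t, x), continuous (fun z : R * 'rV[R]_3 => ka z.1 z.2)}.
  move=> x0; have c1 := @contFst R 'rV[R]_3 (t, x).
  have c2 : {for (t, x), continuous (fun z : R * 'rV[R]_3 => k z.2)}.
    by apply: (@contcomp _ _ _ snd k); [exact: contSnd|exact: ck].
  exact: (contD (contB (@contC _ _ (1 : R) (t, x)) c1) (contM c1 c2)).
pose H (t : R) x := x + (ka t x - 1) *: pl x.
pose H' (t : R) x := x + ((ka t x)^-1 - 1) *: pl x.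
have plH (t : R) x : pl (H t x) = ka t x *: pl x.
  by rewrite /H plD plZ pl_pl; apply: rV3P; rewrite !mxE; ring.
have plH' (t : R) x : pl (H' t x) = (ka t x)^-1 *: pl x.
  by rewrite /H' plD plZ pl_pl; apply: rV3P; rewrite !mxE; ring.
have kaH (t : R) x : 0 <= t <= 1 -> ka t (H t x) = ka t x.
  by move=> ht; rewrite /ka (@kh (ka t x) x) //; exact: ka0.
have kaH' (t : R) x : 0 <= t <= 1 -> ka t (H' t x) = ka t x.
  by move=> ht; rewrite /ka (@kh (ka t x)^-1 x) // invr_gt0; exact: ka0.
have HK (t : R) : 0 <= t <= 1 -> cancel (H t) (H' t).
  move=> ht x; rewrite {1}/H' plH kaH // /H.
  have := ka0 t x ht => p; apply: rV3P; rewrite !mxE /=; field; by rewrite gt_eqF.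
have H'K (t : R) : 0 <= t <= 1 -> cancel (H' t) (H t).
  move=> ht x; rewrite {1}/H plH' kaH' // /H'.
  have := ka0 t x ht => p; apply: rV3P; rewrite !mxE /=; field; by rewrite gt_eqF.
have cH (t : R) x : {for (t, x), continuous (fun z : R * 'rV[R]_3 => H z.1 z.2)}.
  apply: (@scale_cont R _ snd (fun z : R * 'rV[R]_3 => ka z.1 z.2) (t, x) (1 + (`|t| + 1) + (`|t| + 1) * K)).
  - exact: contSnd.
  - have n1 : \forall z \near (t, x), `|(t, x).1 - z.1| < 1.
      have /cvgrPdist_lt := @contFst R 'rV[R]_3 (t, x); apply; exact: ltr01.
    near=> z.
    have hz : `|t - z.1| < 1 by near: z; exact: n1.
    have z1 : `|z.1| <= `|t| + 1.
      have := ler_normB t (t - z.1); rewrite subKr; move: hz; clear; lra.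
    rewrite /ka; apply: le_trans (ler_normD _ _) _.
    apply: lerD.
      apply: le_trans (ler_normB _ _) _; rewrite normr1; move: z1; clear; lra.
    rewrite normrM; apply: ler_pM => //; rewrite ?normr_ge0 //.
    by rewrite gtr0_norm ?k0 //; exact: hK.
  - exact: cka.
have cH1 (t : R) : 0 <= t <= 1 -> continuous (H t).
  move=> ht x; have c1 : {for x, continuous (fun y : 'rV[R]_3 => (t, y))}.
    by apply: contPair; [exact: contC|exact: contI].
  exact: (@contcomp _ _ _ (fun y : 'rV[R]_3 => (t, y)) (fun z => H z.1 z.2) x c1 (cH t x)).
have cH' (t : R) : 0 <= t <= 1 -> continuous (H' t).
  move=> ht x.
  apply: (@scale_cont R _ id (fun y : 'rV[R]_3 => (ka t y)^-1) x (1 + K2)).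
  - exact: contI.
  - near=> y; rewrite gtr0_norm ?invr_gt0 ?ka0 //.
    rewrite -[1 + K2]invrK lef_pV2 ?posrE ?ka0 // ?invr_gt0 ?addr_gt0 //.
    exact: kaL.
  - move=> x0; apply: contV; first by rewrite gt_eqF // ka0.
    have c1 : {for x, continuous (fun y : 'rV[R]_3 => (t, y))}.
      by apply: contPair; [exact: contC|exact: contI].
    exact: (@contcomp _ _ _ (fun y : 'rV[R]_3 => (t, y)) (fun z => ka z.1 z.2) x c1 (cka t x x0)).
have i1 : 0 <= (1 : R) <= 1 by rewrite ler01 lexx.
have ka1 x : ka 1 x = k x by rewrite /ka subrr add0r mul1r.
have H1E x : H 1 x = k x *: pl x + x 0 2%:R *: ez R.
  by rewrite /H ka1; apply: rV3P; rewrite !mxE /=; ring.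
exists (H 1), (H' 1); split.
- move=> I L; apply: isotopyI => [t x _|t ht|x]; first exact: cH.
    split; first exact: cH1.
    by exists (H' t); split; [exact: cH'|exact: HK|exact: H'K].
  by rewrite /H /ka mul0r addr0 subr0 subrr scale0r addr0.
- by split; [exact: HK|exact: H'K].
- by move=> x; exists (k x); [exact: k0|exact: H1E].
- move=> x x2; rewrite H1E x2 scale0r addr0 (pl_id x2).
  have [->|x0] := eqVneq x 0.
    by rewrite scaler0 !F0 !F'0 !(ltW F0) !(ltW F'0).
  have px : pl x = x := pl_id x2; have p0 : 0 < rad F x by rewrite -px rad_pos.
  have e1 : (k x < rad F' x) = (1 < rad F x).
    by rewrite /k px ltr_pdivrMr // ltr_pMr // -px rad_pos.
  have e2 : (rad F' x < k x) = (rad F x < 1).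
    by rewrite /k px ltr_pdivlMr // gtr_pMr // -px rad_pos.
  have f1 := rad_lt hF F0 x2 x0 ler01; have f2 := rad_gt hF F0 x2 x0 ler01.
  rewrite scale1r in f1 f2.
  have g1 := rad_lt hF' F'0 x2 x0 (ltW (k0 x)); have g2 := rad_gt hF' F'0 x2 x0 (ltW (k0 x)).
  split; first by rewrite f1 g1 e1.
  by rewrite !leNgt f2 g2 e2.
(* Where both boundaries pass through [y] the factor is 1 on the half-plane above its ray; a circle
   hooked there is not moved. *)
- move=> y r s y2 y0 Fy F'y r0.
  have [->|rn0] := eqVneq r 0.
    by rewrite H1E scale0r add0r; apply: rV3P; rewrite !mxE /=; ring.
  have rp : 0 < r by rewrite lt_neqAle eq_sym rn0.
  have px : pl (r *: y + s *: ez R) = r *: pl y.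
    by rewrite plD !plZ; apply: rV3P; rewrite !mxE /=; ring.
  have k1 : k (r *: y + s *: ez R) = 1.
    rewrite (kh r y) // /k (pl_id y2) (@rad_eq _ F' y 1) ?scale1r //.
    by rewrite (@rad_eq _ F y 1) ?scale1r ?divr1.
  by rewrite H1E k1 scale1r -pl_ez.
Unshelve. all: by end_near. Qed.

(** * Necklaces: circles hooked on the boundary of a plane convex body *)

Lemma unit_vec_ex (R : realType) : unit_vec R (inord 0) = ex R.
Proof.
rewrite /unit_vec (_ : inord 0 = 0 :> 'I_3); last by apply: val_inj; rewrite /= inordK.
by apply: rV3P; rewrite !mxE.
Qed.

Lemma unit_vec_ey (R : realType) : unit_vec R (inord 1) = vec3 0 1 0.
Proof.
rewrite /unit_vec (_ : inord 1 = 1 :> 'I_3); last by apply: val_inj; rewrite /= inordK.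
by apply: rV3P; rewrite !mxE.
Qed.

Lemma unit_vec_ez (R : realType) : unit_vec R (inord 2) = ez R.
Proof.
rewrite /unit_vec (_ : inord 2 = 2%:R :> 'I_3); last by apply: val_inj; rewrite /= inordK.
by apply: rV3P; rewrite !mxE.
Qed.

Lemma xcoordE (R : realType) (x : 'rV[R]_3) : xcoord x = x 0 0.
Proof. by rewrite /xcoord unit_vec_ex dotE !mxE /=; ring. Qed.

Lemma convex_max (R : realType) (F G : 'rV[R]_3 -> R) : convex_fun F -> convex_fun G ->
  convex_fun (fun x => Num.max (F x) (G x)).
Proof.
move=> cF cG x y t ht; have := cF x y t ht; have := cG x y t ht.
case/andP: ht => t0 t1; have s0 : 0 <= 1 - t by rewrite subr_ge0.
have a1 : (1 - t) * F x <= (1 - t) * Num.max (F x) (G x) by rewrite ler_wpM2l // le_max lexx.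
have a2 : (1 - t) * G x <= (1 - t) * Num.max (F x) (G x) by rewrite ler_wpM2l // le_max lexx orbT.
have b1 : t * F y <= t * Num.max (F y) (G y) by rewrite ler_wpM2l // le_max lexx.
have b2 : t * G y <= t * Num.max (F y) (G y) by rewrite ler_wpM2l // le_max lexx orbT.
move: a1 a2 b1 b2; clear => a1 a2 b1 b2 h1 h2; rewrite ge_max; apply/andP; split; lra.
Qed.

Lemma cont_max (R : realType) (T : topologicalType) (f g : T -> R) (x : T) :
  {for x, continuous f} -> {for x, continuous g} ->
  {for x, continuous (fun z => Num.max (f z) (g z))}.
Proof. by move=> cf cg; exact: (@continuous_max _ _ f g x cf cg). Qed.

Lemma body_max (R : realType) (F G : 'rV[R]_3 -> R) : body F -> continuous G -> convex_fun G ->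
  body (fun x => Num.max (F x) (G x)).
Proof.
move=> hF cG vG; split.
- by move=> x; apply: cont_max; [exact: (body_cont hF)|exact: cG].
- by apply: convex_max; [exact: (body_convex hF)|].
- have [M hM] := body_bound hF; exists M => x x2; rewrite ge_max => /andP[h _]; exact: hM.
Qed.

Lemma convex_coord (R : realType) (a : R) (i : 'I_3) : convex_fun (fun x : 'rV[R]_3 => a * x 0 i).
Proof. by move=> x y t _; rewrite !mxE le_eqVlt; apply/orP; left; apply/eqP; ring. Qed.

Lemma cont_coordZ (R : realType) (a : R) (i : 'I_3) : continuous (fun x : 'rV[R]_3 => a * x 0 i).
Proof. by move=> x; apply: contM; [exact: contC|exact: coord_cont]. Qed.

Lemma body_translate (R : realType) (F : 'rV[R]_3 -> R) (o : 'rV[R]_3) : o 0 2%:R = 0 -> body F ->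
  body (fun x => F (x + o)).
Proof.
move=> o2 hF; split.
- move=> x; have c : {for x, continuous (fun y : 'rV[R]_3 => y + o)}.
    by apply: contD; [exact: contI|exact: contC].
  by apply: (@contcomp _ _ _ (fun y : 'rV[R]_3 => y + o) F x c); exact: (body_cont hF).
- move=> x y t ht; have := body_convex hF (x + o) (y + o) ht.
  by rewrite (_ : (1 - t) *: (x + o) + _ = (1 - t) *: x + t *: y + o) //; apply: rV3P; rewrite !mxE; ring.
- have [M hM] := body_bound hF; exists (M + enorm o) => x x2 h.
  have := hM (x + o); rewrite mxE x2 o2 addr0 => /(_ erefl h) hh.
  have := enormD (x + o) (- o); rewrite addrK enormN; move: hh; clear; lra.
Qed.

(* [None] indexes the curve [F = 0] of the plane [z = 0]. *)
Definition necklace (R : realType) (T : finType) (F : 'rV[R]_3 -> R) (v n : T -> 'rV[R]_3)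
    (o : option T) : set 'rV[R]_3 :=
  if o is Some i then meridian (ez R) (v i) (n i) else [set x : 'rV[R]_3 | x 0 2%:R = 0 /\ F x = 0].

(* The circles have diameter 2, so marked points at distance 5 along the x-axis
   leave a slab of width 1 around the middle plane that meets no circle. *)
Record hooked (R : realType) (T : finType) (F : 'rV[R]_3 -> R) (v n : T -> 'rV[R]_3) : Prop := Hooked {
  hk_body : body F;
  hk_v : forall i, v i 0 2%:R = 0;
  hk_n : forall i, n i 0 2%:R = 0;
  hk_unit : forall i, dot (n i) (n i) = 1;
  hk_in : forall i, F (v i) < 0;
  hk_on : forall i, F (v i + n i) = 0;
  hk_far : forall i j, i != j -> 5 <= `|v i 0 0 - v j 0 0| }.

Lemma hooked_translate (R : realType) (T : finType) (F : 'rV[R]_3 -> R) (v n : T -> 'rV[R]_3)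
    (o : 'rV[R]_3) :
  o 0 2%:R = 0 -> hooked F v n -> hooked (fun x => F (x + o)) (fun i => v i - o) n.
Proof.
move=> o2 [h1 h2 h3 h4 h5 h6 h7]; split=> //.
- exact: body_translate.
- by move=> i; rewrite !mxE h2 o2 subrr.
- by move=> i; rewrite subrK.
- by move=> i; rewrite addrAC subrK.
- by move=> i j ij; rewrite !mxE opprD addrACA subrr addr0 h7.
Qed.

Lemma necklace_translate (R : realType) (T : finType) (F : 'rV[R]_3 -> R) (v n : T -> 'rV[R]_3)
    (o : 'rV[R]_3) m :
  o 0 2%:R = 0 -> hopf_sum m (necklace (fun x => F (x + o)) (fun i => v i - o) n) ->
  hopf_sum m (necklace F v n).
Proof.
move=> o2; apply: hopf_iso.
rewrite (_ : necklace (fun x => F (x + o)) _ _ = fun k => (fun x => x - o) @` necklace F v n k).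
  exact: (translation_isotopy (- o)).
apply/funext => -[i|] /=; apply/seteqP; split=> x /=.
- move=> [r [s [h ->]]]; exists (v i + r *: n i + s *: ez R); first by exists r, s.
  by apply: rV3P; rewrite !mxE; ring.
- move=> [_ [r [s [h ->]]] <-]; exists r, s; split=> //.
  by apply: rV3P; rewrite !mxE; ring.
- by move=> [x2 h]; exists (x + o); rewrite ?addrK // mxE x2 o2 addr0.
- by move=> [y [y2 h] <-]; rewrite subrK !mxE y2 o2 subrr.
Qed.

(** Isotopies keep labels, so the passage from a necklace labelled by [option 'I_n] to a link
    labelled by ['I_n.+1] goes through the inductive definition. *)
Lemma hopf_relabel (R : realType) m (I : finType) (L : I -> set 'rV[R]_3) : hopf_sum m L ->
  forall (K : finType) (h : I -> K) (h' : K -> I), cancel h h' -> cancel h' h ->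
  hopf_sum m (L \o h').
Proof.
elim=> {m I L} [I L f bf hL|m n I J K A B C hA _ hB _ hC|n I L L' hL IH hi] K' h h' hK h'K.
- apply: (@hopf_sum1 R K' _ (h \o f)); first by apply: bij_comp => //; exists h'.
  by rewrite (_ : _ \o _ = L \o f) //; apply/funext => b /=; rewrite hK.
- apply: (hopf_sumD hA hB); move: hC => [f [g [a [b [p [q [e [[fi gi fg d s] H1 [H2 H2'] H3 H4]]]]]]]].
  exists (h \o f), (h \o g), a, b, p, q, e; split.
  + split.
    * exact: inj_comp (can_inj hK) fi.
    * exact: inj_comp (can_inj hK) gi.
    * by rewrite /= fg.
    * by move=> i j /(can_inj hK); exact: d.
    * move=> k; have [[i hi]|[j hj]] := s (h' k); [left; exists i|right; exists j] => /=; by rewrite ?hi ?hj h'K.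
  + by rewrite /= hK.
  + by rewrite /= !hK.
  + by move=> i /H3; rewrite /= hK.
  + by move=> i /H4; rewrite /= hK.
- apply: hopf_sum_isotopic (IH K' h h' hK h'K) _.
  by case: hi => H [q1 q2 q3 q4]; exists H; split=> // i; exact: q4.
Qed.

(** A linear isometry that can be removed from a link without changing [hopf_sum]. The first field
    records this effect instead of an isotopy, so that composition needs no concatenation of
    isotopies. *)
Record rigid (R : realType) (f : 'rV[R]_3 -> 'rV[R]_3) : Prop := Rigid {
  rg_hopf : forall m (I : finType) (L : I -> set 'rV[R]_3),
    hopf_sum m (fun i => f @` L i) -> hopf_sum m L;
  rg_surj : forall y, exists x, f x = y;
  rg_lin : forall (a b : R) x y, f (a *: x + b *: y) = a *: f x + b *: f y;
  rg_dot : forall x y, dot (f x) (f y) = dot x y }.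

Lemma rigid_id (R : realType) : rigid (fun x : 'rV[R]_3 => x).
Proof.
split=> // [m I L|y]; last by exists y.
by rewrite (_ : (fun i => _) = L) //; apply/funext => i; rewrite image_id.
Qed.

Lemma rigid_comp (R : realType) (f g : 'rV[R]_3 -> 'rV[R]_3) : rigid f -> rigid g -> rigid (f \o g).
Proof.
move=> hf hg; split=> [m I L h|y|a b x y|x y] /=.
- apply: (rg_hopf hg); apply: (rg_hopf hf).
  by rewrite (_ : (fun i => _) = fun i => (f \o g) @` L i) //; apply/funext => i; rewrite image_comp.
- have [z <-] := rg_surj hf y; have [x <-] := rg_surj hg z; by exists x.
- by rewrite (rg_lin hg) (rg_lin hf).
- by rewrite (rg_dot hf) (rg_dot hg).
Qed.

Lemma refl_lin (R : realType) (c : 'rV[R]_3) (a b : R) x y :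
  refl c (a *: x + b *: y) = a *: refl c x + b *: refl c y.
Proof.
rewrite /refl [dot c (_ + _)]dotDr !dotZr.
by apply: rV3P; rewrite !mxE; ring.
Qed.

Lemma rigid_refl2 (R : realType) (a b : 'rV[R]_3) : a != 0 -> b != 0 -> rigid (refl a \o refl b).
Proof.
move=> a0 b0; split=> [m I L|y|c d x y|x y] /=.
- by apply: hopf_iso; exact: refl2_isotopy.
- by exists (refl b (refl a y)); rewrite !reflK.
- by rewrite !refl_lin.
- by rewrite !refl_dot.
Qed.

(** The reflection in [a - b] carries [a] to [b]; a second one, in [c] orthogonal to [b], fixes [b]
    and makes the product a rotation. The vectors it fixes let a later swap keep an axis already in
    place. *)
Lemma rigid_swap (R : realType) (a b c : 'rV[R]_3) : dot a a = dot b b -> c != 0 -> dot c b = 0 ->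
  exists f, [/\ rigid f, f a = b & forall x, dot a x = 0 -> dot b x = 0 -> dot c x = 0 -> f x = x].
Proof.
move=> e c0 cb; have [->|ab] := eqVneq a b.
  by exists (fun x => x); split=> //; exact: rigid_id.
have d0 : a - b != 0 by rewrite subr_eq0.
exists (refl c \o refl (a - b)); split.
- exact: rigid_refl2.
- by rewrite /= refl_swap // refl_perp.
- by move=> x ax bx cx /=; rewrite (@refl_perp _ (a - b)) ?refl_perp // dotDl dotNl ax bx subrr.
Qed.

Lemma vec3_neq0 (R : realType) (a b c : R) i : vec3 a b c 0 i != 0 -> vec3 a b c != 0.
Proof. by apply: contraNneq => ->; rewrite mxE. Qed.

Lemma ey_neq0 (R : realType) : vec3 0 1 0 != 0 :> 'rV[R]_3.
Proof. by apply: (@vec3_neq0 _ _ _ _ 1); rewrite vec3E1 oner_eq0. Qed.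

Lemma frame (R : realType) (a b : 'rV[R]_3) : dot a a = 1 -> dot b b = 1 -> dot a b = 0 ->
  exists f, [/\ rigid f, f a = ex R & f b = ez R].
Proof.
move=> aa bb ab.
have exx : dot (ex R) (ex R) = 1 by rewrite dotE !mxE /=; ring.
have ezz : dot (ez R) (ez R) = 1 by rewrite dotE !mxE /=; ring.
have exz : dot (ez R) (ex R) = 0 by rewrite dotE !mxE /=; ring.
have eyx : dot (vec3 0 1 0) (ex R) = 0 by rewrite dotE !mxE /=; ring.
have eyz : dot (vec3 0 1 0) (ez R) = 0 by rewrite dotE !mxE /=; ring.
have [f [hf fa _]] : exists f, [/\ rigid f, f a = ex R & forall x, dot a x = 0 ->
    dot (ex R) x = 0 -> dot (vec3 0 1 0) x = 0 -> f x = x].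
  by apply: rigid_swap eyx; rewrite ?ey_neq0 ?aa.
have [g [hg gb gx]] : exists g, [/\ rigid g, g (f b) = ez R & forall x, dot (f b) x = 0 ->
    dot (ez R) x = 0 -> dot (vec3 0 1 0) x = 0 -> g x = x].
  by apply: rigid_swap eyz; rewrite ?ey_neq0 // (rg_dot hf) bb.
exists (g \o f); split=> //=; first exact: rigid_comp.
by rewrite fa gx // -fa (rg_dot hf) dotC.
Qed.

Lemma image_level (R : realType) (H H' : 'rV[R]_3 -> 'rV[R]_3) (G G' : 'rV[R]_3 -> R) :
  cancel H' H -> (forall x : 'rV[R]_3, H x 0 2%:R = x 0 2%:R) ->
  (forall x : 'rV[R]_3, x 0 2%:R = 0 -> (G x < 0) = (G' (H x) < 0) /\ (G x <= 0) = (G' (H x) <= 0)) ->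
  H @` [set x : 'rV[R]_3 | x 0 2%:R = 0 /\ G x = 0] = [set x : 'rV[R]_3 | x 0 2%:R = 0 /\ G' x = 0].
Proof.
move=> HK H2 hs.
have s0 (a b : R) : (a < 0) = (b < 0) -> (a <= 0) = (b <= 0) -> a = 0 -> b = 0.
  by move=> e1 e2 a0; apply/eqP; move: e1 e2; rewrite a0 ltxx lexx eq_le => e1 <-; rewrite leNgt -e1.
apply/seteqP; split=> y /=.
  by move=> [x [x2 Gx] <-]; have [e1 e2] := hs x x2; rewrite H2; split=> //; exact: s0 e1 e2 Gx.
move=> [y2 Gy]; have x2 : H' y 0 2%:R = 0 by rewrite -H2 HK.
exists (H' y) => //; split=> //; have [e1 e2] := hs _ x2; rewrite HK in e1 e2.
exact: (s0 _ _ (esym e1) (esym e2) Gy).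
Qed.

Lemma convex_shift (R : realType) (F : 'rV[R]_3 -> R) (c : R) : convex_fun F ->
  convex_fun (fun x => F x - c).
Proof. by move=> h x y t ht; have := h x y t ht; lra. Qed.

Lemma body_disk (R : realType) : body (fun x : 'rV[R]_3 => enorm (pl x) - 1).
Proof.
split.
- move=> x; have c : {for x, continuous (fun y : 'rV[R]_3 => enorm (pl y))}.
    by apply: (@contcomp _ _ _ (@pl R) (@enorm R)); [exact: pl_cont|exact: enorm_cont].
  exact: (contB c (@contC _ _ (1 : R) x)).
- apply: convex_shift => x y t /andP[t0 t1]; rewrite plD !plZ.
  apply: le_trans (enormD _ _) _; rewrite !enormZ ger0_norm ?subr_ge0 //.
  by rewrite ger0_norm.
- by exists 1 => x x2; rewrite pl_id // subr_le0.
Qed.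

Lemma radial_height (R : realType) (H : 'rV[R]_3 -> 'rV[R]_3) :
  (forall x : 'rV[R]_3, exists2 k : R, 0 < k & H x = k *: pl x + x 0 2%:R *: ez R) ->
  forall x : 'rV[R]_3, H x 0 2%:R = x 0 2%:R.
Proof. by move=> h x; have [k _ ->] := h x; rewrite !mxE /=; ring. Qed.

(** The curve is deformed to the unit circle about the bead at 0. The point [n i0] lies on both
    curves, so the hooked circle stays fixed, and a rotation takes the pair to the standard Hopf
    link. *)
Lemma necklace_base (R : realType) (T : finType) (F : 'rV[R]_3 -> R) (v n : T -> 'rV[R]_3) i0 :
  (forall i : T, i = i0) -> v i0 = 0 -> hooked F v n -> hopf_sum 1 (necklace F v n).
Proof.
move=> hi v0 [hF _ n2 n1 vin von _].
have F0 : F 0 < 0 by rewrite -v0.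
have F'0 : enorm (pl (0 : 'rV[R]_3)) - 1 < 0.
  by rewrite pl_id ?mxE // enorm0 sub0r oppr_lt0.
have [H [H' [iso [_ HK] Hk Hs Hf]]] := radial_isotopy hF F0 (body_disk R) F'0.
have n0 : n i0 != 0.
  by apply/eqP => e; have := n1 i0; rewrite e dot0l => /esym/eqP; rewrite oner_eq0.
have Fn : F (n i0) = 0 by have := von i0; rewrite v0 add0r.
have F'n : enorm (pl (n i0)) - 1 = 0.
  by rewrite pl_id //; have /enorm1 -> := n1 i0; rewrite subrr.
apply: (hopf_iso (iso _ _)).
have nz : dot (n i0) (ez R) = 0 by rewrite dotE !mxE /= n2; ring.
have ezz : dot (ez R) (ez R) = 1 by rewrite dotE !mxE /=; ring.
have [f [hf fn fz]] := frame (n1 i0) ezz nz.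
apply: (rg_hopf hf).
pose h (b : bool) : option T := if b then None else Some i0.
apply: (@hopf_sum1 _ _ _ h).
  exists (fun o : option T => if o is None then true else false) => [[]//|[i|]//=].
  by rewrite (hi i).
rewrite (_ : _ \o h = @std_hopf R); first exact: isotopic_refl.
apply/funext => -[] /=.
- transitivity (f @` [set x : 'rV[R]_3 | x 0 2%:R = 0 /\ enorm (pl x) - 1 = 0]).
    congr (_ @` _); exact: (image_level HK (radial_height Hk) Hs).
  rewrite unit_vec_ez.
  have dz (x : 'rV[R]_3) : dot (ez R) x = x 0 2%:R by rewrite dotE !mxE /=; ring.
  apply/seteqP; split=> y /=.
    move=> [x [x2]]; rewrite pl_id // => e <-; rewrite /unit_circle /= subr0; split.
      by apply/enorm1; rewrite (rg_dot hf); apply/enorm1; move: e; clear; lra.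
    by rewrite -fz (rg_dot hf) dz.
  rewrite /unit_circle /= subr0; have [x <-] := rg_surj hf y => -[/enorm1 e1 e2].
  move: e1 e2; rewrite (rg_dot hf) -fz (rg_dot hf) dz => /enorm1 e1 x2.
  by exists x => //; split=> //; rewrite pl_id // e1 subrr.
- have -> : H @` meridian (ez R) (v i0) (n i0) = meridian (ez R) (v i0) (n i0).
    have fx x : meridian (ez R) (v i0) (n i0) x -> H x = x.
      move=> [r [s [e ->]]]; rewrite v0 add0r Hf //.
      by have [] := meridian_bounds e.
    apply/seteqP; split=> x /=; first by move=> [y hy <-]; rewrite fx.
    by move=> hx; exists x => //; exact: fx.
  rewrite v0 unit_vec_ex unit_vec_ey -[ex R in RHS]add0r.
  rewrite (@unit_circle_meridian _ (ez R)) //; last 5 first.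
  + by rewrite dotE !mxE /=; ring.
  + by rewrite dotE !mxE /=; ring.
  + exact: ey_neq0.
  + by rewrite dotE !mxE /=; ring.
  + by rewrite dotE !mxE /=; ring.
  apply/seteqP; split=> y /=.
    move=> [_ [r [s [e ->]]] <-]; exists r, s; split=> //.
    by rewrite add0r (rg_lin hf) fn fz add0r.
  move=> [r [s [e ->]]]; exists (r *: n i0 + s *: ez R); first by exists r, s; rewrite add0r.
  by rewrite (rg_lin hf) fn fz add0r.
Qed.

Definition square (R : realType) (x : 'rV[R]_3) : R := Num.max `|x 0 0| `|x 0 1| - 1.

Lemma convex_abs (R : realType) (i : 'I_3) : convex_fun (fun x : 'rV[R]_3 => `|x 0 i|).
Proof.
move=> x y t /andP[t0 t1]; rewrite !mxE; apply: le_trans (ler_normD _ _) _.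
by rewrite !normrM (ger0_norm t0) ger0_norm ?subr_ge0.
Qed.

Lemma cont_abs (R : realType) (i : 'I_3) : continuous (fun x : 'rV[R]_3 => `|x 0 i|).
Proof.
move=> x; apply: (@contcomp _ _ _ (fun x : 'rV[R]_3 => x 0 i) (fun r : R => `|r|)).
  exact: coord_cont.
exact: (@norm_continuous R R^o).
Qed.

Lemma body_square (R : realType) : body (@square R).
Proof.
split.
- move=> x; have c := cont_max (@cont_abs R 0 x) (@cont_abs R 1 x).
  exact: (contB c (@contC _ _ (1 : R) x)).
- by apply: convex_shift; apply: convex_max; exact: convex_abs.
- exists 2 => x x2; rewrite /square subr_le0 ge_max => /andP[h0 h1].
  rewrite enorm_le ?ler0n // dotE x2.
  move: h0 h1; rewrite !ler_norml => /andP[a b] /andP[c d]; nra.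
Qed.

Lemma vec3_segment (R : realType) (x : 'rV[R]_3) : x 0 2%:R = 0 -> x 0 0 = 0 -> `|x 0 1| <= 1 ->
  segment (vec3 0 (-1) 0) (vec3 0 1 0) x.
Proof.
move=> x2 x0; rewrite ler_norml => /andP[a b]; exists ((x 0 1 + 1) / 2).
  by apply/andP; split; lra.
by apply: rV3P; rewrite !mxE /= ?x0 ?x2; lra.
Qed.

Lemma segment_vec3 (R : realType) (x : 'rV[R]_3) :
  segment (vec3 0 (-1) 0) (vec3 0 1 0) x -> [/\ x 0 2%:R = 0, x 0 0 = 0 & `|x 0 1| <= 1].
Proof.
move=> [t /andP[a b] <-]; rewrite !mxE /=; split; [ring|ring|].
by rewrite ler_norml; apply/andP; split; lra.
Qed.

(** The zero set of the maximum is what remains of the boundary together with the cut itself: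
    precisely the closing of a half by a segment that [decomposed_sum] prescribes. *)
Lemma square_half (R : realType) (e : R) : e != 0 ->
  [set x : 'rV[R]_3 | x 0 2%:R = 0 /\ Num.max (square x) (e * x 0 0) = 0] =
  ([set x : 'rV[R]_3 | x 0 2%:R = 0 /\ square x = 0] `&` [set x : 'rV[R]_3 | e * x 0 0 <= 0])
    `|` segment (vec3 0 (-1) 0) (vec3 0 1 0).
Proof.
move=> e0; apply/seteqP; split=> x /=.
- move=> [x2 hm]; have h1 : square x <= 0 by rewrite -hm le_max lexx.
  have h2 : e * x 0 0 <= 0 by rewrite -hm le_max lexx orbT.
  have [q|q] := eqVneq (square x) 0; first by left.
  have x0 : e * x 0 0 = 0.
    apply/eqP; rewrite eq_le h2 /= leNgt; apply/negP => h3.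
    have : Num.max (square x) (e * x 0 0) < 0 by rewrite gt_max h3 lt_neqAle q h1.
    by rewrite hm ltxx.
  right; move/eqP: x0; rewrite mulf_eq0 (negPf e0) => /eqP x0.
  by apply: vec3_segment => //; move: h1; rewrite /square subr_le0 ge_max => /andP[].
- case=> [[[x2 q] h]|/segment_vec3[x2 x0 x1]]; split=> //.
    by rewrite q; apply/eqP; rewrite eq_le le_max lexx andbT ge_max lexx.
  rewrite x0 mulr0 /square x0 normr0 (max_r (normr_ge0 _)); apply/eqP.
  by rewrite eq_le le_max lexx orbT andbT ge_max lexx andbT subr_le0.
Qed.

Lemma square_cross (R : realType) :
  [set x : 'rV[R]_3 | x 0 2%:R = 0 /\ square x = 0] `&` [set x | `|xcoord x| <= 1 / 2] =
  [set z + t *: unit_vec R (inord 0)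
    | z in [set vec3 0 (-1) 0; vec3 0 1 0] & t in [set t : R | `|t| <= 1 / 2]].
Proof.
rewrite unit_vec_ex; apply/seteqP; split=> x /=.
- rewrite xcoordE => -[[x2 q] h].
  have h1 : `|x 0 1| = 1.
    apply/eqP; rewrite eq_le; apply/andP; split.
      have : Num.max `|x 0 0| `|x 0 1| <= 1 by rewrite -subr_le0 -/(square x) q.
      by rewrite ge_max => /andP[].
    have : 1 <= Num.max `|x 0 0| `|x 0 1| by rewrite -subr_ge0 -/(square x) q.
    by rewrite le_max => /orP[|//]; move: h; clear; lra.
  have xE c : x 0 1 = c -> vec3 0 c 0 + x 0 0 *: ex R = x.
    by move=> hc; apply: rV3P; rewrite !mxE /= ?x2 ?hc; ring.
  have [y0|y0] := leP 0 (x 0 1).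
    exists (vec3 0 1 0); first by right.
    by exists (x 0 0) => //; apply: xE; rewrite ger0_norm in h1.
  exists (vec3 0 (-1) 0); first by left.
  by exists (x 0 0) => //; apply: xE; rewrite ltr0_norm // in h1; rewrite -h1 opprK.
- move=> [z hz [t ht <-]]; rewrite xcoordE.
  have e2 : (z + t *: ex R) 0 2%:R = 0 by case: hz => ->; rewrite !mxE /=; ring.
  have e0 : (z + t *: ex R) 0 0 = t by case: hz => ->; rewrite !mxE /=; ring.
  have e1 : `|(z + t *: ex R) 0 1| = 1.
    by case: hz => ->; rewrite !mxE /= mulr0 addr0 ?normrN normr1.
  rewrite e0; split=> //; split=> //.
  rewrite /square e0 e1 max_r ?subrr //; move: ht; clear; lra.
Qed.

(** The sign e = 1 selects the left half and e = -1 the right one, so both halves share one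
    construction. *)
Definition beads (R : realType) (T : finType) (v : T -> 'rV[R]_3) (e : R) : finType :=
  {i : T | e * v i 0 0 < 0}.

Lemma hooked_half (R : realType) (T : finType) (F : 'rV[R]_3 -> R) (v n : T -> 'rV[R]_3) (e : R) :
  `|e| = 1 -> (forall i, 1 <= `|v i 0 0|) -> hooked F v n ->
  hooked (fun x => Num.max (F x) (e * x 0 0))
    (fun i : beads v e => v (val i)) (fun i => n (val i)).
Proof.
move=> e1 hv [h1 h2 h3 h4 h5 h6 h7]; split=> //.
- by apply: body_max => //; [exact: cont_coordZ|exact: convex_coord].
- by move=> [i hi] /=; rewrite gt_max h5.
(* The bead is at least 1 away from the cutting plane and [n i] has length 1, so [v i + n i] does
   not cross it and the second entry of the maximum is nonpositive. *)
- move=> [i hi] /=; rewrite h6; apply/eqP; rewrite eq_le le_max lexx andbT ge_max lexx /= mxE.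
  have : `|e * v i 0 0| = `|v i 0 0| by rewrite normrM e1 mul1r.
  rewrite ltr0_norm // => ev.
  have := ler_norm (e * n i 0 0); rewrite normrM e1 mul1r => en.
  have := coord_le_enorm (n i) 0; have /enorm1 -> := h4 i => n1.
  have := hv i; move: ev en n1; rewrite mulrDr; clear; lra.
- by move=> i j ij; apply: h7; rewrite val_eqE.
Qed.

(* Deforming the body to a square makes its boundary cross the cutting plane
   along straight segments. *)
Lemma necklace_cut (R : realType) (T : finType) (F : 'rV[R]_3 -> R) (v n : T -> 'rV[R]_3) :
  hooked F v n -> F 0 < 0 -> (forall i, 5 / 2 <= `|v i 0 0|) ->
  (forall e : R, `|e| = 1 -> hopf_sum #|beads v e|
    (necklace (fun x => Num.max (F x) (e * x 0 0))
       (fun i : beads v e => v (val i)) (fun i => n (val i)))) ->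
  hopf_sum #|T| (necklace F v n).
Proof.
move=> hk F0 hv IH; have [hF _ _ n1 vin von _] := hk.
have S0 : square (0 : 'rV[R]_3) < 0.
  by rewrite /square !mxE normr0 max_l // sub0r oppr_lt0.
have [H [H' [iso [_ HK] Hk Hs _]]] := radial_isotopy hF F0 (body_square R) S0.
have cardE : #|T| = (#|beads v 1%R| + #|beads v (-1)%R|)%N.
  rewrite !card_sig -(cardC [pred i | 1 * v i 0 0 < 0]); congr addn; apply: eq_card => i.
  rewrite !inE mul1r mulN1r oppr_lt0 -leNgt le_eqVlt; case: eqVneq => [e|//].
  by have := hv i; rewrite -e normr0; lra.
have H2 := radial_height Hk.
(* The deformation multiplies the x-coordinate by a positive factor, so it respects both halves and
   matches the cut bodies as well. *)
have Hlvl (e : R) : H @` [set x : 'rV[R]_3 | x 0 2%:R = 0 /\ Num.max (F x) (e * x 0 0) = 0] =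
    [set x : 'rV[R]_3 | x 0 2%:R = 0 /\ Num.max (square x) (e * x 0 0) = 0].
  apply: (image_level HK H2) => x x2; have [s1 s2] := Hs x x2.
  have [k k0 Hx] := Hk x; have h0 : H x 0 0 = k * x 0 0 by rewrite Hx !mxE /=; ring.
  by rewrite !gt_max !ge_max s1 s2 h0 mulrCA (pmulr_rlt0 _ k0) (pmulr_rle0 _ k0).
have Hsq : H @` [set x : 'rV[R]_3 | x 0 2%:R = 0 /\ F x = 0] =
    [set x : 'rV[R]_3 | x 0 2%:R = 0 /\ square x = 0] by exact: image_level.
(* A circle extends at most 2 from its bead in the x-direction, less than the clearance 5 / 2. *)
have Hmer (e : R) (i : T) (x : 'rV[R]_3) : `|e| = 1 -> e * v i 0 0 < 0 ->
    H @` meridian (ez R) (v i) (n i) `<=` [set x | e * xcoord x < 0].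
  move=> e1 hi _ [y [r [s [rs ->]]] <-] /=; rewrite xcoordE.
  have [k k0 ->] := Hk (v i + r *: n i + s *: ez R).
  have -> : (k *: pl (v i + r *: n i + s *: ez R) + (v i + r *: n i + s *: ez R) 0 2%:R *: ez R) 0 0
      = k * (v i 0 0 + r * n i 0 0) by rewrite !mxE /=; ring.
  rewrite mulrCA pmulr_rlt0 // mulrDr.
  have : `|e * v i 0 0| = `|v i 0 0| by rewrite normrM e1 mul1r.
  rewrite ltr0_norm // => ev.
  have := ler_norm (e * (r * n i 0 0)); rewrite !normrM e1 mul1r => en.
  have := coord_le_enorm (n i) 0; have /enorm1 -> := n1 i => n0.
  have [r0 r2] := meridian_bounds rs; rewrite (ger0_norm r0) in en.
  have : r * `|n i 0 0| <= 2 by have := normr_ge0 (n i 0 0); nra.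
  have := hv i; move: ev en; clear; lra.
apply: (hopf_iso (iso _ _)).
have piece (e : R) : `|e| = 1 -> hopf_sum #|beads v e| (fun o => H @` necklace
    (fun x => Num.max (F x) (e * x 0 0)) (fun i : beads v e => v (val i)) (fun i => n (val i)) o).
  by move=> e1; apply: hopf_sum_isotopic (IH e e1) (iso _ _).
have p1 : `|1 : R| = 1 by rewrite normr1.
have m1 : `|-1 : R| = 1 by rewrite normrN normr1.
rewrite cardE; apply: (hopf_sumD (piece 1 p1) (piece (-1) m1)).
exists (option_map val), (option_map val), None, None, (vec3 0 (-1) 0), (vec3 0 1 0), (1 / 2).
split.
- split=> //.
  + by move=> [i|] [j|] //= [/val_inj ->].
  + by move=> [i|] [j|] //= [/val_inj ->].
  + move=> [[i hi]|] [[j hj]|] //= [ij]; exfalso; move: hi hj; rewrite ij mul1r mulN1r oppr_lt0.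
    by move=> /lt_trans h /h; rewrite ltxx.
  + move=> [i|]; last by left; exists None.
    have [h|h] := boolP (1 * v i 0 0 < 0); first by left; exists (Some (exist _ i h)).
    right; have h' : -1 * v i 0 0 < 0.
      move: h; rewrite mul1r mulN1r oppr_lt0 -leNgt le_eqVlt => /orP[/eqP e|//].
      by have := hv i; rewrite -e normr0; lra.
    by exists (Some (exist _ i h')).
- split; rewrite ?xcoordE ?vec3E //.
  + apply/eqP => /(congr1 (fun x : 'rV[R]_3 => x 0 1)); rewrite !vec3E; lra.
  + by rewrite /= Hsq square_cross.
- rewrite /= !Hlvl !square_half ?oppr_eq0 ?oner_eq0 // Hsq; split; congr ((_ `&` _) `|` _);
    apply/funext => x; apply/propext => /=; rewrite xcoordE ?mul1r ?mulN1r ?oppr_le0 //.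
- move=> [[i hi]|] //= _; split=> // x hx.
  by have := Hmer 1 i x p1 hi x hx; rewrite /= mul1r.
- move=> [[i hi]|] //= _; split=> // x hx.
  by have := Hmer (-1) i x m1 hi x hx; rewrite /= mulN1r oppr_lt0.
Qed.

(** The induction is on a bound [m], as the numbers of beads on the two sides of the cut are not
    known in advance. Both are smaller than the total, because [i0] and [j0] end up on different
    sides. *)
Lemma necklace_hopf (R : realType) m (T : finType) (F : 'rV[R]_3 -> R) (v n : T -> 'rV[R]_3) :
  (0 < #|T| <= m)%N -> hooked F v n -> hopf_sum #|T| (necklace F v n).
Proof.
elim: m T F v n => [|m IH] T F v n /andP[T0 Tm] hk; first by have := leq_trans T0 Tm.
have [T1|T1] := leqP #|T| 1.
  have /fintype1 [i0 hi] : #|T| = 1%N by apply/eqP; rewrite eqn_leq T1.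
  have -> : #|T| = 1%N by apply/eqP; rewrite eqn_leq T1.
  apply: (@necklace_translate _ _ _ _ _ (v i0)); first exact: (hk_v hk).
  apply: (@necklace_base _ _ _ _ _ i0) => //; first by rewrite subrr.
  by apply: hooked_translate => //; exact: (hk_v hk).
have [i0 [j0 lij]] : exists i j, v i 0 0 < v j 0 0.
  have [i [j [_ _ ij]]] := card_gt1P T1.
  have := hk_far hk ij; have [h|h|h] := ltgtP (v i 0 0) (v j 0 0).
  - by exists i, j.
  - by exists j, i.
  - by rewrite h subrr normr0; lra.
have gap : 5 <= v j0 0 0 - v i0 0 0.
  have ij : j0 != i0 by apply: contraTneq lij => ->; rewrite ltxx.
  by have := hk_far hk ij; rewrite gtr0_norm // subr_gt0.
(* The new origin lies on the segment from [v i0] to [v j0], hence inside the body, and 5 / 2 past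
   [v i0] in x. Every other bead is at least 5 from [v i0] in x, so all beads keep 5 / 2 from the
   cutting plane. *)
pose d := v j0 0 0 - v i0 0 0; pose t := 5 / 2 / d.
have d0 : 0 < d by rewrite /d; move: gap; clear; lra.
have t0 : 0 < t by rewrite /t !divr_gt0.
have t1 : t < 1 by rewrite /t ltr_pdivrMr // /d; move: gap; clear; lra.
pose o := (1 - t) *: v i0 + t *: v j0.
have o2 : o 0 2%:R = 0 by rewrite !mxE !(hk_v hk); ring.
have o0 : o 0 0 = v i0 0 0 + 5 / 2.
  have td : t * d = 5 / 2 by rewrite /t divfK // gt_eqF.
  by rewrite -td /o /d !mxE; ring.
have Fo : F o < 0.
  apply: le_lt_trans (body_convex (hk_body hk) _ _ _) _; first by rewrite (ltW t0) (ltW t1).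
  have := hk_in hk i0; have := hk_in hk j0; move: t0 t1; clear => *; nra.
apply: (necklace_translate o2); have hk' := hooked_translate o2 hk.
have far i : 5 / 2 <= `|(v i - o) 0 0|.
  rewrite mxE [(- o) 0 0]mxE o0; have [->|ne] := eqVneq i i0.
    by rewrite opprD addrA subrr add0r normrN ger0_norm //; lra.
  have := hk_far hk ne; rewrite !ler_normr => /orP[h|h]; apply/orP; [left|right]; move: h; clear; lra.
apply: (necklace_cut hk' _ far); first by rewrite add0r.
move=> e e1; apply: IH; last first.
  by apply: (hooked_half e1 _ hk') => i; apply: le_trans (far i); lra.
have ei : e * (v i0 - o) 0 0 = - (5 / 2 * e) by rewrite mxE [(- o) 0 0]mxE o0; ring.
have oj : 5 / 2 <= (v j0 - o) 0 0 by rewrite mxE [(- o) 0 0]mxE o0; move: gap; clear; lra.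
have ec : e = 1 \/ e = -1.
  by move/eqP: e1; rewrite eqr_norml => /andP[/orP[]/eqP -> _]; [left|right].
rewrite card_sig; apply/andP; split.
  by apply/card_gt0P; case: ec => ec; [exists i0|exists j0]; rewrite inE; move: ei oj; rewrite ec; lra.
rewrite -ltnS; apply: leq_trans Tm; rewrite -(cardC [pred i | e * (v i - o) 0 0 < 0]).
rewrite -[X in (X < _)%N]addn0 ltn_add2l; apply/card_gt0P.
by case: ec => ec; [exists j0|exists i0]; rewrite !inE -leNgt; move: ei oj; rewrite ec; lra.
Qed.

(** * From the star configuration to a necklace with distant beads *)

Lemma proj_shift (R : realType) (C : set 'rV[R]_3) pr x y (a : R) : projection C pr -> 0 <= a ->
  y - pr x = a *: (x - pr x) -> pr y = pr x.
Proof.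
move=> hp a0 e; have [Cx nx] := hp x; apply: (proj_eq hp Cx) => q Cq.
by rewrite e dotZl mulr_ge0_le0 //; exact: nx.
Qed.

(* Spreads the vertices apart while translating each meridian rigidly. *)
Definition expand (R : realType) (pr : 'rV[R]_3 -> 'rV[R]_3) (a : R) (x : 'rV[R]_3) :=
  x + a *: pr x.
Definition shrink (R : realType) (pr : 'rV[R]_3 -> 'rV[R]_3) (a : R) (y : 'rV[R]_3) :=
  y - a *: pr ((1 + a)^-1 *: y).

(** Scaled back by 1 + a, the expanded point lies on the normal ray at [pr x], so its projection
    recovers [pr x]; this is what makes [shrink] the inverse. *)
Lemma proj_expand (R : realType) (C : set 'rV[R]_3) pr (a : R) x : projection C pr -> 0 <= a ->
  pr ((1 + a)^-1 *: expand pr a x) = pr x.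
Proof.
move=> hp a0; have h : 0 < 1 + a by rewrite ltr_pwDl.
apply: (proj_shift (a := (1 + a)^-1) hp); first by rewrite invr_ge0 ltW.
have h' : 1 + a != 0 by rewrite gt_eqF.
by rewrite /expand; apply: rV3P; rewrite !mxE; field.
Qed.

Lemma proj_shrink (R : realType) (C : set 'rV[R]_3) pr (a : R) y : projection C pr -> 0 <= a ->
  pr (shrink pr a y) = pr ((1 + a)^-1 *: y).
Proof.
move=> hp a0; have h : 0 < 1 + a by rewrite ltr_pwDl.
apply: (proj_shift (a := 1 + a) hp); first exact: ltW.
have h' : 1 + a != 0 by rewrite gt_eqF.
by rewrite /shrink; apply: rV3P; rewrite !mxE; field.
Qed.

Lemma expandK (R : realType) (C : set 'rV[R]_3) pr (a : R) : projection C pr -> 0 <= a ->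
  cancel (expand pr a) (shrink pr a).
Proof. by move=> hp a0 x; rewrite /shrink (proj_expand _ hp) // addrK. Qed.

Lemma shrinkK (R : realType) (C : set 'rV[R]_3) pr (a : R) : projection C pr -> 0 <= a ->
  cancel (shrink pr a) (expand pr a).
Proof. by move=> hp a0 x; rewrite /expand (proj_shrink _ hp) // subrK. Qed.

Lemma expand_isotopy (R : realType) (C : set 'rV[R]_3) pr (a : R) (I : Type) (L : I -> set 'rV[R]_3) :
  projection C pr -> 0 <= a ->
  ambient_isotopic L (fun i => expand pr a @` L i).
Proof.
move=> hp a0; have := @isotopyI R (fun t => expand pr (t * a)) I L; rewrite mul1r; apply.
- move=> t x _ /=.
  have c1 := contM (@contFst _ _ (t, x)) (@contC (R * 'rV[R]_3)%type R a (t, x)).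
  have c2 : {for (t, x), continuous (fun z : R * 'rV[R]_3 => pr z.2)}.
    by apply: (@contcomp _ _ _ snd pr); [exact: contSnd|exact: (proj_cont hp)].
  exact: (contD (@contSnd _ _ (t, x)) (contZ c1 c2)).
- move=> t /andP[t0 _]; have ta : 0 <= t * a by rewrite mulr_ge0.
  have cp := proj_cont hp; split.
    move=> x; exact: (contD (@contI _ x) (contZ (@contC _ _ (t * a) x) (cp x))).
  exists (shrink pr (t * a)); split; [move=> x|exact: (expandK hp)|exact: (shrinkK hp)].
  have c1 : {for x, continuous (fun y : 'rV[R]_3 => (1 + t * a)^-1 *: y)}.
    by apply: contZ; [exact: contC|exact: contI].
  have c2 := @contcomp _ _ _ _ pr x c1 (cp _).
  exact: (contB (@contI _ x) (contZ (@contC _ _ (t * a) x) c2)).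
- by move=> x; rewrite /expand mul0r scale0r addr0.
Qed.

Lemma proj_nearest (R : realType) (C : set 'rV[R]_3) pr x q : projection C pr ->
  C q -> enorm (x - pr x) <= enorm (x - q).
Proof. by move=> hp Cq; rewrite -(proj_dist x hp); exact: dist_to_set_le. Qed.

Lemma proj_convex (R : realType) (C : set 'rV[R]_3) pr : projection C pr ->
  convex_rV C -> convex_fun (fun x => enorm (x - pr x)).
Proof.
move=> hp vC x y t /andP[t0 t1].
have [[Cx _] [Cy _]] := (hp x, hp y).
have Cz : C (pr x + t *: (pr y - pr x)) by apply: vC => //; rewrite t0.
apply: le_trans (proj_nearest _ hp Cz) _.
have -> : (1 - t) *: x + t *: y - (pr x + t *: (pr y - pr x)) =
    (1 - t) *: (x - pr x) + t *: (y - pr y) by apply: rV3P; rewrite !mxE; ring.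
apply: le_trans (enormD _ _) _; rewrite !enormZ ger0_norm ?subr_ge0 //.
by rewrite ger0_norm.
Qed.

Lemma region_bounded (R : realType) n (v : 'I_n -> 'rV[R]_3) x :
  polygon_region v x -> enorm x <= \sum_i enorm (v i).
Proof.
move=> [a [a0 a1 ->]].
have h : enorm (\sum_i a i *: v i) <= \sum_i enorm (a i *: v i).
  elim/big_ind2: _ => [|x1 y1 x2 y2 h1 h2|//]; first by rewrite enorm0.
  by apply: le_trans (enormD _ _) _; exact: lerD.
apply: le_trans h _; apply: ler_sum => i _; rewrite enormZ ger0_norm //.
rewrite -[leRHS]mul1r ler_wpM2r ?enorm_ge0 // -a1 (bigD1 i) //= lerDl.
by apply: sumr_ge0.
Qed.

(* Along a + s b, each pair of points excludes at most one value of s. *)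
Lemma generic_direction (R : realType) (I : finType) (u a : 'rV[R]_3) (w : I -> I -> 'rV[R]_3) :
  dot u u = 1 -> dot a a = 1 -> dot u a = 0 -> (forall i j, dot u (w i j) = 0) ->
  exists d, [/\ dot d d = 1, dot d u = 0 & forall i j, w i j != 0 -> dot d (w i j) != 0].
Proof.
move=> hu ha ua hw; pose b := cross u a.
have bb : dot b b = 1 by rewrite /b dot_cross2 hu ha ua; ring.
have ab : dot a b = 0 by exact: dot_crossr.
have ub : dot u b = 0 by exact: dot_crossl.
(* Bounds the absolute values of all excluded s, so that s = 1 + S is admissible; pairs with <b, w>
   = 0 contribute 0 through the quotient by 0. *)
pose S := \sum_i \sum_j `|dot a (w i j) / dot b (w i j)|.
have S0 : 0 <= S by apply: sumr_ge0 => i _; apply: sumr_ge0 => j _.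
have hS i j : `|dot a (w i j) / dot b (w i j)| <= S.
  rewrite /S (bigD1 i) //= (bigD1 j) //= -addrA lerDl addr_ge0 //.
    by apply: sumr_ge0.
  by apply: sumr_ge0 => k _; apply: sumr_ge0 => m _.
pose s := 1 + S; pose e := a + s *: b.
have ee : dot e e = 1 + s ^+ 2.
  by rewrite /e dotDD !dotZr dotZl ha bb ab; ring.
have e0 : e != 0.
  apply/eqP => h; move: ee; rewrite h dot0l => h2.
  by have := sqr_ge0 s; lra.
have en0 := enorm_gt0 e0.
exists ((enorm e)^-1 *: e); split.
- by rewrite dotZl dotZr -enorm2; field; rewrite gt_eqF.
- by rewrite dotZl /e dotC dotDr dotZr ua ub mulr0 addr0 mulr0.
- move=> i j w0; rewrite dotZl; apply: mulf_neq0; first by rewrite invr_neq0 // gt_eqF.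
  apply/eqP; rewrite /e dotDl dotZl => h.
  have [b0|b0] := eqVneq (dot b (w i j)) 0.
    have := @plane_decomp R u a (w i j) hu ha ua (hw i j).
    move: h; rewrite -/b (dotC _ a) (dotC _ b) b0 mulr0 addr0 => -> z.
    by move/eqP: w0; apply; rewrite z !scale0r addr0.
  have := hS i j; have -> : dot a (w i j) / dot b (w i j) = - s.
    have : dot a (w i j) = - s * dot b (w i j) by move: h; clear; lra.
    by move=> ->; rewrite mulfK.
  by rewrite normrN ger0_norm /s; move: S0; clear; lra.
Qed.

Lemma rigid_inv (R : realType) (f : 'rV[R]_3 -> 'rV[R]_3) : rigid f ->
  exists g, [/\ cancel g f, cancel f g,
    forall (a b : R) x y, g (a *: x + b *: y) = a *: g x + b *: g y &
    forall x y, dot (g x) (g y) = dot x y].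
Proof.
move=> hf; have [g gK] := choice (rg_surj hf).
have inj : injective f.
  move=> x y e; apply/eqP; rewrite -subr_eq0; apply/eqP/dotxx_eq0.
  rewrite -(rg_dot hf) (_ : x - y = 1 *: x + (-1) *: y); last by rewrite scale1r scaleN1r.
  by rewrite (rg_lin hf) e scale1r scaleN1r subrr dot0l.
exists g; split=> //.
- by move=> x; apply: inj; rewrite gK.
- by move=> a b x y; apply: inj; rewrite (rg_lin hf) !gK.
- by move=> x y; rewrite -(rg_dot hf) !gK.
Qed.

(** The function is the distance from [g y] to the region translated by [- o] and dilated by [c],
    minus 1; its convexity is that of the distance to a convex set. *)
Lemma body_neighbourhood (R : realType) n (v : 'I_n -> 'rV[R]_3) pr (g : 'rV[R]_3 -> 'rV[R]_3)
    (o : 'rV[R]_3) (c : R) : projection (polygon_region v) pr -> 0 < c ->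
  (forall (a b : R) x y, g (a *: x + b *: y) = a *: g x + b *: g y) ->
  (forall x y, dot (g x) (g y) = dot x y) ->
  body (fun y => c * enorm (c^-1 *: g y + o - pr (c^-1 *: g y + o)) - 1).
Proof.
move=> hp c0 gl gd.
have gn x : enorm (g x) = enorm x by rewrite /enorm gd.
have gB x y : g x - g y = g (x - y).
  by rewrite -[x - y]scale1r -[1 *: _](scale1r) scalerBr !scale1r
    (_ : x - y = 1 *: x + (-1) *: y) ?gl ?scale1r ?scaleN1r.
have cg : continuous g by apply: (@elip _ _ 1) => // x y; rewrite mul1r gB gn.
have cw (x : 'rV[R]_3) : {for x, continuous (fun y : 'rV[R]_3 => c^-1 *: g y + o)}.
  by apply: contD; [apply: contZ; [exact: contC|exact: cg]|exact: contC].
split.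
- move=> x; have cp : {for c^-1 *: g x + o, continuous pr} by exact: (proj_cont hp).
  have c1 := @contcomp _ _ _ _ pr x (cw x) cp.
  have ce (y : 'rV[R]_3) : {for y, continuous (@enorm R)} by exact: enorm_cont.
  have c2 := @contcomp _ _ _ _ (@enorm R) x (contB (cw x) c1) (ce _).
  exact: (contB (contM (@contC _ _ c x) c2) (@contC _ _ (1 : R) x)).
- apply: convex_shift => x y t ht.
  have := proj_convex hp (@region_convex _ _ v) (c^-1 *: g x + o) (c^-1 *: g y + o) ht.
  rewrite (_ : (1 - t) *: (c^-1 *: g x + o) + _ = c^-1 *: g ((1 - t) *: x + t *: y) + o); last first.
    by rewrite gl; apply: rV3P; rewrite !mxE; ring.
  move=> h; apply: le_trans (ler_wpM2l (ltW c0) h) _.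
  by rewrite mulrDr mulrCA (mulrCA c t).
- exists (c * (c^-1 + \sum_i enorm (v i) + enorm o)) => x _.
  set w := c^-1 *: g x + o; rewrite subr_le0 mulrC -ler_pdivlMr // mul1r => h.
  have [hC _] := hp w; have hb := region_bounded hC.
  have -> : enorm x = c * enorm (w - o).
    by rewrite /w addrK enormZ gn gtr0_norm ?invr_gt0 // mulrA mulfV ?mul1r // gt_eqF.
  rewrite ler_pM2l //; have := enormD (w - pr w) (pr w - o).
  rewrite addrA subrK => h1; have := enormD (pr w) (- o); rewrite enormN.
  move: h1 h hb; clear; lra.
Qed.

Lemma star_hopf (R : realType) (n : nat) (u : 'rV[R]_3) (v k : 'I_n -> 'rV[R]_3) pr
    (L : 'I_n.+1 -> set 'rV[R]_3) :
  (0 < n)%N -> star_config u v k pr -> L ord0 = parallel_set u v pr ->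
  (forall i, L (lift ord0 i) = meridian u (v i) (k i)) -> hopf_sum n L.
Proof.
move=> n0 hc hL0 hLi; have [hu hpl hs _ _] := sc_orient hc; have hp := sc_proj hc.
have k1 := sc_unit hc; have uk := sc_plane hc.
pose i0 := Ordinal n0; pose o := v i0; pose w i j := v j - v i.
have [d [dd du dw]] := generic_direction hu (hs i0) (hpl _ _) hpl.
(* Expanding by [tau] multiplies differences of vertices by 1 + [tau], which brings their
   coordinates along [d] at least 5 apart, as [hooked] asks. Equal indices contribute 5 / 0 = 0. *)
pose tau := \sum_i \sum_j 5 / `|dot d (w i j)|.
have q0 i j : 0 <= 5 / `|dot d (w i j)| by rewrite divr_ge0.
have hq i j : 5 / `|dot d (w i j)| <= tau.
  rewrite /tau (bigD1 i) //= (bigD1 j) //= -addrA lerDl addr_ge0 //.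
    by apply: sumr_ge0 => m _; exact: q0.
  by apply: sumr_ge0 => m _; apply: sumr_ge0 => l _; exact: q0.
have t0 : 0 <= tau by apply: sumr_ge0 => m _; apply: sumr_ge0 => l _; exact: q0.
pose c := 1 + tau; have c0 : 0 < c by rewrite /c ltr_pwDl.
have cn : c != 0 by rewrite gt_eqF.
have far i j : i != j -> 5 <= c * `|dot d (w i j)|.
  move=> ij; have wn : w i j != 0.
    by apply/eqP => e; have := sc_dist hc ij; rewrite -/(w i j) e dot0l; lra.
  rewrite -ler_pdivrMr ?normr_gt0 ?dw //; apply: le_trans (hq i j) _.
  by rewrite /c lerDr.
have [f [hf fd fu]] := frame dd hu du.
have [g [gK fK gl gd]] := rigid_inv hf.
have f2 x : f x 0 2%:R = dot u x.
  by rewrite -(rg_dot hf) fu dotE !mxE /=; ring.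
have f0 x : f x 0 0 = dot d x.
  by rewrite -(rg_dot hf) fd dotE !mxE /=; ring.
have fD x y : f (x + y) = f x + f y.
  by have := rg_lin hf 1 1 x y; rewrite !scale1r.
have fZ (a : R) x : f (a *: x) = a *: f x.
  by have := rg_lin hf a 0 x 0; rewrite !scale0r !addr0.
pose W y := c^-1 *: g y + o.
pose F y := c * enorm (W y - pr (W y)) - 1.
pose v' i := f (c *: (v i - o)); pose n' i := f (k i).
have prv i r s : 0 <= r -> pr (v i + r *: k i + s *: u) = v i.
  move=> r0; apply: (proj_eq hp); first exact: region_vertex.
  move=> q hq'; rewrite (_ : _ - v i = r *: k i + s *: u); last first.
    by apply: rV3P; rewrite !mxE; ring.
  rewrite dotDl !dotZl (region_plane i hpl hq') mulr0 addr0.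
  by rewrite mulr_ge0_le0 //; exact: (sc_normal hc).
have Wv i r : W (f (c *: (v i - o) + r *: k i)) = v i + (r / c) *: k i + 0 *: u.
  by rewrite /W fK; apply: rV3P; rewrite !mxE; field.
have hk : hooked F v' n'.
  split.
  - exact: body_neighbourhood.
  - by move=> i; rewrite /v' f2 dotZr hpl mulr0.
  - by move=> i; rewrite /n' f2.
  - by move=> i; rewrite /n' (rg_dot hf).
  - move=> i; rewrite /F /v'; have := Wv i 0; rewrite scale0r addr0 => ->.
    rewrite prv ?mul0r // !scale0r !addr0 subrr enorm0 mulr0 sub0r.
    by rewrite oppr_lt0.
  - move=> i; rewrite /F /v' /n'.
    have -> : f (c *: (v i - o)) + f (k i) = f (c *: (v i - o) + 1 *: k i).
      by rewrite fD scale1r.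
    rewrite Wv prv ?divr_ge0 ?ltW //.
    rewrite (_ : _ - v i = (1 / c) *: k i); last by apply: rV3P; rewrite !mxE; ring.
    rewrite enormZ; have /enorm1 -> := k1 i; rewrite gtr0_norm ?divr_gt0 // mulr1.
    by rewrite mulrC divfK // subrr.
  - move=> i j ij; rewrite /v' !f0 !dotZr -mulrBr normrM gtr0_norm //.
    rewrite (_ : _ - dot d (v j - o) = - dot d (w i j)).
      by rewrite normrN; exact: far.
    by rewrite /w ![dot d (_ - _)]dotDr !dotNr; ring.
pose h (x : option 'I_n) : 'I_n.+1 := if x is Some i then lift ord0 i else ord0.
have hK : cancel h (unlift ord0) by move=> [i|] /=; rewrite ?liftK ?unlift_none.
have Kh : cancel (unlift ord0) h by move=> i; case: unliftP => [j|] ->.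
have card : (0 < #|'I_n| <= n)%N by rewrite card_ord n0 leqnn.
have := hopf_relabel (necklace_hopf card hk) hK Kh; rewrite card_ord => hN.
apply: (hopf_iso (expand_isotopy L hp t0)).
apply: (hopf_iso (translation_isotopy (- (c *: o)) _)).
apply: (rg_hopf hf); move: hN.
rewrite (_ : necklace F v' n' \o _ = fun i => f @` ((fun x => x - c *: o) @` (expand pr tau @` L i))) //.
apply/funext => i /=; rewrite !image_comp; case: unliftP => [j|] -> /=.
- have key r s : 0 <= r -> f (expand pr tau (v j + r *: k j + s *: u) - c *: o) = v' j + r *: n' j + s *: ez R.
    move=> r0; rewrite /expand prv // /v' /n' -fu -!fZ -!fD.
    by congr f; apply: rV3P; rewrite !mxE; rewrite /c; ring.
  rewrite hLi; apply/seteqP; split=> y /=.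
    move=> [r [s [e ->]]]; have [r0 _] := meridian_bounds e.
    by exists (v j + r *: k j + s *: u); [exists r, s|exact: key].
  move=> [_ [r [s [e ->]]] <-]; have [r0 _] := meridian_bounds e.
  by exists r, s; split=> //; exact: key.
(* Expansion leaves [x - pr x] unchanged while it dilates the polygon, so the expanded curve is
   still at distance 1 from the dilated polygon. *)
- pose y x := f (expand pr tau x - c *: o).
  have yF x : F (y x) = enorm (x - pr x) - 1.
    have wE : W (y x) = c^-1 *: expand pr tau x.
      by rewrite /W /y fK; apply: rV3P; rewrite !mxE; field.
    have pE : pr (W (y x)) = pr x by rewrite wE (proj_expand _ hp).
    rewrite /F pE wE (_ : _ - pr x = c^-1 *: (x - pr x)).
      by rewrite enormZ gtr0_norm ?invr_gt0 // mulrA mulfV // mul1r.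
    have c1 : 1 + tau != 0 by exact: cn.
    by rewrite /expand /c; apply: rV3P; rewrite !mxE; field.
  have y2 x : y x 0 2%:R = dot u (x - o).
    have px : dot u (pr x - o) = 0 by apply: region_plane => //; have [] := hp x.
    rewrite /y f2 (_ : expand pr tau x - c *: o = (x - o) + tau *: (pr x - o)).
      by rewrite dotDr dotZr px mulr0 addr0.
    by rewrite /expand /c; apply: rV3P; rewrite !mxE; ring.
  rewrite hL0; apply/seteqP; split=> z /=.
    have zE : y (shrink pr tau (g z + c *: o)) = z by rewrite /y (shrinkK hp) // addrK gK.
    rewrite -{1 2}zE yF y2; set x := shrink pr tau _ => -[h1 h2].
    exists x; last exact: zE.
    split=> [i'|]; last by apply/enorm1; move: h2; clear; lra.
    have -> : x - v i' = (x - o) + (o - v i') by rewrite addrA subrK.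
    by rewrite dotDr h1 hpl addr0.
  by move=> [x [h1 /enorm1 h2] <-]; rewrite yF y2 h1 h2 subrr.
Qed.

Theorem proposition7p2 (R : realType) (n : nat) (u : 'rV[R]_3)
    (v : 'I_n -> 'rV[R]_3) (c w : 'I_n -> 'rV[R]_3)
    (l : 'I_n.+1 -> R) (gamma : 'I_n.+1 -> R -> 'rV[R]_3)
    (hn : (3 <= n)%N)
    (hP : convex_planar_polygon u v)
    (hside : forall i, enorm (side v i) = 1)
    (hangle : forall i, 0 <= turning_angle v i <= 2 * pi / 3)
    (hL0 : simple_arclength_param (outer_parallel_curve u v 1)
             (l ord0) (gamma ord0))
    (hc : forall i, outer_parallel_curve u v 1 (c i))
    (hw : forall i, w i != 0 /\ dot (w i) u = 0)
    (hthrough : forall i, unit_circle (c i) (w i) (v i))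
    (hL : forall i, simple_arclength_param (unit_circle (c i) (w i))
             (l (lift ord0 i)) (gamma (lift ord0 i))) :
  [/\ is_H (@star n) (fun i => range (gamma i)),
      LThi (fun i => range (gamma i)) = 1 &
      link_critical l gamma].
Proof.
have [u' [k [pr [hc0 eL0 _ eLi]]]] := star_setup hn hP hside hangle hc hw hthrough.
have r0 : range (gamma ord0) = parallel_set u' v pr by rewrite -eL0; have [_ _ ->] := hL0.
have ri i : range (gamma (lift ord0 i)) = meridian u' (v i) (k i).
  by rewrite -eLi; have [_ _ ->] := hL i.
have n1 : (1 < n)%N by apply: ltn_trans hn.
split.
- split; first by apply: (@star_hopf R n u' v k pr (fun i => range (gamma i)) (ltnW n1) hc0 r0 ri).
  exact: (@star_linked R n u' v k pr (fun i => range (gamma i)) hc0 r0 ri).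
- by have [] := @star_thickness R n u' v k pr (fun i => range (gamma i)) n1 hc0 r0 ri.
- apply: (star_critical n1 hc0); first by rewrite -eL0.
  by move=> i; rewrite -eLi.
Qed.
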